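(* Let $b$ be a real-valued continuous almost periodic function on $\mathbb{R}^2$ with mean value $b_0$, let $V$ be a continuous almost periodic function on $\mathbb{R}^2$ with values in the Hermitian $2\times 2$ matrices, put $A_0(x)=\big(-\tfrac{b_0x_2}{2},\tfrac{b_0x_1}{2}\big)$, and assume that there exists an almost periodic vector field $\widetilde A\in CAP(\mathbb{R}^2;\mathbb{R}^2)$, of class $C^1$, such that $\operatorname{curl}(A_0+\widetilde A)=b$. Let $\{\mathcal{H}_\omega\}_{\omega\in\mathbb{B}^2}$ be the associated family of self-adjoint Pauli operators in $L^2(\mathbb{R}^2;\mathbb{C}^2)$ (see context), and let $\Sigma\subset\mathbb{R}$ be the closed set such that $\sigma(\mathcal{H}_\omega)=\Sigma$ for $\mathbb{P}$-almost every $\omega\in\mathbb{B}^2$ (such a set exists). Then for every $\omega\in\mathbb{B}^2$, $$\sigma(\mathcal{H}_\omega)=\Sigma,\qquad \sigma_{\rm disc}(\mathcal{H}_\omega)=\emptyset .$$ In particular, the Pauli operator $H=\mathcal{H}_0$ with magnetic potential $A_0+\widetilde A$ and electric potential $V$ satisfies $\sigma_{\rm disc}(H)=\emptyset$.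
   Context: $CAP(\mathbb{R}^2)$ (continuous almost periodic functions) is the closure, in the space of bounded continuous functions on $\mathbb{R}^2$ with the sup norm, of the linear span of $e_\lambda(x)=e^{i\lambda\cdot x}$, $\lambda\in\mathbb{R}^2$; $CAP(\mathbb{R}^2;X)$ with $X=\mathbb{R},\mathbb{R}^2$ or $X=M_2$ (Hermitian $2\times2$ matrices) denotes $X$-valued functions with components in $CAP(\mathbb{R}^2)$. The mean value of $f\in CAP(\mathbb{R}^2)$ is $\lim_{T\to\infty}T^{-2}\int_{(-T/2,T/2)^2}f(x)\,dx$. For $A=(A_1,A_2)$, $\operatorname{curl}A=\partial_{x_1}A_2-\partial_{x_2}A_1$. $\mathbb{B}^2$ is the Bohr compactification of $\mathbb{R}^2$: a compact abelian group (written additively) with a continuous homomorphism $\iota:\mathbb{R}^2\to\mathbb{B}^2$ of dense image such that every $f\in CAP(\mathbb{R}^2)$ has a unique canonic extension $\phi\in C(\mathbb{B}^2)$ with $f=\phi\circ\iota$. $\mathbb{P}$ is the Haar probability measure on $\mathbb{B}^2$. Let $\alpha\in C(\mathbb{B}^2;\mathbb{R}^2)$, $\beta\in C(\mathbb{B}^2;\mathbb{R})$, $\Upsilon\in C(\mathbb{B}^2;M_2)$ be the canonic extensions of $\widetilde A,b,V$, and for $\omega\in\mathbb{B}^2$, $x\in\mathbb{R}^2$ set $\mathcal{A}_\omega(x)=\alpha(\omega+\iota(x))$, $\mathcal{B}_\omega(x)=\beta(\omega+\iota(x))$, $\mathcal{V}_\omega(x)=\Upsilon(\omega+\iota(x))$.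 For $A\in L^2_{\rm loc}(\mathbb{R}^2;\mathbb{R}^2)$, $(-i\nabla-A)^2$ denotes the self-adjoint operator in $L^2(\mathbb{R}^2)$ generated by the closure of the quadratic form $\int_{\mathbb{R}^2}|i\nabla u+Au|^2dx$, $u\in C_0^\infty(\mathbb{R}^2)$. Set $$\mathcal{H}_\omega^\pm=(-i\nabla-A_0-\mathcal{A}_\omega)^2\pm\mathcal{B}_\omega,\qquad \mathcal{H}_\omega=\begin{pmatrix}\mathcal{H}_\omega^-&0\\0&\mathcal{H}_\omega^+\end{pmatrix}+\mathcal{V}_\omega .$$ $\sigma_{\rm disc}$ is the set of isolated eigenvalues of finite multiplicity. *)

(* Defs.v *)
From HB Require Import structures.
From mathcomp Require Import all_boot all_order all_algebra.
From mathcomp Require Import all_classical all_reals all_analysis.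
From mathcomp Require Import complex.

Set Implicit Arguments.
Unset Strict Implicit.
Unset Printing Implicit Defensive.

Import Order.TTheory GRing.Theory Num.Theory.
Import numFieldNormedType.Exports.

Local Open Scope classical_set_scope.
Local Open Scope ring_scope.

(* R[i], seen as a numClosedFieldType so that it gets its norm topology. *)
Definition Cplx (R : realType) : numClosedFieldType := R[i].
Definition toC {R : realType} (r : R) : Cplx R := Complex r 0.
Definition reC {R : realType} (z : Cplx R) : R := complex.Re z.
Definition imC {R : realType} (z : Cplx R) : R := complex.Im z.
Definition imag {R : realType} : Cplx R := Complex 0 1.

Definition plane_measure (R : realType) :=
  (@lebesgue_measure R \x @lebesgue_measure R)%E.

Section Plane.
Variable R : realType.
Local Notation C := (Cplx R).
Local Notation plane := (R * R)%type.
Local Notation mu := (@plane_measure R).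

Definition expi (l x : plane) : C :=
  let t := l.1 * x.1 + l.2 * x.2 in Complex (cos t) (sin t).

Definition trig_polynomial (p : plane -> C) : Prop :=
  exists (n : nat) (c : 'I_n -> C) (l : 'I_n -> plane),
    p = fun x => \sum_(k < n) c k * expi (l k) x.

Definition CAP (f : plane -> C) : Prop :=
  [/\ continuous f, bounded_fun f &
      forall e : R, 0 < e -> exists2 p, trig_polynomial p &
        forall x, `|f x - p x| <= toC e].

Definition CAP_real (f : plane -> R) : Prop := CAP (toC \o f).

Definition CAP_vec (A : plane -> plane) : Prop :=
  CAP_real (fst \o A) /\ CAP_real (snd \o A).

Definition CAP_herm (V : plane -> 'M[C]_2) : Prop :=
  (forall x, V x \is hermsymmx) /\ forall i j, CAP (fun x => V x i j).

Definition has_mean_value (f : plane -> R) (m : R) : Prop :=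
  (T ^- 2 * Rintegral mu (`]- (T / 2), T / 2[ `*` `]- (T / 2), T / 2[) f)
    @[T --> +oo] --> m.

Definition e1 : plane := (1, 0).
Definition e2 : plane := (0, 1).

Fixpoint class_C (n : nat) (f : plane -> R) : Prop :=
  continuous f /\
  if n is m.+1 then
    [/\ forall x, derivable f x e1, forall x, derivable f x e2,
        class_C m ('D_e1 f) & class_C m ('D_e2 f)]
  else True.

Definition curl (A : plane -> plane) (x : plane) : R :=
  'D_e1 (snd \o A) x - 'D_e2 (fst \o A) x.

Definition test_function (u : plane -> C) : Prop :=
  [/\ forall n, class_C n (reC \o u), forall n, class_C n (imC \o u) &
      compact (closure [set x | u x != 0])].

Definition partialC (v : plane) (u : plane -> C) (x : plane) : C :=
  Complex ('D_v (reC \o u) x) ('D_v (imC \o u) x).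

(* Elements of L^2 are represented by functions; equality in L^2 is equality
   almost everywhere. *)

Definition cintegral (f : plane -> C) : C :=
  Complex (Rintegral mu setT (reC \o f)) (Rintegral mu setT (imC \o f)).

Definition abs2 (z : C) : R := reC z ^+ 2 + imC z ^+ 2.

Definition in_L2 (u : plane -> C) : Prop :=
  [/\ measurable_fun setT (reC \o u), measurable_fun setT (imC \o u) &
      (\int[mu]_x (abs2 (u x))%:E < +oo)%E].

Definition L2dot (u v : plane -> C) : C := cintegral (fun x => u x * (v x)^*).

Definition L2norm2 (u : plane -> C) : R :=
  Rintegral mu setT (fun x => abs2 (u x)).

Definition spinor := plane -> 'cV[C]_2.
Definition component (u : spinor) (i : 'I_2) : plane -> C := fun x => u x i 0.
Definition in_L2s (u : spinor) : Prop := forall i, in_L2 (component u i).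
Definition L2norm2s (u : spinor) : R := \sum_i L2norm2 (component u i).

(* An operator is given by its graph: [T u f] means that u is in the domain of T
   and T u = f. Graphs are stable under replacing u and f by a.e. equal functions
   of L^2. *)

Definition sesq_form := (plane -> C) -> (plane -> C) -> C.

(* [w] exhibits [u] as an element of the domain of the closure of the form [q]
   with domain [D]. *)
Definition form_approx (q : sesq_form) (D : set (plane -> C)) (u : plane -> C)
    (w : nat -> plane -> C) : Prop :=
  [/\ in_L2 u, forall n, D (w n),
      (fun n => L2norm2 (w n \- u)) @ \oo --> (0 : R) &
      (fun p : nat * nat =>
         q (w p.1 \- w p.2) (w p.1 \- w p.2)) @ (\oo, \oo) --> (0 : C)].

(* The operator generated by the closure qbar of [q]: u is in its domain with
   image f iff u is in the domain of qbar and qbar(u, v) = <f, v> for every v in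
   the domain of qbar. The value qbar(u, v) is the limit of q along
   approximating sequences. *)
Definition form_operator (q : sesq_form) (D : set (plane -> C))
    (u f : plane -> C) : Prop :=
  [/\ in_L2 f, exists w, form_approx q D u w &
      forall (v : plane -> C) (u_ v_ : nat -> plane -> C),
        form_approx q D u u_ -> form_approx q D v v_ ->
        (fun n => q (u_ n) (v_ n)) @ \oo --> L2dot f v].

Definition magnetic_grad (A : plane -> plane) (u : plane -> C)
    : (plane -> C) * (plane -> C) :=
  (fun x => imag * partialC e1 u x + toC (A x).1 * u x,
   fun x => imag * partialC e2 u x + toC (A x).2 * u x).

(* The sesquilinear form whose quadratic form is the integral of
   |i grad u + A u|^2. *)
Definition magnetic_form (A : plane -> plane) : sesq_form := fun u v =>
  cintegral (fun x =>
    (magnetic_grad A u).1 x * ((magnetic_grad A v).1 x)^* +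
    (magnetic_grad A u).2 x * ((magnetic_grad A v).2 x)^*).

Definition magnetic_laplacian (A : plane -> plane) :=
  form_operator (magnetic_form A) test_function.

(* T + W, for multiplication by the bounded function W. *)
Definition add_potential (T : (plane -> C) -> (plane -> C) -> Prop)
    (W : plane -> R) (u f : plane -> C) : Prop :=
  T u (fun x => f x - toC (W x) * u x).

(* diag((-i grad - A)^2 - b, (-i grad - A)^2 + b) + V *)
Definition pauli (A : plane -> plane) (b : plane -> R)
    (V : plane -> 'M[C]_2) (u f : spinor) : Prop :=
  let g : spinor := fun x => f x - V x *m u x in
  add_potential (magnetic_laplacian A) (\- b) (component u 0) (component g 0) /\
  add_potential (magnetic_laplacian A) b (component u 1) (component g 1).

Definition resolvent_set (T : spinor -> spinor -> Prop) : set C :=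
  [set z | exists c : R, forall f : spinor, in_L2s f ->
     exists u : spinor,
       [/\ T u (fun x => f x + z *: u x),
           forall v : spinor, T v (fun x => f x + z *: v x) ->
             ae_eq mu setT v u &
           L2norm2s u <= c * L2norm2s f]].

Definition spectrum (T : spinor -> spinor -> Prop) : set C :=
  ~` resolvent_set T.

Definition eigenspace (T : spinor -> spinor -> Prop) (z : C) : set spinor :=
  [set u | T u (fun x => z *: u x)].

Definition eigenvalue (T : spinor -> spinor -> Prop) (z : C) : Prop :=
  exists2 u, eigenspace T z u & ~ ae_eq mu setT u (fun=> 0).

Definition finite_multiplicity (T : spinor -> spinor -> Prop) (z : C) : Prop :=
  exists (n : nat) (e : 'I_n -> spinor), (forall k, eigenspace T z (e k)) /\
    forall u, eigenspace T z u -> exists c : 'I_n -> C,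
      ae_eq mu setT u (fun x => \sum_(k < n) c k *: e k x).

Definition discrete_spectrum (T : spinor -> spinor -> Prop) : set C :=
  [set z | [/\ isolated (spectrum T) z, eigenvalue T z &
               finite_multiplicity T z]].

Definition canonic_extension (B X : topologicalType) (iota : plane -> B)
    (f : plane -> X) (phi : B -> X) : Prop :=
  continuous phi /\ f = phi \o iota.

Record is_Bohr (B : topologicalZmodType) (iota : plane -> B) : Prop := {
  Bohr_compact : compact [set: B];
  Bohr_hausdorff : hausdorff_space B;
  Bohr_morph : {morph iota : x y / x + y};
  Bohr_continuous : continuous iota;
  Bohr_dense : dense (range iota);
  Bohr_extension : forall f : plane -> C, CAP f ->
    exists! phi : B -> C, canonic_extension iota f phi }.

End Plane.

(* The measurable structure of MathComp-Analysis requires a pointed carrier. *)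
Definition pointed_at0 (B : topologicalZmodType) : Type := B.
HB.instance Definition _ (B : topologicalZmodType) :=
  Choice.on (pointed_at0 B).
HB.instance Definition _ (B : topologicalZmodType) :=
  isPointed.Build (pointed_at0 B) (0 : B).

Definition borel_type (B : topologicalZmodType) :=
  g_sigma_algebraType (@open B : set (set (pointed_at0 B))).
HB.instance Definition _ (B : topologicalZmodType) :=
  Measurable.on (borel_type B).

(* Outer regularity is part of the definition: B need not be metrizable. On a
   compact space it implies inner regularity. *)
Definition is_Haar (R : realType) (B : topologicalZmodType)
    (P : probability (borel_type B) R) : Prop :=
  (forall (w : B) (A : set B), measurable (A : set (borel_type B)) ->
     P [set w + a | a in A] = P A) /\
  (forall A : set B, measurable (A : set (borel_type B)) ->
     P A = ereal_inf [set P U | U in [set U : set B | open U /\ A `<=` U]]).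

Definition hull (R : realType) (B : topologicalZmodType) (X : Type)
    (iota : R * R -> B) (phi : B -> X) (w : B) (x : R * R) : X :=
  phi (w + iota x).

Definition A0 (R : realType) (b0 : R) (x : R * R) : R * R :=
  (- (b0 * x.2 / 2), b0 * x.1 / 2).

Definition pauli_family (R : realType) (B : topologicalZmodType)
    (iota : R * R -> B) (b0 : R) (alpha : B -> R * R) (beta : B -> R)
    (Upsilon : B -> 'M[Cplx R]_2) (w : B) :
    spinor R -> spinor R -> Prop :=
  pauli (fun x => A0 b0 x + hull iota alpha w x) (hull iota beta w)
        (hull iota Upsilon w).

Definition almost_sure_spectrum (R : realType) (B : topologicalZmodType)
    (P : probability (borel_type B) R)
    (H : B -> spinor R -> spinor R -> Prop) (Sigma : set R) : Prop :=
  closed Sigma /\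
  {ae P, forall w : borel_type B, spectrum (H w) = [set toC s | s in Sigma]}.

(* Main.v *)
(* With M large, the form of H_w + M is coercive uniformly in w, so that T_w = (H_w + M)^-1
   is bounded and symmetric, and z is in the resolvent set of H_w iff 1 - (z + M) T_w is
   bounded below. Magnetic translations are isometries conjugating T_w to
   T_{w + iota(x)}, and w |-> T_w is norm continuous because the coefficients are uniformly
   continuous on the compact group. Since iota has dense range, a lower bound passes from
   any w to any other one: the spectrum does not depend on w. If t were an isolated
   eigenvalue of finite multiplicity of H_w with eigenvector e, then K = T_w - 1/(t + M)
   would have a gap on its range. By recurrence of iota(x) to 0 there are arbitrarily
   distant x with iota(x) near 0; the translates of e by such x are almost orthogonal and
   almost in ker K, and more of them than the multiplicity contradict the gap. *)

From HB Require Import structures.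
From mathcomp Require Import all_boot all_order all_algebra.
From mathcomp Require Import all_classical all_reals all_analysis.
From mathcomp Require Import measurable_realfun complex ring lra.
Require Import Defs.

Set Implicit Arguments.
Unset Strict Implicit.
Unset Printing Implicit Defensive.

Import Order.TTheory GRing.Theory Num.Theory.
Import numFieldNormedType.Exports.

Local Open Scope classical_set_scope.
Local Open Scope ring_scope.

(** * Semi-Hilbert spaces and symmetric operators *)

(** Spectral statements are reduced to lower bounds |u|^2 <= c |u - z T u|^2 rather than to spectral
    projections: such bounds survive small norm perturbations and isometric conjugations, and for
    symmetric [T] they already imply surjectivity. The obstacle is the unbounded part [A0]. Plain
    translations change it, but only by a constant vector, which a phase absorbs; and it cancels
    when two points of the group are compared, so that the two magnetic gradients differ by a
    bounded multiplication. To exploit this, the closed form is kept as a closed subspace of pairs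
    (function, gradient), on which such a change is a shear of the second component. Closability,
    that is the fact that the gradient is determined by the function, is obtained by integration by
    parts on boxes with polynomial cutoffs; it is what makes the limit in [form_operator] the same
    for all approximating sequences. Recurrence is used along the first axis only: a cluster point
    of a sequence iota(k r, 0) yields returns near 0 whose first coordinates are as far apart as
    required. *)

(* Elements of L^2 are functions, so the inner product is only positive
   semidefinite; [dot] is its real part, from which the complex inner product is
   recovered by complex linearity. *)
HB.mixin Record isSemiHilbert (R : realType) V of GRing.Lmodule (Cplx R) V := {
  dot : V -> V -> R;
  dotC : forall u v, dot u v = dot v u;
  dotDl : forall u v w, dot (u + v) w = dot u w + dot v w;
  dotZl : forall a u v, dot (toC a *: u) v = a * dot u v;
  dotiZ : forall u v, dot (imag *: u) (imag *: v) = dot u v;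
  dot_ge0 : forall u, 0 <= dot u u;
  dot_complete : forall u : nat -> V,
    (forall e : R, 0 < e -> exists N, forall m n, (N <= m)%N -> (N <= n)%N ->
       dot (u m - u n) (u m - u n) < e) ->
    exists l, forall e : R, 0 < e -> exists N, forall n, (N <= n)%N ->
       dot (u n - l) (u n - l) < e
}.
#[short(type="semiHilbertType")]
HB.structure Definition SemiHilbert (R : realType) :=
  { V of GRing.Lmodule (Cplx R) V & isSemiHilbert R V }.

Section prod.
Variables (R : realType) (V W : semiHilbertType R).
Definition pdot (u v : V * W) : R := dot u.1 v.1 + dot u.2 v.2.
Fact pdotC u v : pdot u v = pdot v u.
Proof. by rewrite /pdot dotC [X in _ + X]dotC. Qed.
Fact pdotDl u v w : pdot (u + v) w = pdot u w + pdot v w.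
Proof. rewrite /pdot !dotDl; ring. Qed.
Fact pdotZl a u v : pdot (toC a *: u) v = a * pdot u v.
Proof. rewrite /pdot !dotZl; ring. Qed.
Fact pdotiZ u v : pdot (imag *: u) (imag *: v) = pdot u v.
Proof. by rewrite /pdot !dotiZ. Qed.
Fact pdot_ge0 u : 0 <= pdot u u.
Proof. by rewrite addr_ge0 ?dot_ge0. Qed.
Fact pdot_complete (u : nat -> V * W) :
    (forall e : R, 0 < e -> exists N, forall m n, (N <= m)%N -> (N <= n)%N ->
       pdot (u m - u n) (u m - u n) < e) ->
    exists l, forall e : R, 0 < e -> exists N, forall n, (N <= n)%N ->
       pdot (u n - l) (u n - l) < e.
Proof.
move=> uC.
have [l1 l1P] : exists l1, forall e : R, 0 < e -> exists N, forall n, (N <= n)%N ->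
    dot ((u n).1 - l1) ((u n).1 - l1) < e.
  apply: dot_complete => e e0; have [N NP] := uC e e0; exists N => m n Nm Nn.
  by apply: le_lt_trans (NP m n Nm Nn); rewrite /pdot lerDl dot_ge0.
have [l2 l2P] : exists l2, forall e : R, 0 < e -> exists N, forall n, (N <= n)%N ->
    dot ((u n).2 - l2) ((u n).2 - l2) < e.
  apply: dot_complete => e e0; have [N NP] := uC e e0; exists N => m n Nm Nn.
  by apply: le_lt_trans (NP m n Nm Nn); rewrite /pdot lerDr dot_ge0.
exists (l1, l2) => e e0; have e20 : 0 < e / 2 by rewrite divr_gt0.
have [N1 N1P] := l1P _ e20; have [N2 N2P] := l2P _ e20.
exists (maxn N1 N2) => n; rewrite geq_max => /andP[n1 n2].
by rewrite (splitr e) ltrD ?N1P ?N2P.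
Qed.
HB.instance Definition _ := isSemiHilbert.Build R (V * W)%type
  pdotC pdotDl pdotZl pdotiZ pdot_ge0 pdot_complete.
Lemma dot_pair (u v : V * W) : dot u v = dot u.1 v.1 + dot u.2 v.2.
Proof. by []. Qed.
End prod.

(** * Semi-inner products and the Riesz representation theorem *)

Section semidot.
Variable R : realType.
Local Notation C := (Cplx R).

Lemma toC0 : toC 0 = 0 :> C. Proof. by []. Qed.
Lemma toC1 : toC 1 = 1 :> C. Proof. by []. Qed.
Lemma toCD (a b : R) : toC (a + b) = toC a + toC b.
Proof. by rewrite /toC; apply/eqP; rewrite eq_complex /= addr0 !eqxx. Qed.
Lemma toCN (a : R) : toC (- a) = - toC a.
Proof. by rewrite /toC; apply/eqP; rewrite eq_complex /= oppr0 !eqxx. Qed.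
Lemma toCM (a b : R) : toC (a * b) = toC a * toC b.
Proof.
by rewrite /toC; apply/eqP; rewrite eq_complex /= !(mulr0, mul0r, subr0, addr0) !eqxx.
Qed.
Lemma imag2 : imag * imag = - 1 :> C.
Proof.
by apply/eqP; rewrite eq_complex /= !(mulr0, mul0r, mulr1, sub0r, addr0) oppr0 !eqxx.
Qed.
Lemma complexE_toC (z : C) : z = toC (reC z) + toC (imC z) * imag.
Proof.
by case: z => a b; apply/eqP;
   rewrite eq_complex /= !(mulr0, mul0r, mulr1, subr0, addr0, add0r) !eqxx.
Qed.

(** Kept apart from the structure [isSemiHilbert] because one space carries several forms: besides
    [dot], Cauchy-Schwarz and Riesz are applied to energies and to pulled back inner products. *)
Record semidot (V : lmodType C) (d : V -> V -> R) : Prop := {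
  semidotC : forall u v, d u v = d v u;
  semidotDl : forall u v w, d (u + v) w = d u w + d v w;
  semidotZl : forall a u v, d (toC a *: u) v = a * d u v;
  semidot_ge0 : forall u, 0 <= d u u }.

Lemma semidot_dot (V : semiHilbertType R) : semidot (@dot R V).
Proof. by split; [exact: dotC|exact: dotDl|exact: dotZl|exact: dot_ge0]. Qed.

Section theory.
Variables (V : lmodType C) (d : V -> V -> R) (dP : semidot d).

Lemma semidotDr u v w : d w (u + v) = d w u + d w v.
Proof. by rewrite !(semidotC dP w) (semidotDl dP). Qed.
Lemma semidotZr a u v : d v (toC a *: u) = a * d v u.
Proof. by rewrite !(semidotC dP v) (semidotZl dP). Qed.
Lemma semidotNl u v : d (- u) v = - d u v.
Proof. by rewrite -scaleN1r -toC1 -toCN (semidotZl dP) mulN1r. Qed.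
Lemma semidotNr u v : d v (- u) = - d v u.
Proof. by rewrite !(semidotC dP v) semidotNl. Qed.
Lemma semidot0l v : d 0 v = 0.
Proof. by rewrite -(scale0r (0 : V)) -toC0 (semidotZl dP) mul0r. Qed.
Lemma semidot0r v : d v 0 = 0.
Proof. by rewrite (semidotC dP) semidot0l. Qed.
Definition semidotE :=
  (semidotDl dP, semidotDr, semidotZl dP, semidotZr, semidotNl, semidotNr,
   semidot0l, semidot0r).

(** The quadratic is tested at its minimizer [- b / a]. If [a = 0] it is affine in [t], and for
    [b != 0] the value at [- (e + 1) / (2 * b)] would be -1. *)
Lemma discr_le (a b e : R) : 0 <= a -> 0 <= e ->
  (forall t, 0 <= t ^+ 2 * a + 2 * t * b + e) -> b ^+ 2 <= a * e.
Proof.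
move=> a0 e0 H; have [az|an0] := eqVneq a 0.
  rewrite az mul0r; have [->|bn0] := eqVneq b 0; first by rewrite expr0n.
  have := H (- (e + 1) / (2 * b)); rewrite az mulr0 add0r.
  rewrite (_ : 2 * _ * b = - (e + 1)); last by field.
  by move=> ?; exfalso; lra.
have ap : 0 < a by rewrite lt_neqAle eq_sym an0.
have := H (- b / a).
rewrite (_ : _ + e = (a * e - b ^+ 2) / a); last by field.
by rewrite pmulr_lge0 ?invr_gt0// subr_ge0.
Qed.

Lemma cauchy_schwarz u v : d u v ^+ 2 <= d u u * d v v.
Proof.
rewrite mulrC; apply: discr_le; rewrite ?(semidot_ge0 dP)// => t.
apply: le_trans (semidot_ge0 dP (toC t *: v + u)) _.
rewrite !semidotE (semidotC dP v u) le_eqVlt; apply/orP; left; apply/eqP; ring.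
Qed.

Lemma semidotD_le u v : d (u + v) (u + v) <= 2 * d u u + 2 * d v v.
Proof.
have := semidot_ge0 dP (u - v); rewrite !semidotE (semidotC dP v u); lra.
Qed.
Lemma semidotB_le u v : d (u - v) (u - v) <= 2 * d u u + 2 * d v v.
Proof. by have := semidotD_le u (- v); rewrite !semidotE opprK. Qed.
Lemma semidot_sym u v : d (u - v) (u - v) = d (v - u) (v - u).
Proof. by rewrite -(opprB v u) semidotNl semidotNr opprK. Qed.

Lemma semidot_null u v : d u u = 0 -> d u v = 0.
Proof.
move=> u0; have := cauchy_schwarz u v; rewrite u0 mul0r => h.
by apply/eqP; rewrite -sqrf_eq0 eq_le h sqr_ge0.
Qed.

Definition cvg_in (u : nat -> V) (l : V) := forall e : R, 0 < e -> exists N, forall n,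
  (N <= n)%N -> d (u n - l) (u n - l) < e.
Definition cauchy_in (u : nat -> V) := forall e : R, 0 < e -> exists N, forall m n,
  (N <= m)%N -> (N <= n)%N -> d (u m - u n) (u m - u n) < e.

Lemma cvg_in_cauchy u l : cvg_in u l -> cauchy_in u.
Proof.
move=> ul e e0; have [N NP] := ul _ (divr_gt0 e0 (ltr0n R 4)).
exists N => m n Nm Nn.
have -> : u m - u n = (u m - l) - (u n - l) by rewrite opprB addrA subrK.
have := semidotB_le (u m - l) (u n - l); have := NP m Nm; have := NP n Nn; lra.
Qed.

Lemma cvg_in_dot u l v : cvg_in u l -> forall e : R, 0 < e -> exists N, forall n,
  (N <= n)%N -> (d (u n) v - d l v) ^+ 2 < e.
Proof.
move=> ul e e0; have v0 : 0 < d v v + 1 by rewrite ltr_wpDl// (semidot_ge0 dP).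
have [N NP] := ul _ (divr_gt0 e0 v0).
exists N => n Nn; have := NP n Nn; rewrite ltr_pdivlMr// => h.
apply: le_lt_trans h.
rewrite -semidotNl -(semidotDl dP); apply: le_trans (cauchy_schwarz _ _) _.
by rewrite ler_wpM2l ?(semidot_ge0 dP)// lerDl.
Qed.

Definition complete_on (D : V -> Prop) := forall u, (forall n, D (u n)) ->
  cauchy_in u -> exists2 l, D l & cvg_in u l.

Definition real_subspace (D : V -> Prop) := [/\ D 0, forall u v, D u -> D v -> D (u + v) &
  forall a u, D u -> D (toC a *: u)].

(** The representative minimizes [J u = d u u - 2 F u] on [D]. Working on a real subspace that is
    complete for [d] allows the whole space, the closure of a range and a form domain to be treated
    alike. *)
Theorem riesz (D : V -> Prop) (F : V -> R) (c : R) :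
  real_subspace D -> complete_on D ->
  (forall u v, D u -> D v -> F (u + v) = F u + F v) ->
  (forall a u, D u -> F (toC a *: u) = a * F u) ->
  (forall u, D u -> F u ^+ 2 <= c * d u u) ->
  exists2 u, D u & forall v, D v -> F v = d u v.
Proof.
move=> [D0 DD DZ] Dc FD FZ Fc.
pose J u := d u u - 2 * F u.
have DB u v : D u -> D v -> D (u - v).
  by move=> Du Dv; rewrite -scaleN1r -toC1 -toCN; apply: DD => //; exact: DZ.
have FN u : D u -> F (- u) = - F u.
  by move=> Du; rewrite -scaleN1r -toC1 -toCN FZ// mulN1r.
(* If 2 F u exceeded d u u + |c|, then (d u u + |c|)^2 < 4 (F u)^2 <= 4 |c| d u u, against (d u u -
   |c|)^2 >= 0. *)
have c0 u : D u -> - `|c| <= J u.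
  move=> Du; rewrite /J; have := Fc u Du; have := semidot_ge0 dP u => dg.
  have : c * d u u <= `|c| * d u u by rewrite ler_wpM2r// ler_norm.
  move=> h1 h2; have h3 := le_trans h2 h1.
  have [h|h] := leP (2 * F u) (d u u + `|c|); first lra.
  have : (d u u + `|c|) ^+ 2 < (2 * F u) ^+ 2.
    by rewrite ltr_pXn2r// ?nnegrE//; [apply: addr_ge0|apply: le_trans (ltW h); apply: addr_ge0].
  have : 0 <= (d u u - `|c|) ^+ 2 by apply: sqr_ge0.
  by rewrite !expr2 => *; exfalso; rewrite expr2 in h3; nra.
pose E := [set x | exists2 u, D u & x = J u].
have E0 : has_inf E.
  split; first by exists (J 0); exists 0.
  by exists (- `|c|) => _ [u Du ->]; exact: c0.
have Emin n : exists u, D u /\ J u < inf E + n.+1%:R^-1.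
  have [//|x [u Du ->] h] := @inf_adherent R E (n.+1%:R^-1) _ E0.
  by exists u.
have [u uP] := choice Emin.
have Du n : D (u n) by have [] := uP n.
have Ju n : J (u n) < inf E + n.+1%:R^-1 by have [] := uP n.
have Jinf v : D v -> inf E <= J v.
  by move=> Dv; apply: ge_inf => //; [case: E0|exists v].
(* The midpoint of [u m] and [u n] lies in [D], so [J] is at least [inf E] there; the parallelogram
   identity then controls the difference. *)
have par m n : d (u m - u n) (u m - u n) <= 2 * m.+1%:R^-1 + 2 * n.+1%:R^-1.
  have := Jinf _ (DZ 2^-1 _ (DD _ _ (Du m) (Du n))).
  have := Ju m; have := Ju n; rewrite /J FZ; last exact: DD.
  rewrite FD// !semidotE !(semidotC dP (u n) (u m)); move: (m.+1%:R^-1) (n.+1%:R^-1) => x y; lra.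
have inv_small e : 0 < e -> exists N, forall n, (N <= n)%N -> n.+1%:R^-1 < e :> R.
  move=> e0; exists (Num.bound e^-1) => n Nn.
  rewrite invf_plt ?posrE//; apply: (lt_le_trans (archi_boundP _)); first by rewrite invr_ge0 ltW.
  by rewrite ler_nat ltnW.
have uC : cauchy_in u.
  move=> e e0; have [N NP] := inv_small _ (divr_gt0 e0 (ltr0n R 4)).
  exists N => m n /NP hm /NP hn; move: (par m n) hm hn; move: (m.+1%:R^-1) (n.+1%:R^-1) => x y; lra.
have [l Dl ul] := Dc u Du uC.
exists l => // v Dv.
(* The polynomial J (u n + t v) - inf E is nonnegative in t and smaller than 1/(n+1) at t = 0: its
   discriminant bounds the defect in the Euler equation. *)
have near0 n : (d (u n) v - F v) ^+ 2 <= d v v * n.+1%:R^-1.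
  apply: discr_le; rewrite ?(semidot_ge0 dP)// => t.
  have := Jinf _ (DD _ _ (Du n) (DZ t _ Dv)); have := Ju n.
  rewrite /J FD ?FZ//; last exact: DZ.
  rewrite !semidotE (semidotC dP v (u n)); move: (n.+1%:R^-1) => y; rewrite expr2; nra.
apply/eqP; rewrite -subr_eq0 -sqrf_eq0 eq_le sqr_ge0 andbT; apply/ler_addgt0Pl => e e0.
have [N1 N1P] := cvg_in_dot v ul (divr_gt0 e0 (ltr0n R 4)).
have v0 : 0 < d v v + 1 by rewrite ltr_wpDl// (semidot_ge0 dP).
have [N2 N2P] := inv_small _ (divr_gt0 (divr_gt0 e0 (ltr0n R 4)) v0).
pose n := maxn N1 N2; have := N1P n (leq_maxl _ _); have := N2P n (leq_maxr _ _).
rewrite ltr_pdivlMr// => h1 h2; have := near0 n.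
have i0 : 0 < n.+1%:R^-1 :> R by rewrite invr_gt0.
move: (n.+1%:R^-1) i0 h1 => i i0 h1 h3.
have h4 : d v v * i <= e / 4.
  apply: ltW; apply: le_lt_trans h1; rewrite mulrDr mulr1 mulrC lerDl; exact: ltW.
have -> : F v - d l v = (d (u n) v - d l v) - (d (u n) v - F v) by ring.
move: (d (u n) v - d l v) (d (u n) v - F v) h2 h3 => x y h2 h3.
have : 0 <= (x + y) ^+ 2 by apply: sqr_ge0.
rewrite !expr2 in h2 h3 *; nra.
Qed.

End theory.
End semidot.

(** * Bounded symmetric operators and their resolvents *)

Section symop.
Variables (R : realType) (H : semiHilbertType R).
Local Notation C := (Cplx R).
Local Notation nn u := (dot u u).
Implicit Types (u v w f g : H) (z : C).

Local Notation dP := (semidot_dot H).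
Definition dotE := (semidotE (semidot_dot H)).

Definition cj z : C := Complex (reC z) (- imC z).

Lemma dot_imag u v : dot (imag *: u) v = - dot u (imag *: v).
Proof. by rewrite -dotiZ scalerA imag2 scaleN1r !dotE. Qed.

Lemma scaleC z u : z *: u = toC (reC z) *: u + toC (imC z) *: (imag *: u).
Proof. by rewrite {1}(complexE_toC z) scalerDl scalerA. Qed.

Lemma dotZ z u v : dot (z *: u) v = dot u (cj z *: v).
Proof. by rewrite scaleC [cj z *: v]scaleC !dotE dot_imag mulrN mulNr. Qed.

Lemma cjK z : cj (cj z) = z.
Proof. by case: z => a b; rewrite /cj /= opprK. Qed.

Lemma dotii u : dot (imag *: u) u = 0.
Proof. have := dot_imag u u; rewrite (dotC u (imag *: u)); lra. Qed.

Lemma nnZ z u : nn (z *: u) = abs2 z * nn u.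
Proof.
rewrite scaleC !dotE dotiZ (dotC u) dotii /abs2; ring.
Qed.

Lemma abs2_ge0 z : 0 <= abs2 z.
Proof. by rewrite addr_ge0 ?sqr_ge0. Qed.

(** The seminorm does not separate points, so equality of vectors is tested against all of the
    space; in L^2 this is equality almost everywhere. *)
Definition eqv u v := forall w, dot u w = dot v w.

Lemma eqvP u v : nn (u - v) = 0 <-> eqv u v.
Proof.
split=> [h w|h].
  apply/eqP; rewrite -subr_eq0; apply/eqP.
  by have := semidot_null dP w h; rewrite !dotE.
by rewrite !dotE !h; ring.
Qed.
Lemma eqv_refl u : eqv u u. Proof. by []. Qed.
Lemma eqv_sym u v : eqv u v -> eqv v u. Proof. by move=> h w; rewrite h. Qed.
Lemma eqv_trans v u w : eqv u v -> eqv v w -> eqv u w.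
Proof. by move=> h1 h2 x; rewrite h1 h2. Qed.
Lemma eqvD u u' v v' : eqv u v -> eqv u' v' -> eqv (u + u') (v + v').
Proof. by move=> h1 h2 x; rewrite !dotE h1 h2. Qed.
Lemma eqvN u v : eqv u v -> eqv (- u) (- v).
Proof. by move=> h1 x; rewrite !dotE h1. Qed.
Lemma eqvB u u' v v' : eqv u v -> eqv u' v' -> eqv (u - u') (v - v').
Proof. by move=> h1 h2; apply: eqvD => //; exact: eqvN. Qed.
Lemma eqvZ z u v : eqv u v -> eqv (z *: u) (z *: v).
Proof. by move=> h x; rewrite !dotZ h. Qed.
Lemma eqv_nn u v : eqv u v -> nn u = nn v.
Proof. by move=> h; rewrite h dotC h. Qed.
Lemma eqv_subl u v w : eqv (u - v) w -> eqv u (v + w).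
Proof. by move=> h x; move: (h x); rewrite !dotE => <-; ring. Qed.
Lemma eqv_subr u v w : eqv u (v + w) -> eqv (u - v) w.
Proof. by move=> h x; rewrite !dotE h !dotE; ring. Qed.

(** Symmetry for the real form [dot] forces additivity and real homogeneity up to [eqv]. It does not
    force commutation with [imag], as complex conjugation shows, whence the third field. *)
Record symop (T : H -> H) : Prop := {
  symopP : forall u v, dot (T u) v = dot u (T v);
  symop_bdd : exists2 c : R, 0 < c & forall u, nn (T u) <= c * nn u;
  symop_imag : forall u, eqv (T (imag *: u)) (imag *: T u) }.

Definition bddbelow (T : H -> H) z c := forall u, nn u <= c * nn (u - z *: T u).

Section theory.
Variables (T : H -> H) (TP : symop T).

Lemma symop_eqv u v : eqv u v -> eqv (T u) (T v).
Proof. by move=> h w; rewrite !(symopP TP). Qed.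
Lemma symopD u v : eqv (T (u + v)) (T u + T v).
Proof. by move=> w; rewrite (symopP TP) !dotE !(symopP TP). Qed.
Lemma symopZr (a : R) u : eqv (T (toC a *: u)) (toC a *: T u).
Proof. by move=> w; rewrite (symopP TP) !dotE (symopP TP). Qed.
Lemma symopB u v : eqv (T (u - v)) (T u - T v).
Proof. by move=> w; rewrite (symopP TP) !dotE !(symopP TP). Qed.
Lemma symopZ z u : eqv (T (z *: u)) (z *: T u).
Proof.
rewrite !(scaleC z); apply: eqv_trans (symopD _ _) _.
apply: eqvD; first exact: symopZr.
by apply: eqv_trans (symopZr _ _) _; apply: eqvZ; exact: symop_imag.
Qed.

Lemma symop_adj z u v : dot (u - z *: T u) v = dot u (v - cj z *: T v).
Proof. by rewrite !dotE dotZ (symopP TP) [dot u (T _)]dotC symopZ [dot (cj _ *: _) _]dotC. Qed.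

Lemma symop_res_bdd z : exists2 c : R, 0 < c & forall u, nn (u - z *: T u) <= c * nn u.
Proof.
have [c c0 cP] := symop_bdd TP; exists (2 + 2 * abs2 z * c).
  by rewrite ltr_wpDr// mulr_ge0 ?(ltW c0)// mulr_ge0// abs2_ge0.
move=> u; apply: le_trans (semidotB_le dP _ _) _.
rewrite nnZ [(2 + _) * _]mulrDl lerD// -!mulrA ler_wpM2l// ler_wpM2l ?cP ?abs2_ge0//.
Qed.

(* [<u - z T u, i T u> = - Im z |T u|^2] since [<u, i T u> = 0]. *)
Lemma bddbelow_nonreal z : imC z != 0 -> exists c, bddbelow T z c.
Proof.
move=> z0; pose b := imC z; pose a := reC z.
have uiTu u : dot u (imag *: T u) = 0.
  have e : dot (imag *: u) (T u) = dot u (imag *: T u).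
    by rewrite -(symopP TP) (symop_imag TP) dotC.
  by have := dot_imag u (T u); rewrite e; lra.
have b2 : 0 < b ^+ 2 by rewrite lt_neqAle sqr_ge0 eq_sym sqrf_eq0 z0.
have key u : b ^+ 2 * nn (T u) <= nn (u - z *: T u).
  have := cauchy_schwarz dP (u - z *: T u) (imag *: T u).
  rewrite dotiZ (_ : dot (u - z *: T u) _ = - b * nn (T u)); last first.
    by rewrite scaleC !dotE uiTu dotiZ -/b (dotC (T u)) dotii; ring.
  move=> cs; have [Tn0|Tn0] := eqVneq (nn (T u)) 0; first by rewrite Tn0 mulr0 dot_ge0.
  have Tp : 0 < nn (T u) by rewrite lt_neqAle eq_sym Tn0 dot_ge0.
  move: cs; rewrite exprMn sqrrN [X in _ * X <= _]expr2 mulrA => h.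
  by rewrite -(ler_pM2r Tp).
exists (2 + 2 * abs2 z / b ^+ 2) => u.
have := semidotD_le dP (u - z *: T u) (z *: T u); rewrite subrK => h.
apply: le_trans h _; rewrite [(2 + _) * _]mulrDl lerD2l nnZ -!mulrA.
do 2![apply: ler_wpM2l; first by rewrite ?abs2_ge0].
by rewrite mulrC ler_pdivlMr// mulrC.
Qed.

(** Either [z] is its own conjugate, or its conjugate is nonreal and a lower bound holds there
    anyway. Thus the adjoint of 1 - z T is bounded below as well. *)
Lemma bddbelow_cj z c : bddbelow T z c -> exists c', bddbelow T (cj z) c'.
Proof.
move=> h; have [z0|z0] := eqVneq (imC z) 0.
  by exists c; rewrite (_ : cj z = z)//; case: z z0 {h} => a b /= ->; rewrite /cj /= oppr0.
by apply: bddbelow_nonreal; rewrite /cj /= oppr_eq0.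
Qed.

(* The range is everything by Riesz for the semi-inner product
   [<S' u, S' v>], [S'] the adjoint of [1 - z T]. *)
Lemma bddbelow_onto z c : bddbelow T z c -> forall f, exists u, eqv (u - z *: T u) f.
Proof.
move=> /bddbelow_cj[c' h'] f.
pose S u := u - cj z *: T u.
have S_adj u v : dot (S u) v = dot u (v - z *: T v) by rewrite symop_adj cjK.
have SD u v : eqv (S (u + v)) (S u + S v).
  by move=> w; rewrite S_adj dotDl -!S_adj -dotDl.
have SZ (a : R) u : eqv (S (toC a *: u)) (toC a *: S u).
  by move=> w; rewrite S_adj dotZl -!S_adj -dotZl.
pose d u v := dot (S u) (S v).
have dd : semidot d.
  split=> [u v|u v w|a u v|u]; rewrite /d ?dot_ge0//.
  - exact: dotC.
  - by rewrite SD dotDl.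
  - by rewrite SZ dotZl.
have c'0 : 0 <= `|c'| by [].
have h'' u : nn u <= `|c'| * d u u.
  by apply: le_trans (h' u) _; rewrite ler_wpM2r ?dot_ge0// ler_norm.
have [|||||u _ uP] := @riesz R H d dd (fun=> True) (dot f) (nn f * `|c'|).
- by [].
- move=> u _ uC; have [|l lP] := @dot_complete R H u.
    move=> e e0; have c1 : 0 < `|c'| + 1 by rewrite ltr_wpDl.
    have [N NP] := uC _ (divr_gt0 e0 c1); exists N => m n Nm Nn.
    have := NP m n Nm Nn; rewrite ltr_pdivlMr// => h0.
    apply: le_lt_trans (h'' _) _; apply: le_lt_trans h0.
    by rewrite mulrC ler_wpM2l ?(semidot_ge0 dd)// lerDl.
  exists l => // e e0; have [k k0 kP] := symop_res_bdd (cj z).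
  have [N NP] := lP _ (divr_gt0 e0 k0); exists N => n Nn.
  have := NP n Nn; rewrite ltr_pdivlMr// mulrC => h0.
  exact: le_lt_trans (kP _) h0.
- by move=> u v _ _; rewrite !dotE.
- by move=> a u _; rewrite !dotE.
- move=> u _; apply: le_trans (cauchy_schwarz dP _ _) _.
  by rewrite -mulrA ler_wpM2l ?dot_ge0.
by exists (S u) => v; rewrite (uP v)// symop_adj.
Qed.

(** The radius 1/(4 c' k) makes the error 2 c' |z' - z|^2 |T u|^2 at most |u|^2 / 2, which is
    absorbed on the left and leaves the constant 4 c'. Here [c'] replaces [c], whose sign is not
    prescribed. *)
Lemma bddbelow_open z c : bddbelow T z c ->
  exists2 e : R, 0 < e & forall z', abs2 (z' - z) < e -> exists c', bddbelow T z' c'.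
Proof.
move=> h; have [k k0 kP] := symop_bdd TP.
pose c' := `|c| + 1.
have c'0 : 0 < c' by rewrite ltr_wpDl.
have {}h u : nn u <= c' * nn (u - z *: T u).
  apply: le_trans (h u) _; rewrite ler_wpM2r ?dot_ge0//.
  by apply: le_trans (ler_norm c) _; rewrite lerDl.
exists (4 * c' * k)^-1; first by rewrite invr_gt0 !mulr_gt0.
move=> z' z'P; exists (4 * c') => u.
move: z'P; rewrite -[_^-1]div1r ltr_pdivlMr ?mulr_gt0// => z'P.
have e1 : u - z *: T u = (u - z' *: T u) + (z' - z) *: T u.
  by rewrite scalerBl addrA subrK.
have := semidotD_le dP (u - z' *: T u) ((z' - z) *: T u); rewrite -e1 nnZ => h1.
have h2 := h u; have h3 := kP u; have h4 := dot_ge0 u.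
have h5 : abs2 (z' - z) * nn (T u) <= abs2 (z' - z) * (k * nn u) by rewrite ler_wpM2l// abs2_ge0.
have h6 : abs2 (z' - z) * (4 * c' * k) * nn u <= 1 * nn u by rewrite ler_wpM2r// ltW.
have h7 : c' * nn (u - z *: T u) <= c' * (2 * nn (u - z' *: T u) + 2 * (abs2 (z' - z) * (k * nn u))).
  by rewrite ler_wpM2l ?(ltW c'0)//; lra.
nra.
Qed.

(** Same absorption as for a change of [z], with |z|^2 |T u - T' u|^2 as the error. The admissible
    distance depends on [T] only, so that it can be fixed before the comparison operator is
    chosen. *)
Lemma bddbelow_perturb z c : bddbelow T z c -> exists2 e : R, 0 < e & forall T',
  (forall u, nn (T u - T' u) <= e * nn u) -> exists c', bddbelow T' z c'.
Proof.
move=> h; pose c' := `|c| + 1; pose a := abs2 z + 1.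
have c'0 : 0 < c' by rewrite ltr_wpDl.
have a0 : 0 < a by rewrite ltr_wpDl// abs2_ge0.
have {}h u : nn u <= c' * nn (u - z *: T u).
  apply: le_trans (h u) _; rewrite ler_wpM2r ?dot_ge0//.
  by apply: le_trans (ler_norm c) _; rewrite lerDl.
exists (4 * c' * a)^-1; first by rewrite invr_gt0 !mulr_gt0.
move=> T' T'P; exists (4 * c') => u.
have e1 : u - z *: T u = (u - z *: T' u) - z *: (T u - T' u).
  by rewrite scalerBr opprB addrA subrK.
have := semidotB_le dP (u - z *: T' u) (z *: (T u - T' u)); rewrite -e1 nnZ => h1.
have h2 := h u; have h4 := dot_ge0 u.
have h3 : 4 * c' * a * nn (T u - T' u) <= nn u.
  by have := T'P u; rewrite mulrC ler_pdivlMr ?mulr_gt0// mulrC.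
have h5 : abs2 z * nn (T u - T' u) <= a * nn (T u - T' u).
  by rewrite ler_wpM2r ?dot_ge0// lerDl.
have h7 : c' * nn (u - z *: T u) <= c' * (2 * nn (u - z *: T' u) + 2 * (a * nn (T u - T' u))).
  by rewrite ler_wpM2l ?(ltW c'0)//; lra.
nra.
Qed.

(** Writing u = T (f + z u) expresses (T^-1 - z) u = f without mentioning the unbounded inverse of
    [T]; the three clauses are existence, uniqueness and boundedness. *)
Definition resolvent z := exists c, forall f, exists u,
  [/\ eqv u (T (f + z *: u)), forall v, eqv v (T (f + z *: v)) -> eqv v u &
      nn u <= c * nn f].

(** The equation u = T (f + z u) is (1 - z T) u = T f. A lower bound makes 1 - z T invertible.
    Conversely (1 - z T)^-1 is recovered from the resolvent R as 1 + z R. *)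
Lemma resolventP z : resolvent z <-> exists c, bddbelow T z c.
Proof.
split=> [[c h]|[c h]].
  pose c' := `|c| + 1; exists (2 + 2 * (abs2 z * c')) => v.
  pose y := v - z *: T v; have [u [u1 _ u3]] := h y.
  (* [x] is the candidate 1 + z R applied to [y]. The vector T (x - v) solves the homogeneous
     equation, so uniqueness makes it null, and then x - v = z T (x - v) is null too. *)
  pose x := y + z *: u.
  have x1 : eqv (x - v) (z *: T (x - v)).
    apply: (@eqv_trans (z *: (T x - T v))); last by apply: eqv_sym; apply: eqvZ; exact: symopB.
    rewrite scalerBr.
    have -> : x - v = z *: u - z *: T v by rewrite /x /y addrAC (addrAC v) subrr sub0r addrC.
    by apply: eqvB => //; exact: eqvZ.
  have x2 : eqv (x - v) 0.
    have [u0 [u01 u02 u03]] := h 0.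
    have z1 : eqv (T (x - v)) u0.
      by apply: u02; rewrite add0r; exact: symop_eqv.
    have z2 : eqv u0 0.
      apply/eqvP; rewrite subr0; apply/eqP; rewrite eq_le dot_ge0 andbT.
      by move: u03; rewrite dotE mulr0.
    apply: eqv_trans x1 _; rewrite -(scaler0 _ z); apply: eqvZ.
    exact: eqv_trans z1 z2.
  have -> : nn v = nn x.
    apply: eqv_nn; apply: eqv_sym => w; rewrite -[x](subrK v) dotDl (x2 w) dotE add0r //.
  apply: le_trans (semidotD_le dP _ _) _; rewrite [(2 + _) * _]mulrDl lerD2l nnZ -!mulrA.
  rewrite ler_wpM2l// ler_wpM2l ?abs2_ge0//; apply: le_trans u3 _.
  rewrite ler_wpM2r ?dot_ge0//; apply: le_trans (ler_norm _) _; by rewrite lerDl.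
have [k k0 kP] := symop_bdd TP.
exists (`|c| * k) => f; have [u uP] := bddbelow_onto h (T f).
have lin w : eqv w (T (f + z *: w)) <-> eqv (w - z *: T w) (T f).
  have e : eqv (T (f + z *: w)) (z *: T w + T f).
    by rewrite [z *: T w + _]addrC; apply: eqv_trans (symopD _ _) _; apply: eqvD => //; exact: symopZ.
  split=> h1; first by apply: eqv_subr; exact: eqv_trans h1 e.
  by apply: (@eqv_trans (z *: T w + T f)); [exact: eqv_subl|exact: eqv_sym].
have h' w : nn w <= `|c| * nn (w - z *: T w).
  by apply: le_trans (h w) _; rewrite ler_wpM2r ?dot_ge0// ler_norm.
exists u; split; first exact/lin.
  move=> v /lin vP; apply/eqvP; apply/eqP; rewrite eq_le dot_ge0 andbT.
  apply: le_trans (h' _) _; rewrite (_ : nn _ = 0) ?mulr0//.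
  have -> : 0 = dot (0 : H) 0 by rewrite dotE.
  apply: eqv_nn; apply: (@eqv_trans ((v - z *: T v) - (u - z *: T u))).
    apply: (@eqv_trans (v - u - z *: (T v - T u))).
      by apply: eqvB => //; apply: eqvZ; exact: symopB.
    by rewrite scalerBr !opprB !addrA => w; rewrite !dotE; ring.
  rewrite -(subrr (T f)); exact: eqvB.
apply: le_trans (h' u) _; rewrite -mulrA ler_wpM2l//; apply: le_trans _ (kP f).
by rewrite (eqv_nn uP).
Qed.

End theory.
End symop.

(** * Spectral gaps and finite-dimensional kernels *)

Section gap.
Variables (R : realType) (H : semiHilbertType R).
Local Notation C := (Cplx R).
Local Notation nn u := (dot u u).
Local Notation dP := (semidot_dot H).
Implicit Types (u v w f g : H) (z : C).

Lemma symop_shift (T : H -> H) (t : R) : symop T -> symop (fun u => T u - toC t *: u).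
Proof.
move=> TP; split=> [u v||u].
- by rewrite !dotE (symopP TP).
- have [k k0 kP] := symop_bdd TP; exists (2 * k + 2 * t ^+ 2).
    by rewrite ltr_wpDr ?mulr_gt0// mulr_ge0// sqr_ge0.
  move=> u; apply: le_trans (semidotB_le dP _ _) _.
  rewrite [X in _ <= X]mulrDl lerD// -mulrA ler_wpM2l//.
  by rewrite nnZ /abs2 /= expr0n addr0.
- rewrite scalerBr !scalerA mulrC -scalerA; apply: eqvB => //.
  exact: (symop_imag TP).
Qed.

(* If [c] is the optimal constant in [c |u|^2 <= |K u|^2], the form
   [|K u|^2 - c |u|^2] is nonnegative and [K^2 - c = (K - s)(K + s)], [s^2 = c];
   were [s < r], both factors would be bounded below, so [c] could be increased. *)
Lemma gap_symmetric (K : H -> H) (r : R) : symop K -> 0 < r ->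
  (forall s, `|s| < r -> exists c, forall u, nn u <= c * nn (K u - toC s *: u)) ->
  forall u, r ^+ 2 * nn u <= nn (K u).
Proof.
move=> KP r0 bb u0; rewrite leNgt; apply/negP => hu0.
have u0p : 0 < nn u0.
  rewrite lt_neqAle dot_ge0 andbT eq_sym; apply/eqP => z.
  by move: hu0; rewrite z mulr0 ltNge dot_ge0.
pose E := [set c : R | forall u, c * nn u <= nn (K u)].
have Eub c : E c -> c < r ^+ 2.
  by move=> /(_ u0) h; rewrite -(ltr_pM2r u0p); exact: le_lt_trans h hu0.
have E0 : E 0 by move=> u; rewrite mul0r dot_ge0.
have supE : has_sup E by split; [exists 0|exists (r ^+ 2) => c /Eub/ltW].
pose c0 := sup E.
have c0E : E c0.
  move=> u; have [->|un0] := eqVneq (nn u) 0; first by rewrite mulr0 dot_ge0.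
  have up : 0 < nn u by rewrite lt_neqAle dot_ge0 andbT eq_sym.
  rewrite -ler_pdivlMr//; apply: ge_sup; first by exists 0.
  by move=> c /(_ u); rewrite ler_pdivlMr.
have c00 : 0 <= c0 by apply: ub_le_sup => //; case: supE.
pose s := Num.sqrt c0.
have s2 : s ^+ 2 = c0 by rewrite sqr_sqrtr.
have sr : `|s| < r.
  rewrite ger0_norm ?sqrtr_ge0//.
  by rewrite -(@ltr_pXn2r _ 2)// ?nnegrE ?sqrtr_ge0 ?(ltW r0)// s2 Eub.
have [a aP] := bb s sr; have [b bP] := bb (- s) (eq_ind_r (fun x => x < r) sr (normrN s)).
pose y u v := dot (K u) (K v) - c0 * dot u v.
have yP : semidot y.
  split=> [u v|u v w|t u v|u]; rewrite /y.
  - by rewrite dotC (dotC u).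
  - by rewrite (symopD KP) !dotDl; ring.
  - by rewrite (symopZr KP) !dotZl; ring.
  - by rewrite subr_ge0 c0E.
pose Y u := K (K u) - toC c0 *: u.
have YE u v : dot (Y u) v = y u v by rewrite /y /Y !dotE !(symopP KP).
have [k k0 kP] := symop_bdd KP.
(* Cauchy-Schwarz for the form [y] at [u] and [Y u] gives |Y u|^4 <= y u u * y (Y u) (Y u), and y (Y
   u) (Y u) <= k |Y u|^2. *)
have Yy u : nn (Y u) <= k * y u u.
  have := cauchy_schwarz yP u (Y u); rewrite -YE => h.
  have [Y0|Yn0] := eqVneq (nn (Y u)) 0.
    by rewrite Y0 mulr_ge0 ?(ltW k0)// (semidot_ge0 yP).
  have Yp : 0 < nn (Y u) by rewrite lt_neqAle dot_ge0 andbT eq_sym.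
  rewrite -(ler_pM2r Yp) -expr2; apply: le_trans h _.
  rewrite mulrAC [X in _ <= X]mulrC ler_wpM2l ?(semidot_ge0 yP)// /y.
  apply: le_trans (kP (Y u)); rewrite gerBl.
  by rewrite mulr_ge0 ?dot_ge0.
have key u : nn u <= `|a| * (`|b| * (k * y u u)).
  apply: le_trans (aP u) _.
  apply: le_trans (ler_wpM2r (dot_ge0 _) (ler_norm a)) _.
  rewrite ler_wpM2l//; apply: le_trans (bP _) _.
  apply: le_trans (ler_wpM2r (dot_ge0 _) (ler_norm b)) _.
  rewrite ler_wpM2l//; apply: le_trans (Yy u).
  rewrite le_eqVlt; apply/orP; left; apply/eqP; apply: eqv_nn => w.
  rewrite /Y !dotE (symopB KP) !dotE (symopZr KP) !dotE -s2; ring.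
pose e := (`|a| * (`|b| * k) + 1)^-1.
have ep : 0 < `|a| * (`|b| * k) + 1.
  by rewrite ltr_wpDl// !mulr_ge0// ltW.
have : E (c0 + e).
  move=> u; have hk := key u; have yge := semidot_ge0 yP u.
  have : e * nn u <= y u u.
    rewrite mulrC ler_pdivrMr//; apply: le_trans hk _.
    move: (y u u) yge => z z0; rewrite mulrDr mulr1 -subr_ge0.
    by rewrite (_ : _ - _ = z)//; ring.
  by rewrite /y mulrDl; lra.
move=> /(ub_le_sup supE.2); rewrite -/c0 leNgt => /negP; apply.
by rewrite ltrDl invr_gt0.
Qed.

(* With [m_j = <K^j u, u>], the gaps on both sides of [0] give
   [m_2 >= d |m_1|] for all [u]; applying this to [K u + t u] with
   [t = d/2] and [t = -d/2] and adding up gives [m_4 >= 3/4 d^2 m_2]. *)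
Lemma gap_range (K : H -> H) (d : R) : symop K -> 0 < d ->
  (forall s, s != 0 -> `|s| < d ->
     exists c, forall u, nn u <= c * nn (K u - toC s *: u)) ->
  forall u, 3 / 4 * d ^+ 2 * nn (K u) <= nn (K (K u)).
Proof.
move=> KP d0 bb u.
(* Shifting [K] by m = d/2 or m = -d/2 centres the punctured gap on one side of 0, with half width
   d/2. Expanding |K v - m v|^2 >= m^2 |v|^2 cancels the terms in |v|^2. *)
have side (m : R) : `|m| = d / 2 -> forall v, 2 * m * dot (K v) v <= nn (K v).
  move=> md v; have d20 : 0 < d / 2 by rewrite divr_gt0.
  have := @gap_symmetric _ (d / 2) (symop_shift m KP) d20 _ v.
  have h s : `|s| < d / 2 ->
      exists c, forall u, nn u <= c * nn (K u - toC m *: u - toC s *: u).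
    move=> sd; have [||c cP] := bb (m + s).
    - rewrite addr_eq0; apply/eqP => ms; move: sd; rewrite -md ms normrN ltxx //.
    - by rewrite (le_lt_trans (ler_normD _ _))// md [X in _ < X](splitr d) ltrD2l.
    exists c => w; apply: le_trans (cP w) _.
    by rewrite toCD scalerDl opprD addrA.
  move=> /(_ h).
  have -> : (d / 2) ^+ 2 = m ^+ 2 by rewrite -md real_normK// num_real.
  rewrite !dotE (dotC v (K v)) expr2; lra.
pose v := K u.
have ext (t : R) : let x := v + toC t *: u in
    nn (K x) = nn (K v) + 2 * t * dot (K v) v + t ^+ 2 * nn v /\
    dot (K x) x = dot (K v) v + 2 * t * nn v + t ^+ 2 * dot v u.
  move=> x.
  have Kx : eqv (K x) (K v + toC t *: v).
    by apply: eqv_trans (symopD KP _ _) _; apply: eqvD => //; exact: symopZr.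
  have Kvu : dot (K v) u = nn v by rewrite (symopP KP).
  split; first by rewrite (eqv_nn Kx) !dotE (dotC v (K v)); ring.
  by rewrite Kx /x !dotE Kvu; ring.
have dd : `|d / 2| = d / 2 by rewrite gtr0_norm// divr_gt0.
have dN : `|- (d / 2)| = d / 2 by rewrite normrN.
have := side _ dd (v + toC (d / 2) *: u); have [-> ->] := ext (d / 2).
have := side _ dN (v + toC (- (d / 2)) *: u); have [-> ->] := ext (- (d / 2)).
rewrite -/v !expr2; nra.
Qed.

(* [n] is the projection of [v] on the closure of the range of [K]. *)
Lemma kernel_decomp (K : H -> H) (c : R) : symop K -> 0 < c ->
  (forall u, c * nn (K u) <= nn (K (K u))) ->
  forall v, exists n, nn (K (v - n)) = 0 /\ c * nn n <= 4 * nn (K v).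
Proof.
move=> KP c0 gap v.
pose D y := forall e : R, 0 < e -> exists u, nn (y - K u) < e.
have DS : real_subspace D.
  split=> [e e0|x y xD yD e e0|a x xD e e0].
  - exists 0; rewrite (_ : nn _ = 0)// sub0r !dotE opprK (symopP KP) dotE //.
  - have e4 : 0 < e / 4 by rewrite divr_gt0.
    have [p pP] := xD _ e4; have [q qP] := yD _ e4; exists (p + q).
    rewrite (@eqv_nn _ _ _ ((x - K p) + (y - K q))); last first.
      by move=> w; rewrite !dotE (symopD KP) !dotE; ring.
    by have := semidotD_le dP (x - K p) (y - K q); lra.
  - have a0 : 0 < a ^+ 2 + 1 by rewrite ltr_wpDl// sqr_ge0.
    have [p pP] := xD _ (divr_gt0 e0 a0); exists (toC a *: p).
    rewrite (@eqv_nn _ _ _ (toC a *: (x - K p))); last first.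
      by move=> w; rewrite !dotE (symopZr KP) !dotE; ring.
    rewrite nnZ /abs2 /= expr0n addr0; move: pP; rewrite ltr_pdivlMr// => pP.
    by apply: le_lt_trans pP; rewrite mulrC ler_wpM2l ?dot_ge0// lerDl.
have Dc : complete_on (@dot R H) D.
  move=> x xD xC; have [l lP] := @dot_complete R H x xC; exists l => // e e0.
  have e4 : 0 < e / 4 by rewrite divr_gt0.
  have [N NP] := lP _ e4; have [p pP] := xD N _ e4; exists p.
  have -> : l - K p = (x N - K p) - (x N - l) by rewrite opprB [RHS]addrC addrA subrK.
  have := semidotB_le dP (x N - K p) (x N - l); have := NP N (leqnn N); lra.
have [|||n nD nP] := @riesz _ _ _ dP D (dot v) (nn v) DS Dc.
- by move=> x y _ _; rewrite dotE.
- by move=> a x _; rewrite dotE.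
- by move=> x _; exact: (cauchy_schwarz dP).
have DK w : D (K w) by move=> e e0; exists w; rewrite subrr dotE.
have ker : eqv (K (v - n)) 0.
  by move=> w; rewrite (symopP KP) !dotE nP// subrr.
exists n; split; first by rewrite (eqv_nn ker) dotE.
have KE : eqv (K v) (K n).
  move=> w; apply/eqP; rewrite -subr_eq0; apply/eqP.
  by have := ker w; rewrite (symopB KP) !dotE.
rewrite (eqv_nn KE); apply/ler_addgt0Pl => e e0.
have [k k0 kP] := symop_bdd KP.
(* With |n - K p|^2 < delta, the gap at [p] gives c |n|^2 <= 4 |K n|^2 + (2 c + 4 k) delta. *)
have ck : 0 < 2 * c + 4 * k by rewrite addr_gt0 ?mulr_gt0.
have [p pP] := nD _ (divr_gt0 e0 ck).
have h1 : nn n <= 2 * nn (n - K p) + 2 * nn (K p).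
  by have := semidotD_le dP (n - K p) (K p); rewrite subrK.
have h2 : nn (K (K p)) <= 2 * nn (K n) + 2 * nn (K (n - K p)).
  have := semidotB_le dP (K n) (K (n - K p)).
  rewrite (@eqv_nn _ _ (K n - _) (K (K p)))// => w.
  by rewrite dotDl dotE (symopB KP) !dotE; ring.
have h3 := gap p; have h4 := kP (n - K p).
move: pP; rewrite ltr_pdivlMr// => pP.
have h5 : c * nn n <= c * (2 * nn (n - K p) + 2 * nn (K p)) by rewrite ler_wpM2l ?(ltW c0).
lra.
Qed.

Lemma nn_sum_le n (x : 'I_n -> H) (b : R) : 0 <= b ->
  (forall i, nn (x i) <= b) -> nn (\sum_i x i) <= 4 ^+ n * b.
Proof.
elim: n x => [|n IH] x b0 xb; first by rewrite big_ord0 dotE expr0 mul1r.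
rewrite big_ord_recr /=; apply: le_trans (semidotD_le dP _ _) _.
have := IH _ b0 (fun i => xb (widen_ord (leqnSn n) i)); have := xb ord_max.
have : 1 <= 4 ^+ n :> R by rewrite exprn_ege1// ler1n.
rewrite exprS => h1 h2 h3.
have h4 : 1 * b <= 4 ^+ n * b by rewrite ler_wpM2r.
lra.
Qed.

(** A nonzero vector of the left kernel is divided by its entry of largest modulus: the coefficient
    1 gives a lower bound for the combination, the bound on the others controls the errors. *)
Lemma dependent_combination n (c : 'M[C]_(n.+1, n)) : exists (a : 'I_n.+1 -> C) (i0 : 'I_n.+1),
  [/\ forall j, \sum_i a i * c i j = 0, a i0 = 1 & forall i, abs2 (a i) <= 1].
Proof.
have /eqP/eqP/matrix0Pn[i1 [j1 kn0]] : kermx c != 0.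
  rewrite kermx_eq0 /row_free; apply/negP => /eqP h.
  by have := rank_leq_col c; rewrite h ltnn.
pose b := row i1 (kermx c).
have bc : b *m c = 0 by rewrite -row_mul mulmx_ker row0.
have b0 : b 0 j1 != 0 by rewrite mxE.
pose i0 := [arg max_(i > j1) abs2 (b 0 i)]%O.
have i0P i : abs2 (b 0 i) <= abs2 (b 0 i0).
  by rewrite /i0; case: arg_maxP => // k _ h; exact: h.
have abs20 z : (abs2 z == 0) = (z == 0).
  by case: z => x y; rewrite /abs2 paddr_eq0 ?sqr_ge0// !sqrf_eq0 eq_complex.
have bi0 : b 0 i0 != 0.
  have : abs2 (b 0 j1) != 0 by rewrite abs20.
  rewrite -abs20 => h; apply: lt0r_neq0; apply: lt_le_trans (i0P j1).
  by rewrite lt_neqAle abs2_ge0 eq_sym h.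
exists (fun i => b 0 i / b 0 i0), i0; split.
- move=> j; under eq_bigr do rewrite mulrAC; rewrite -mulr_suml.
  have : (b *m c) 0 j = 0 by rewrite bc mxE.
  by rewrite mxE => ->; rewrite mul0r.
- by rewrite divff.
- move=> i.
  have abs2M x y : abs2 (x * y) = abs2 x * abs2 y.
    by case: x => ? ?; case: y => ? ?; rewrite /abs2 /=; ring.
  have p : 0 < abs2 (b 0 i0) by rewrite lt_neqAle abs2_ge0 eq_sym abs20 bi0.
  by rewrite -(ler_pM2r p) -abs2M mulfVK// mul1r.
Qed.

(* More almost orthogonal approximate null vectors than the dimension of the kernel:
   a combination of their projections on the kernel vanishes, although the
   combination itself is far from 0. *)
Lemma finite_kernel (K : H -> H) (c N0 : R) n (e : 'I_n -> H) : symop K ->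
  0 < c -> 0 < N0 ->
  (forall u, c * nn (K u) <= nn (K (K u))) ->
  (forall k, nn (K k) = 0 -> exists a, eqv k (\sum_(j < n) a j *: e j)) ->
  exists2 h : R, 0 < h & forall v : 'I_n.+1 -> H,
    (forall i, nn (v i) = N0) -> (forall i, nn (K (v i)) <= h) ->
    (forall i j, i != j -> `|dot (v i) (v j)| <= h /\ `|dot (imag *: v i) (v j)| <= h) ->
    False.
Proof.
move=> KP c0 N00 gap span.
pose M : R := 4 ^+ n.+1 * (4 / c).
have M0 : 0 < M by rewrite mulr_gt0 ?exprn_gt0 ?divr_gt0.
(* With B h = N0 the off-diagonal errors 2 (n+1) h are at most N0/4 and the squared norm M h of the
   combination is at most N0/8; testing against [v i0], Cauchy-Schwarz would give N0^2/4 <=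
   N0^2/8. *)
pose B : R := 8 * n.+1%:R + 8 * M.
have B0 : 0 < B by apply: addr_gt0; apply: mulr_gt0; rewrite ?ltr0n.
exists (N0 / B) => [|v vN vK vv]; first by rewrite divr_gt0.
set h := N0 / B in vK vv.
have h0 : 0 < h by rewrite divr_gt0.
have [m mP] := choice (fun i => kernel_decomp KP c0 gap (v i)).
have [a aP] := @choice _ _ (fun i b => eqv (v i - m i) (\sum_(j < n) b j *: e j))
  (fun i => span _ (mP i).1).
have [t [i0 [t0 t1 tle]]] := dependent_combination (\matrix_(i, j) a i j).
have dot_sum (F : 'I_n.+1 -> H) w : dot (\sum_i F i) w = \sum_i dot (F i) w.
  by elim/big_rec2 : _ => [|i x y _ <-]; rewrite dotE.
have E : eqv (\sum_i t i *: v i) (\sum_i t i *: m i).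
  have : eqv (\sum_i t i *: (v i - m i)) 0.
    have z : \sum_i t i *: (\sum_(j < n) a i j *: e j) = 0.
      under eq_bigr do rewrite scaler_sumr.
      rewrite exchange_big /= big1// => j _.
      under eq_bigr do rewrite scalerA.
      rewrite -scaler_suml (_ : \sum_i _ = 0) ?scale0r// -[RHS](t0 j).
      by apply: eq_bigr => i _; rewrite mxE.
    move=> w; rewrite -[X in _ = dot X _]z !dot_sum; apply: eq_bigr => i _. exact: eqvZ.
  under eq_bigr do rewrite scalerBr; rewrite sumrB => hh w.
  by apply/eqP; rewrite -subr_eq0; apply/eqP; have := hh w; rewrite !dotE.
have hm i : nn (t i *: m i) <= 4 / c * h.
  rewrite nnZ; apply: le_trans (ler_wpM2r (dot_ge0 _) (tle i)) _.
  rewrite mul1r mulrAC ler_pdivlMr// mulrC.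
  by have [_ q] := mP i; apply: le_trans q _; rewrite ler_wpM2l.
have h4c : 0 <= 4 / c * h by rewrite mulr_ge0 ?divr_ge0 ?ltW.
have up := nn_sum_le h4c hm.
have CS := cauchy_schwarz dP (\sum_i t i *: v i) (v i0).
have low : N0 - 2 * n.+1%:R * h <= dot (\sum_i t i *: v i) (v i0).
  rewrite dot_sum (bigD1 i0)//= t1 scale1r vN lerD2l.
  have -> : - (2 * n.+1%:R * h) = \sum_(i < n.+1) (- (2 * h)).
    by rewrite sumr_const card_ord -mulr_natl; ring.
  rewrite [leLHS](bigD1 i0)//=.
  apply: (@le_trans _ _ (\sum_(i < n.+1 | i != i0) (- (2 * h)))).
    by rewrite gerDr oppr_le0 mulr_ge0// ltW.
  apply: ler_sum => i ii0; have [d1 d2] := vv i i0 ii0.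
  rewrite scaleC !dotE.
  have r1 : `|reC (t i)| <= 1.
    rewrite -(@ler_pXn2r _ 2)// ?nnegrE// real_normK ?num_real// expr1n.
    by apply: le_trans (tle i); rewrite /abs2 lerDl sqr_ge0.
  have r2 : `|imC (t i)| <= 1.
    rewrite -(@ler_pXn2r _ 2)// ?nnegrE// real_normK ?num_real// expr1n.
    by apply: le_trans (tle i); rewrite /abs2 lerDr sqr_ge0.
  have p1 : `|reC (t i) * dot (v i) (v i0)| <= 1 * h by rewrite normrM ler_pM.
  have p2 : `|imC (t i) * dot (imag *: v i) (v i0)| <= 1 * h by rewrite normrM ler_pM.
  move: p1 p2; rewrite !ler_norml; lra.
have hB : B * h = N0 by rewrite mulrC divfK// gt_eqF.
have hB' : 8 * (n.+1%:R * h) + 8 * (M * h) = N0.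
  by rewrite -hB /B; ring.
have n0 : 0 <= n.+1%:R * h by rewrite mulr_ge0// ltW.
have Mh0 : 0 <= M * h by rewrite mulr_ge0// ltW.
rewrite vN (eqv_nn E) in CS.
have {}up : nn (\sum_i t i *: m i) <= M * h by rewrite /M -mulrA.
have : (N0 / 2) ^+ 2 <= dot (\sum_i t i *: v i) (v i0) ^+ 2.
  rewrite ler_pXn2r// ?nnegrE ?divr_ge0 ?(ltW N00)//; last lra.
  by apply: le_trans _ low; lra.
rewrite !expr2 in CS *; nra.
Qed.

End gap.

(** * Resolvents of coercive forms *)

Lemma dot_young (R : realType) (V : semiHilbertType R) (x y : V) :
  - dot x y <= dot x x + dot y y / 4.
Proof.
have := semidot_ge0 (semidot_dot V) (toC 2 *: x + y).
by rewrite !dotE (dotC y x); lra.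
Qed.

Section formres.
Variables (R : realType) (H G : semiHilbertType R).
Local Notation C := (Cplx R).
Local Notation nn u := (dot u u).

(** [Q] is to be thought of as the graph of u |-> grad u for a closed form: a closed complex
    subspace of pairs, the form being the inner product of second components. *)
Record form_domain (Q : H * G -> Prop) : Prop := {
  form_domain0 : Q 0;
  form_domainD : forall x y, Q x -> Q y -> Q (x + y);
  form_domainZ : forall (z : C) x, Q x -> Q (z *: x);
  form_domain_closed : forall x,
    (forall e : R, 0 < e -> exists2 y, Q y & nn (x - y) < e) -> Q x }.

(** The bounded zero-order part of the form. The lower bound 1 is a normalization, by which the
    energy dominates |u|^2 + |g|^2. *)
Record coercive_op (W : H -> H) : Prop := {
  coerciveD : forall u v, W (u + v) = W u + W v;
  coerciveZ : forall (z : C) u, W (z *: u) = z *: W u;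
  coerciveP : forall u v, dot (W u) v = dot u (W v);
  coercive_bdd : exists2 c : R, 0 < c & forall u, nn (W u) <= c * nn u;
  coercive_ge : forall u, nn u <= dot (W u) u }.

(** The equation (grad* grad + W) u = f in weak form, with [g] the gradient of [u] and [y] ranging
    over test pairs. *)
Definition weak_solution (Q : H * G -> Prop) (W : H -> H) (u f : H) := exists2 g, Q (u, g) &
  forall y, Q y -> dot g y.2 + dot (W u) y.1 = dot f y.1.

Section one.
Variables (Q : H * G -> Prop) (QP : form_domain Q) (W : H -> H) (WP : coercive_op W).

Lemma form_domainB x y : Q x -> Q y -> Q (x - y).
Proof.
move=> Qx Qy; apply: form_domainD => //; rewrite -scaleN1r; exact: form_domainZ.
Qed.

Lemma form_domain_eqv u v g : Q (u, g) -> eqv u v -> Q (v, g).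
Proof.
move=> Qu uv; apply: (form_domain_closed QP) => e e0; exists (u, g) => //.
rewrite /dot /= /pdot /= subrr (semidot0l (semidot_dot G)) addr0.
by have /eqvP -> := eqv_sym uv.
Qed.

Definition energy (x y : H * G) : R := dot x.2 y.2 + dot (W x.1) y.1.

Lemma energy_ge x : nn x.1 + nn x.2 <= energy x x.
Proof. by rewrite /energy addrC lerD2l (coercive_ge WP). Qed.

Lemma energy_semidot : semidot energy.
Proof.
split=> [x y|x y z|a x y|x]; rewrite /energy /=.
- by rewrite dotC (coerciveP WP) [in X in _ + X]dotC.
- by rewrite (coerciveD WP) !dotE; ring.
- by rewrite (coerciveZ WP) !dotE; ring.
- by apply: le_trans (energy_ge x); rewrite addr_ge0 ?dot_ge0.
Qed.
Local Notation eP := energy_semidot.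

Lemma energy_le : exists2 c : R, 0 < c & forall x, energy x x <= c * nn x.
Proof.
have [c c0 cP] := coercive_bdd WP; exists (2 + c); first by rewrite addr_gt0.
move=> x; rewrite /energy [X in _ <= _ * X]/(nn x.1 + nn x.2).
have := semidot_ge0 (semidot_dot H) (W x.1 - x.1); rewrite !dotE (dotC x.1 (W x.1)).
have c1 : 0 <= c * nn x.1 by rewrite mulr_ge0 ?dot_ge0 ?ltW.
have c2 : 0 <= c * nn x.2 by rewrite mulr_ge0 ?dot_ge0 ?ltW.
have := cP x.1; have := dot_ge0 x.1; have := dot_ge0 x.2; rewrite mulrDl !mulrDr; move: (dot x.1 x.1) (dot x.2 x.2) (dot (W x.1) x.1) (dot (W x.1) (W x.1)) c1 c2 => p q r s; lra.
Qed.

Lemma energy_complete : complete_on energy Q.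
Proof.
move=> x xQ xC.
have [|l lP] := @dot_complete R (H * G)%type x.
  move=> e e0; have [N NP] := xC e e0; exists N => m n Nm Nn.
  exact: le_lt_trans (energy_ge _) (NP m n Nm Nn).
have [c c0 cP] := energy_le.
exists l; last first.
  move=> e e0; have [N NP] := lP _ (divr_gt0 e0 c0); exists N => n Nn.
  by have := NP n Nn; rewrite ltr_pdivlMr// mulrC; exact: le_lt_trans (cP _).
apply: (form_domain_closed QP) => e e0; have [N NP] := lP e e0; exists (x N) => //.
rewrite (semidot_sym (semidot_dot _)); exact: NP.
Qed.

(** Riesz for the energy on [Q], which is complete because the energy is equivalent to the norm of
    pairs and [Q] is closed. *)
Lemma weak_solution_exists f : exists u, weak_solution Q W u f.
Proof.
have [||||[u g] Qu uP] := @riesz _ _ energy eP Q (fun x => dot f x.1) (nn f) _ energy_complete.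
- split; [exact: (form_domain0 QP)|exact: (form_domainD QP)|].
  by move=> a x; exact: (form_domainZ QP).
- by move=> x y _ _; rewrite /= !dotE.
- by move=> a x _; rewrite /= !dotE.
- move=> x _; apply: le_trans (cauchy_schwarz (semidot_dot H) _ _) _.
  rewrite ler_wpM2l ?dot_ge0//; apply: le_trans (energy_ge x).
  by rewrite lerDl dot_ge0.
by exists u, g => // y /uP /= ->.
Qed.

Lemma weak_solution_unique u v f : weak_solution Q W u f -> weak_solution Q W v f -> eqv u v.
Proof.
move=> [g Qu uP] [h Qv vP].
have Qd : Q (u - v, g - h) by have := form_domainB Qu Qv.
have := energy_ge (u - v, g - h).
have -> : energy (u - v, g - h) (u - v, g - h) = 0.
  rewrite -[X in energy X]/((u, g) - (v, h)) (semidotDl eP).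
  rewrite (semidotNl eP) /energy /=.
  by have /= -> := uP _ Qd; have /= -> := vP _ Qd; rewrite subrr.
move=> /= h0; apply/eqvP; apply/eqP; rewrite eq_le dot_ge0 andbT.
by have := dot_ge0 (g - h); lra.
Qed.

Lemma weak_solution_eqv u v f : weak_solution Q W u f -> eqv u v -> weak_solution Q W v f.
Proof.
move=> [g Qu uP] uv; exists g; first exact: form_domain_eqv Qu uv.
by move=> y Qy; rewrite -uP// !(coerciveP WP) uv.
Qed.

Section res.
Variables (T : H -> H) (TP : forall f, weak_solution Q W (T f) f).

Lemma weak_solutionP u f : weak_solution Q W u f <-> eqv u (T f).
Proof.
split; first by move=> h; exact: weak_solution_unique h (TP f).
by move=> /(@eqv_sym _ _ _ _); exact: weak_solution_eqv.
Qed.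

Lemma weak_solution_le f g : Q (T f, g) ->
  (forall y, Q y -> dot g y.2 + dot (W (T f)) y.1 = dot f y.1) ->
  nn (T f) + nn g <= nn f.
Proof.
move=> Qf /(_ _ Qf) /= e; have := energy_ge (T f, g); rewrite /energy /= e => h.
have := semidot_ge0 (semidot_dot H) (f - T f); rewrite !dotE (dotC (T f) f).
by have := dot_ge0 g; lra.
Qed.

Lemma resolvent_symop : symop T.
Proof.
split=> [f h||f].
- have [g Q1 e1] := TP f; have [k Q2 e2] := TP h.
  rewrite dotC -(e1 _ Q2) -(e2 _ Q1) /= (dotC g) (coerciveP WP) [in X in _ + X]dotC //.
- exists 1 => // f; rewrite mul1r; have [g Qf e] := TP f.
  by apply: le_trans (weak_solution_le Qf e); rewrite lerDl dot_ge0.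
- apply: eqv_sym; apply/weak_solutionP; have [g Qf e] := TP f.
  exists (imag *: g); first exact: (form_domainZ QP imag Qf).
  move=> y Qy; rewrite (coerciveZ WP) !dot_imag -(e (imag *: y)) /=; first by ring.
  exact: (form_domainZ QP).
Qed.
End res.
End one.

Lemma resolvent_exists Q W : form_domain Q -> coercive_op W ->
  exists T : H -> H, forall f, weak_solution Q W (T f) f.
Proof.
by move=> QP WP; have [T TP] := choice (weak_solution_exists QP WP); exists T.
Qed.

(** [a] is the difference of the two gradients, so [Q'] is [Q] sheared by [a]. Both weak equations
    are tested with the difference of the solutions; the principal parts combine into its energy,
    and what remains is small with [a] and [W - W']. *)
Lemma resolvent_perturb Q Q' W W' T T' (a : H -> G) (e : R) :
  form_domain Q -> form_domain Q' -> coercive_op W -> coercive_op W' ->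
  (forall f, weak_solution Q W (T f) f) -> (forall f, weak_solution Q' W' (T' f) f) ->
  0 < e -> (forall u, nn (a u) <= e * nn u) -> (forall u, nn (W u - W' u) <= e * nn u) ->
  (forall u g, Q (u, g) -> Q' (u, g - a u)) -> (forall u g, Q' (u, g) -> Q (u, g + a u)) ->
  forall f, nn (T f - T' f) <= 4 * e * nn f.
Proof.
move=> QP QP' WP WP' TP TP' e0 ae We QQ' Q'Q f.
have [g Qu uP] := TP f; have [g' Qu' uP'] := TP' f.
set u := T f in Qu uP *; set u' := T' f in Qu' uP' *.
(* The second solution is first moved into [Q] by adding [a u'] to its gradient. The difference is
   admissible in [Q], and after subtracting [a d1] also in [Q']. *)
have [[d1 d2] [d1E d2E]] : exists d : H * G, d.1 = u - u' /\ d.2 = g - (g' + a u').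
  by exists (u - u', g - (g' + a u')).
rewrite /= in d1E d2E.
have Qd : Q (d1, d2) by rewrite d1E d2E; have := form_domainB QP Qu (Q'Q _ _ Qu').
have E1 : dot g d2 + dot (W u) d1 = dot f d1 := uP _ Qd.
have E2 : dot g' (d2 - a d1) + dot (W' u') d1 = dot f d1 := uP' _ (QQ' _ _ Qd).
have := energy_ge WP (d1, d2); rewrite /energy /=.
have -> : dot d2 d2 + dot (W d1) d1 =
    - dot g' (a d1) - dot (a u') d2 - dot (W u' - W' u') d1.
  have -> : W d1 = W u - W u'.
    by rewrite d1E (coerciveD WP) -scaleN1r (coerciveZ WP) scaleN1r.
  rewrite [X in X + _](_ : _ = dot g d2 - dot g' d2 - dot (a u') d2); last first.
    by rewrite {1}d2E !dotE; ring.
  move: E2; rewrite -E1 (semidotDr (semidot_dot G)) (semidotNr (semidot_dot G)).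
  rewrite !(semidotDl (semidot_dot H)) !(semidotNl (semidot_dot H)).
  move: (dot g d2) (dot g' d2) (dot (W u) d1) => p q r; lra.
(* Young's inequality weighted by [e], since |a d1|^2 <= e |d1|^2: the quarter of |d1|^2 is absorbed
   by the energy and [e] stays in front of |g'|^2, which |f|^2 controls. *)
have c1 : - dot g' (a d1) <= e * nn g' + nn d1 / 4.
  have := semidot_ge0 (semidot_dot G) (toC (2 * e) *: g' + a d1).
  rewrite !dotE (dotC (a d1) g') => h; have h2 := ae d1.
  have h3 : 0 <= 4 * e * (e * nn g' + dot g' (a d1) + nn d1 / 4) by nra.
  by move: h3; rewrite pmulr_rge0 ?mulr_gt0//; lra.
have c2 : - dot (a u') d2 <= nn (a u') + nn d2 / 4.
  exact: dot_young.
have c3 : - dot (W u' - W' u') d1 <= nn (W u' - W' u') + nn d1 / 4.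
  exact: dot_young.
have c4 := ae u'; have c5 := We u'.
have c6 := weak_solution_le WP' Qu' uP'; rewrite -/u' in c6.
have c7 := dot_ge0 d2.
have c8 : e * (nn u' + nn g') <= e * nn f by rewrite ler_wpM2l ?(ltW e0).
have c9 : 0 <= e * nn g' by rewrite mulr_ge0 ?dot_ge0 ?ltW.
rewrite -d1E mulrDr in c8 *; move: c1 c2 c3 c4 c5 c7 c8 c9; rewrite -[4 * e * _]mulrA.
move: (dot g' (a d1)) (dot (a u') d2) (dot (W u' - W' u') d1) (nn d1) (nn d2)
  (nn (a u')) (nn (W u' - W' u')) (e * nn u') (e * nn g') (e * nn f).
move=> *; lra.
Qed.

(** S (T f) solves the primed problem with datum S f, because every test pair of [Q'] is the
    transport of one of [Q]; uniqueness concludes. *)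
Lemma resolvent_covariant Q Q' W W' T T' (S : H -> H) (SG : G -> G) :
  form_domain Q' -> coercive_op W' ->
  (forall f, weak_solution Q W (T f) f) -> (forall f, weak_solution Q' W' (T' f) f) ->
  (forall u v, dot (S u) (S v) = dot u v) -> (forall u v, dot (SG u) (SG v) = dot u v) ->
  (forall u, W' (S u) = S (W u)) ->
  (forall u g, Q (u, g) -> Q' (S u, SG g)) ->
  (forall y, Q' y -> exists u g, Q (u, g) /\ y = (S u, SG g)) ->
  forall f, eqv (S (T f)) (T' (S f)).
Proof.
move=> QP' WP' TP TP' SP SGP WS QQ' Q'Q f; apply/(weak_solutionP QP' WP' TP').
have [g Qu uP] := TP f; exists (SG g); first exact: QQ'.
move=> y /Q'Q[v [h [Qv ->]]] /=; rewrite SGP WS !SP; exact: (uP _ Qv).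
Qed.

End formres.

(** * Square integrable functions *)

Section L2.
Context d (T : measurableType d) (R : realType) (mu : {measure set T -> \bar R}).
Implicit Types f g h : T -> R.
Local Notation integrable1 f := (mu.-integrable setT (EFin \o f)).

Definition sqint f := measurable_fun setT f /\ (\int[mu]_x (f x ^+ 2)%:E < +oo)%E.

Lemma sqint_sqr f : sqint f -> integrable1 (fun x => f x ^+ 2).
Proof.
move=> [mf foo]; apply/integrableP; split.
  by apply/measurable_EFinP; exact: measurable_funX.
rewrite (eq_integral (fun x => (f x ^+ 2)%:E))// => x _ /=.
by rewrite ger0_norm// sqr_ge0.
Qed.

Lemma sqint_mul f g : sqint f -> sqint g -> integrable1 (fun x => f x * g x).
Proof.
move=> Hf Hg.
have i : integrable1 (fun x => f x ^+ 2 + g x ^+ 2).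
  have := integrableD measurableT (sqint_sqr Hf) (sqint_sqr Hg).
  by apply: eq_integrable => // x _.
apply: le_integrable i => //.
  by apply/measurable_EFinP; apply: measurable_funM; [case: Hf|case: Hg].
move=> x _ /=; rewrite lee_fin [leRHS]ger0_norm ?addr_ge0 ?sqr_ge0//.
rewrite ler_norml; have := sqr_ge0 (f x + g x); have := sqr_ge0 (f x - g x).
by rewrite !expr2 => *; apply/andP; split; nra.
Qed.

Lemma sqintP f : measurable_fun setT f -> integrable1 (fun x => f x ^+ 2) -> sqint f.
Proof.
move=> mf /integrableP[_]; rewrite (eq_integral (fun x => (f x ^+ 2)%:E)) => [|x _ /=].
  by split.
by rewrite ger0_norm// sqr_ge0.
Qed.

Lemma sqint_le f g : measurable_fun setT f -> sqint g -> (forall x, f x ^+ 2 <= g x ^+ 2) ->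
  sqint f.
Proof.
move=> mf Hg fg; apply: sqintP => //; apply: le_integrable (sqint_sqr Hg) => //.
  by apply/measurable_EFinP; exact: measurable_funX.
by move=> x _ /=; rewrite lee_fin !ger0_norm ?sqr_ge0.
Qed.

Lemma sqintZ a f : sqint f -> sqint (fun x => a * f x).
Proof.
move=> Hf; apply: sqintP; first by apply: measurable_funM => //; case: Hf.
have := integrableZl measurableT (a ^+ 2) (sqint_sqr Hf).
by apply: eq_integrable => // x _ /=; rewrite exprMn EFinM.
Qed.

Lemma sqintD f g : sqint f -> sqint g -> sqint (fun x => f x + g x).
Proof.
move=> Hf Hg; apply: sqintP; first by apply: measurable_funD; [case: Hf|case: Hg].
have i : integrable1 (fun x => 2 * f x ^+ 2 + 2 * g x ^+ 2).
  have := integrableD measurableT (integrableZl measurableT 2 (sqint_sqr Hf))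
    (integrableZl measurableT 2 (sqint_sqr Hg)).
  by apply: eq_integrable => // x _ /=; rewrite EFinD !EFinM.
apply: le_integrable i => //.
  by apply/measurable_EFinP; apply: measurable_funX; apply: measurable_funD; [case: Hf|case: Hg].
move=> x _ /=; rewrite lee_fin ger0_norm ?sqr_ge0//; apply: le_trans (ler_norm _).
by have := sqr_ge0 (f x - g x); rewrite !expr2 => *; nra.
Qed.

Lemma sqintN f : sqint f -> sqint (fun x => - f x).
Proof.
by move=> /(sqintZ (-1)); under [X in sqint X]eq_fun do rewrite mulN1r.
Qed.

Lemma sqintB f g : sqint f -> sqint g -> sqint (fun x => f x - g x).
Proof. by move=> Hf Hg; apply: sqintD => //; exact: sqintN. Qed.

Lemma sqint0 : sqint (fun=> 0).
Proof.
split=> //; under eq_integral do rewrite expr0n.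
by rewrite integral0 ltry.
Qed.

Lemma sqint_indic (A : set T) : measurable A -> (mu A < +oo)%E -> sqint \1_A.
Proof.
move=> mA Aoo; split; first exact: measurable_indic.
rewrite (eq_integral (fun x => (\1_A x)%:E)); first by rewrite integral_indic// setIT.
by move=> x _; rewrite indicE; case: (_ \in _); rewrite ?expr1n ?expr0n.
Qed.

Lemma sqint_bounded f M (A : set T) : measurable A -> (mu A < +oo)%E ->
  measurable_fun setT f -> (forall x, A x -> `|f x| <= M) -> (forall x, ~ A x -> f x = 0) ->
  sqint f.
Proof.
move=> mA Aoo mf fM f0; apply: (@sqint_le _ (fun x => M * \1_A x)) => //.
  exact/sqintZ/sqint_indic.
move=> x; rewrite indicE; have [/set_mem h|/negP h] := boolP (x \in A).
  have := fM x h => hM; rewrite mulr1 -[leLHS]real_normK ?num_real// lerXn2r ?nnegrE//.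
  exact: le_trans hM.
by rewrite f0 ?mulr0// => /mem_set.
Qed.

Lemma sqint_integrable f (A : set T) : measurable A -> (mu A < +oo)%E -> sqint f ->
  mu.-integrable A (EFin \o f).
Proof.
move=> mA Aoo Hf; apply/(integrable_mkcond _ mA).
apply: eq_integrable (sqint_mul Hf (sqint_indic mA Aoo)) => // x _; rewrite /= patchE indicE.
by case: (x \in _); rewrite ?mulr1 ?mulr0.
Qed.

Definition rdot f g := Rintegral mu setT (fun x => f x * g x).

Lemma rdotC f g : rdot f g = rdot g f.
Proof. by apply: eq_Rintegral => x _; rewrite mulrC. Qed.

Lemma rdotDl f g h : sqint f -> sqint g -> sqint h ->
  rdot (fun x => f x + g x) h = rdot f h + rdot g h.
Proof.
move=> Hf Hg Hh; rewrite /rdot -RintegralD//; try exact: sqint_mul.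
by apply: eq_Rintegral => x _; rewrite mulrDl.
Qed.

Lemma rdotZl a f h : sqint f -> sqint h -> rdot (fun x => a * f x) h = a * rdot f h.
Proof.
move=> Hf Hh; rewrite /rdot -RintegralZl//; last exact: sqint_mul.
by apply: eq_Rintegral => x _; rewrite mulrA.
Qed.

Lemma rdotNl f h : sqint f -> sqint h -> rdot (fun x => - f x) h = - rdot f h.
Proof.
move=> Hf Hh; rewrite -mulN1r -rdotZl//.
by apply: eq_Rintegral => x _; rewrite mulN1r.
Qed.

Lemma rdot_ge0 f : 0 <= rdot f f.
Proof. by apply: Rintegral_ge0 => x _; rewrite -expr2 sqr_ge0. Qed.

Lemma rdotE f : sqint f -> (rdot f f)%:E = (\int[mu]_x (f x ^+ 2)%:E)%E.
Proof.
move=> Hf; rewrite /rdot /Rintegral fineK; last by apply: integral_fune_fin_num => //; exact: sqint_mul.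
by apply: eq_integral => x _; rewrite expr2.
Qed.

Lemma rdot_eq0 f : sqint f -> rdot f f = 0 <-> ae_eq mu setT f (fun=> 0).
Proof.
move=> Hf.
have mf2 : measurable_fun setT (fun x => (f x ^+ 2)%:E).
  by apply/measurable_EFinP; apply: measurable_funX; case: Hf.
have -> : rdot f f = 0 <-> (\int[mu]_x `|(f x ^+ 2)%:E| = 0)%E.
  under eq_integral do rewrite gee0_abs ?lee_fin ?sqr_ge0//.
  by rewrite -rdotE//; split=> [->//|[]].
rewrite ae_eq_integral_abs//; split; apply: filterS => x /= h /h.
  by move=> [] /eqP; rewrite sqrf_eq0 => /eqP.
by move=> ->; rewrite expr0n.
Qed.

(* [sum_j 4^j |F_{j+1} - F_j|^2] is integrable, hence finite almost everywhere. *)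
Lemma rapid_limit (F : nat -> T -> R) : (forall n, sqint (F n)) ->
  (forall j, 4 ^+ j * rdot (fun x => F j.+1 x - F j x) (fun x => F j.+1 x - F j x) <=
     1 / (2 ^ j.+1)%:R) ->
  exists f A, [/\ measurable A, mu (~` A) = 0%E, measurable_fun setT f &
    forall x, A x -> F ^~ x @ \oo --> f x].
Proof.
move=> HF Fle.
have Hd j : sqint (fun x => F j.+1 x - F j x) by exact: sqintB.
pose g j x := (4 ^+ j * (F j.+1 x - F j x) ^+ 2)%:E.
have g0 j x : (0 <= g j x)%E by rewrite lee_fin mulr_ge0 ?sqr_ge0 ?exprn_ge0.
have mg j : measurable_fun setT (g j).
  apply/measurable_EFinP; apply: measurable_funM => //; apply: measurable_funX.
  by case: (Hd j).
pose G x := (\sum_(j <oo) g j x)%E.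
have G0 x : (0 <= G x)%E by apply: nneseries_ge0 => n _ _; exact: g0.
have mG : measurable_fun setT G.
  by apply: ge0_emeasurable_sum => *; [exact: g0|exact: mg].
have intG : (\int[mu]_x G x < +oo)%E.
  rewrite /G integral_nneseries//.
  apply: (@le_lt_trans _ _ (\sum_(j <oo) (0 + (1 / (2 ^ j.+1)%:R)%:E)%E)%E); last first.
    have h := @epsilon_trick R (fun=> 0%E) 1 xpredT (fun=> lexx _) ler01.
    by apply: le_lt_trans h _; rewrite eseries0// add0e ltry.
  apply: lee_nneseries => [j _ _|j _]; first by apply: integral_ge0.
  rewrite /g; under eq_integral do rewrite EFinM.
  rewrite ge0_integralZl_EFin ?exprn_ge0//; last 2 first.
  - by move=> x _; rewrite lee_fin sqr_ge0.
  - by apply/measurable_EFinP; apply: measurable_funX; case: (Hd j).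
  by rewrite -rdotE// -EFinM add0e lee_fin.
pose A := [set x | (G x < +oo)%E].
have mA : measurable A.
  by rewrite -[A]setTI; exact: emeasurable_fun_infty_o.
have muA : mu (~` A) = 0%E.
  have iG : mu.-integrable setT G.
    apply/integrableP; split=> //; under eq_integral do rewrite gee0_abs//.
    exact: intG.
  apply/(negligibleP mu (measurableC mA)); have := integrable_ae measurableT iG.
  apply: negligibleS => x /= Ax; apply: contra_not Ax => /(_ I).
  by rewrite ge0_fin_numE.
have cvgA x : A x -> cvgn (F ^~ x).
  move=> Ax; have Gfin : G x \is a fin_num by rewrite ge0_fin_numE.
  pose c := fine (G x).
  (* A single term of the finite sum [G x] bounds the increment by sqrt c / 2^j, so the telescoping
     series is dominated by a geometric one. *)
  have dle j : `|F j.+1 x - F j x| <= Num.sqrt c * 2^-1 ^+ j.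
    have : (g j x <= G x)%E.
      rewrite /G (@nneseriesD1 _ _ j xpredT (fun k _ => g0 k x) isT).
      by rewrite leeDl// nneseries_ge0// => k _ _; exact: g0.
    rewrite -(fineK Gfin) lee_fin -/c => h.
    have c0 : 0 <= c by apply: fine_ge0.
    have rhs0 : 0 <= Num.sqrt c * 2^-1 ^+ j.
      by rewrite mulr_ge0 ?sqrtr_ge0// exprn_ge0// invr_ge0.
    rewrite -(@ler_pXn2r _ 2)//.
    rewrite real_normK ?num_real// exprMn sqr_sqrtr// -exprM mulnC exprM.
    rewrite -(ler_pM2l (_ : 0 < 4 ^+ j)) ?exprn_gt0//; apply: le_trans h _.
    rewrite mulrCA -exprMn (_ : 4 * 2^-1 ^+ 2 = 1) ?expr1n ?mulr1//; by field.
  have sc : cvgn (series (telescope (F ^~ x))).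
    apply: normed_cvg; apply: (@series_le_cvg _ _ (geometric (Num.sqrt c) 2^-1)).
    - by move=> n; exact: normr_ge0.
    - by move=> n; rewrite /geometric /= mulr_ge0// ?sqrtr_ge0// exprn_ge0// invr_ge0.
    - by move=> n; exact: dle.
    - by apply: is_cvg_geometric_series; rewrite gtr0_norm ?invr_gt0// invf_lt1// ltr1n.
  rewrite (_ : F ^~ x = (fun n => F 0 x) \+ series (telescope (F ^~ x))).
    by apply: is_cvgD => //; exact: is_cvg_cst.
  by apply/funext => n; rewrite /= -(@eq_sum_telescope _ (F ^~ x)).
exists ((fun x => limn (F ^~ x)) \_ A), A; split=> //.
  apply/(measurable_restrictT _ mA); apply: (@measurable_fun_cvg _ _ _ _ F).
    by move=> n; apply: measurable_funTS; case: (HF n).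
  by move=> x /cvgA.
by move=> x Ax; rewrite patchE mem_set//; exact: cvgA.
Qed.

(** Riesz-Fischer: a rapid subsequence converges almost everywhere, and Fatou's lemma turns the
    Cauchy property into convergence in norm to that limit. *)
Lemma sqint_complete (F : nat -> T -> R) : (forall n, sqint (F n)) ->
  (forall e : R, 0 < e -> exists N, forall m n, (N <= m)%N -> (N <= n)%N ->
     rdot (fun x => F m x - F n x) (fun x => F m x - F n x) < e) ->
  exists2 f, sqint f & forall e : R, 0 < e -> exists N, forall n, (N <= n)%N ->
     rdot (fun x => F n x - f x) (fun x => F n x - f x) < e.
Proof.
move=> HF CF.
have H0 j : 0 < 1 / (2 ^ j.+1)%:R / 4 ^+ j :> R.
  by rewrite !divr_gt0// ?exprn_gt0// ltr0n expn_gt0.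
have [N NP] := choice (fun j => CF _ (H0 j)).
(* Strictly increasing indices beyond every [N j]; the thresholds in [H0] are the summable bounds
   that [rapid_limit] asks for. *)
pose k := fix k j := if j is j'.+1 then maxn (k j').+1 (N j) else N 0%N.
have kN j : (N j <= k j)%N by case: j => //= j; rewrite leq_maxr.
have kS j : (k j < k j.+1)%N by rewrite /= leq_max leqnn.
have kge j : (j <= k j)%N by elim: j => // j IH; exact: leq_ltn_trans IH (kS j).
have [||f [A [mA muA mf fA]]] := @rapid_limit (F \o k) => [n|j|].
- exact: HF.
- have := NP j (k j.+1) (k j) (ltnW (leq_ltn_trans (kN j) (kS j))) (kN j).
  by rewrite ltr_pdivlMr ?exprn_gt0// mulrC => /ltW.
(* The limit m -> infinity is taken under the integral along the subsequence; the shift by [M] keeps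
   all its indices beyond [M]. *)
have key e n M : (forall m, (M <= m)%N -> (\int[mu]_x ((F m x - F n x) ^+ 2)%:E <= e%:E)%E) ->
    (\int[mu]_x ((F n x - f x) ^+ 2)%:E <= e%:E)%E.
  move=> MP.
  have mm : measurable_fun setT (fun x => ((F n x - f x) ^+ 2)%:E).
    by apply/measurable_EFinP; apply: measurable_funX; apply: measurable_funB => //; case: (HF n).
  rewrite (ge0_negligible_integral (measurableC mA) measurableT mm _ muA); last first.
    by move=> x _; rewrite lee_fin sqr_ge0.
  rewrite setDE setCK setTI.
  have -> : (\int[mu]_(x in A) ((F n x - f x) ^+ 2)%:E =
      \int[mu]_(x in A) limn_einf (fun j => ((F (k (j + M)%N) x - F n x) ^+ 2)%:E))%E.
    apply: eq_integral => x; rewrite inE => Ax.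
    have h : (fun j => ((F (k (j + M)%N) x - F n x) ^+ 2)%:E) @ \oo --> ((F n x - f x) ^+ 2)%:E.
      have := fA x Ax; rewrite -(cvg_shiftn M) => h.
      have h2 : (fun j => F (k (j + M)%N) x - F n x) @ \oo --> f x - F n x.
        by apply: cvgB; [exact: h|exact: cvg_cst].
      have h3 : (fun j => (F (k (j + M)%N) x - F n x) ^+ 2) @ \oo --> (F n x - f x) ^+ 2.
        rewrite -sqrrN opprB expr2; under eq_cvg do rewrite expr2.
        exact: cvgM.
      by apply/fine_cvgP; split; [exact: nearW|exact: h3].
    by rewrite (is_cvg_limn_einfE (cvgP _ h)) (cvg_lim _ h).
  apply: le_trans (@fatou _ _ _ mu A mA _ _ _) _.
  - by move=> j; apply: measurable_funTS; apply/measurable_EFinP; apply: measurable_funX;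
      apply: measurable_funB; [case: (HF (k (j + M)%N))|case: (HF n)].
  - by move=> j x _; rewrite lee_fin sqr_ge0.
  rewrite limn_einf_lim; apply: lime_le; first exact: is_cvg_einfs.
  apply: nearW => j; apply: (@le_trans _ _ (\int[mu]_x ((F (k (j + M)%N) x - F n x) ^+ 2)%:E)%E).
    apply: (@le_trans _ _ (\int[mu]_(x in A) ((F (k (j + M)%N) x - F n x) ^+ 2)%:E)%E).
      by apply: ereal_inf_lbound; exists j => //=.
    apply: ge0_subset_integral => //; last by move=> x _; rewrite lee_fin sqr_ge0.
    by apply/measurable_EFinP; apply: measurable_funX; apply: measurable_funB;
      [case: (HF (k (j + M)%N))|case: (HF n)].
  by apply: MP; apply: leq_trans (leq_addl j M) (kge _).
have Hf : sqint f.
  have [M MP] := CF 1 ltr01.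
  have h : sqint (fun x => F M x - f x).
    split; first by apply: measurable_funB => //; case: (HF M).
    apply: le_lt_trans (key 1 M M _) (ltry _) => m Mm.
    by rewrite -rdotE ?lee_fin; [exact/ltW/MP|exact: sqintB].
  have -> : f = fun x => F M x - (F M x - f x) by apply/funext => x; rewrite opprB addrC subrK.
  exact: sqintB.
exists f => // e e0; have [M MP] := CF _ (divr_gt0 e0 (ltr0n R 2)).
exists M => n Mn; apply: (@le_lt_trans _ _ (e / 2)); last by rewrite ltr_pdivrMr// ltr_pMr// ltr1n.
rewrite -lee_fin rdotE; last exact: sqintB.
apply: (key _ n M) => m Mm; rewrite -rdotE ?lee_fin; [exact/ltW/MP|exact: sqintB].
Qed.

End L2.

(** * Lebesgue measure on the plane: open sets, boxes, translations *)

Section plane.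
Variable R : realType.
Local Notation plane := (R * R)%type.
Local Notation mu := (@plane_measure R).
Local Notation leb := (@lebesgue_measure R).
Implicit Types f g h : plane -> R.

(** The plane carries the product sigma-algebra, so an open set is written as a countable union of
    open squares with rational centres and radii 1/(n+1). *)
Lemma open_plane_measurable (U : set plane) : open U -> measurable U.
Proof.
move=> oU.
pose bx (p q : rat) (n : nat) : set plane :=
  ball (ratr p : R) n.+1%:R^-1 `*` ball (ratr q : R) n.+1%:R^-1.
pose F p q n := if `[< bx p q n `<=` U >] then bx p q n else set0.
have -> : U = \bigcup_p \bigcup_q \bigcup_n F p q n.
  apply/seteqP; split=> [[x y] Uxy|z [p _ [q _ [n _]]]]; last first.
    by rewrite /F; case: asboolP => // h /h.
  have /nbhs_ballP[e /= e0 eU] : nbhs (x, y) U by exact: open_nbhs_nbhs.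
  (* A point of the square is within 1/(n+1) of its centre, which is within 1/(n+1) of (x, y); twice
     this radius must stay below [e]. *)
  pose n := Num.bound (2 / e).
  have n0 : 0 < n.+1%:R :> R by rewrite ltr0n.
  have ne : 2 * n.+1%:R^-1 < e.
    rewrite ltr_pdivrMr// -ltr_pdivrMl// mulrC.
    apply: lt_le_trans (archi_boundP _) _; first by rewrite divr_ge0 ?ltW.
    by rewrite ler_nat ltnW.
  have i0 : 0 < n.+1%:R^-1 :> R by rewrite invr_gt0.
  have near_rat (t : R) : exists p : rat, `|ratr p - t| < n.+1%:R^-1.
    have /rat_in_itvoo[p] : t - n.+1%:R^-1 < t + n.+1%:R^-1 by rewrite ltrBlDr -addrA ltrDl addr_gt0.
    by rewrite in_itv /= => /andP[h1 h2]; exists p; rewrite ltr_distl h1.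
  have [p pP] := near_rat x; have [q qP] := near_rat y.
  exists p => //; exists q => //; exists n => //; rewrite /F ifT; first by split.
  apply/asboolP => -[z1 z2] [/= pz qz]; apply: eU; split=> /=;
    apply: lt_trans ne; rewrite mulr_natl mulr2n.
    rewrite -(subrK (ratr p) x) -addrA (le_lt_trans (ler_normD _ _))// ltrD//.
    by rewrite distrC.
  rewrite -(subrK (ratr q) y) -addrA (le_lt_trans (ler_normD _ _))// ltrD//.
  by rewrite distrC.
apply: bigcupT_measurable_rat => p; apply: bigcupT_measurable_rat => q.
apply: bigcupT_measurable => n; rewrite /F; case: asboolP => // _.
by apply: measurableX; apply: open_measurable; exact: ball_open.
Qed.

Lemma continuous_plane_measurable f : continuous f -> measurable_fun setT f.
Proof.
move=> cf; apply: (measurability _ (RGenOInfty.measurableE R)) => //.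
move=> _ [_ [a ->] <-]; rewrite setTI; apply: open_plane_measurable.
by apply: open_comp => // x _; exact: cf.
Qed.

Definition box (a b c d : R) : set plane := `]a, b[ `*` `]c, d[.

Lemma measurable_box a b c d : measurable (box a b c d).
Proof. by apply: measurableX; exact: measurable_itv. Qed.

Lemma box_finite a b c d : (mu (box a b c d) < +oo)%E.
Proof.
rewrite /box /plane_measure product_measure1E; [|exact: measurable_itv..].
by rewrite /= !lebesgue_measure_itv /=; case: ifP => _; case: ifP => _;
   rewrite ?mul0e ?mule0 -?EFinB -?EFinM ltry.
Qed.

Lemma compact_in_box (K : set plane) : compact K -> exists2 r, 0 < r & K `<=` box (- r) r (- r) r.
Proof.
move=> cK; have [M [_ MP]] := compact_bounded cK.
pose r := Num.max M 0 + 1 + 1.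
have M0 : 0 <= Num.max M 0 by rewrite le_max lexx orbT.
exists r; first by rewrite /r; lra.
move=> x Kx; have := MP (Num.max M 0 + 1) _ x Kx.
rewrite ltr_pwDr ?le_max ?lexx// => /(_ isT); rewrite /= prod_normE ge_max => /andP[h1 h2].
split; rewrite /= in_itv /= -ltr_norml; apply: (le_lt_trans h1) || apply: (le_lt_trans h2);
  by rewrite /r; lra.
Qed.

Lemma continuous_compact_sqint f (K : set plane) : continuous f -> compact K ->
  (forall x, ~ K x -> f x = 0) -> sqint mu f.
Proof.
move=> cf cK f0.
have [r r0 KP] := compact_in_box cK.
have [M [_ MP]] : bounded_set (f @` K).
  by apply: compact_bounded; apply: continuous_compact => //; exact: continuous_subspaceT.
pose M' := Num.max M 0 + 1.
have M0 : 0 <= Num.max M 0 by rewrite le_max lexx orbT.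
have := @sqint_bounded _ _ _ mu f M' _ (measurable_box (- r) r (- r) r) (box_finite _ _ _ _)
  (continuous_plane_measurable cf).
apply.
- move=> x _; have [Kx|nKx] := pselect (K x).
    by apply: (MP M') => //; rewrite /M' ltr_pwDr ?le_max ?lexx.
  by rewrite f0// normr0 /M'; lra.
- by move=> x nb; apply: f0 => /KP.
Qed.

Lemma measurable_shift (a : R) : measurable_fun setT (fun x : R => x + a).
Proof. by apply: measurable_funD. Qed.

Lemma lebesgue_translation (a : R) (A : set R) : measurable A ->
  pushforward leb (fun x => x + a : measurableTypeR R) A = leb A.
Proof.
move=> mA; apply/esym/lebesgue_measure_unique => //=; first exact: measurable_shift.
move=> ? _ [[b c]] _ <-.
rewrite /pushforward (_ : _ @^-1` _ = `]b - a, c - a]%classic); last first.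
  by apply/seteqP; split=> x /=; rewrite !in_itv /= ltrBlDr lerBrDr.
rewrite /= !lebesgue_measure_itv/= !lte_fin ltrD2r.
by case: ifP => // _; rewrite -EFinB -EFinB; congr EFin; ring.
Qed.

Lemma integral_shift (a : R) (f : R -> \bar R) : measurable_fun setT f ->
  (forall x, 0 <= f x)%E -> (\int[leb]_x f (x + a)%R = \int[leb]_x f x)%E.
Proof.
move=> mf f0.
have := @ge0_integral_pushforward _ _ (measurableTypeR R) (measurableTypeR R) R _
  (measurable_shift a) leb setT f measurableT mf (fun y _ => f0 y).
rewrite preimage_setT => <-; apply: eq_measure_integral; first exact: measurable_shift.
move=> mS A mA _; exact: lebesgue_translation.
Qed.

Lemma measurable_shift2 (a : plane) : measurable_fun setT (fun x : plane => x + a).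
Proof.
apply/measurable_fun_pairP; split.
  by apply: measurable_funD; [exact: measurable_fst|exact: measurable_cst].
by apply: measurable_funD; [exact: measurable_snd|exact: measurable_cst].
Qed.

Lemma integral_shift2 (a : plane) (f : plane -> \bar R) : measurable_fun setT f ->
  (forall x, 0 <= f x)%E -> (\int[mu]_x f (x + a)%R = \int[mu]_x f x)%E.
Proof.
move=> mf f0; rewrite /plane_measure.
rewrite (@fubini_tonelli1 _ _ (measurableTypeR R) (measurableTypeR R) R leb leb
  (fun x : R * R => f (x + a))) => [||x]; last 2 first.
- by apply: (measurableT_comp mf); exact: measurable_shift2.
- exact: f0.
rewrite (@fubini_tonelli1 _ _ (measurableTypeR R) (measurableTypeR R) R leb leb)//.
pose F (x : R) : \bar R := (\int[leb]_y f (x, y))%E.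
have mF : measurable_fun setT F by have := @measurable_fun_fubini_tonelli_F _ _ (measurableTypeR R) (measurableTypeR R) R leb f mf f0.
transitivity (\int[leb]_x F (x + a.1)%R)%E.
  apply: eq_integral => x _; rewrite /fubini_F /F.
  by rewrite -(@integral_shift a.2)//; exact: measurableT_comp.
by rewrite integral_shift// => x; apply: integral_ge0.
Qed.

Lemma sqint_shift (a : plane) f : sqint mu f -> sqint mu (fun x => f (x + a)).
Proof.
move=> [mf fi]; split; first by apply: measurableT_comp => //; exact: measurable_shift2.
rewrite (@integral_shift2 a (fun x => (f x ^+ 2)%:E))//.
  by apply/measurable_EFinP; exact: measurable_funX.
by move=> x; rewrite lee_fin sqr_ge0.
Qed.
End plane.

(** The sets over which the integral vanishes form a Dynkin system: the zero integral over [D]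
    handles complements, and integrability handles countable disjoint unions. *)
Lemma integral0_dynkin d (T : measurableType d) (R : realType) (mu : {measure set T -> \bar R})
    d' (X : measurableType d') (G : set (set X)) (f : T -> X) (D : set T) (h : T -> \bar R) :
  measurable D -> mu.-integrable D h -> measurable_fun setT f ->
  @measurable _ X = <<s G >> -> setI_closed G ->
  (\int[mu]_(x in D) h x = 0)%E ->
  (forall A, G A -> \int[mu]_(x in D `&` f @^-1` A) h x = 0)%E ->
  forall A, measurable A -> (\int[mu]_(x in D `&` f @^-1` A) h x = 0)%E.
Proof.
move=> mD ih mf GE GI D0 GP A.
have mpre S : measurable S -> measurable (D `&` f @^-1` S).
  by move=> mS; apply: measurableI => //; rewrite -[X in measurable X]setTI; exact: mf.
have ipre S : measurable S -> mu.-integrable (D `&` f @^-1` S) h.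
  by move=> mS; apply: (integrableS mD) => //; exact: mpre.
rewrite GE; apply: (@dynkin_induction _ _ G (fun S => (\int[mu]_(x in D `&` f @^-1` S) h x = 0)%E) GE GI) => [||S mS S0|F mF tF F0].
- by rewrite preimage_setT setIT.
- by move=> S /GP.
- have : (\int[mu]_(x in (D `&` f @^-1` S) `|` (D `&` f @^-1` (~` S))) h x = 0)%E.
    by rewrite -setIUr -preimage_setU setUv preimage_setT setIT.
  rewrite integral_setU ?S0 ?add0e//.
  + exact: mpre.
  + by apply: mpre; exact: measurableC.
  + by rewrite -setIUr -preimage_setU setUv preimage_setT setIT; apply/measurable_int: ih.
  + by apply/disj_setPS => x [[_ a] [_ b]].
- rewrite preimage_bigcup setI_bigcupr integral_bigcup.
  + by rewrite eseries0.
  + apply/trivIsetP => i j _ _ ij; rewrite -setIIr -preimage_setI.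
    by move/trivIsetP : tF => /(_ _ _ _ _ ij) ->//; rewrite preimage_set0 setI0.
  + by move=> n; exact: mpre.
  + by rewrite -setI_bigcupr -preimage_bigcup; apply: ipre; exact: bigcup_measurable.
Qed.

(** * Functions whose integrals over boxes vanish *)

Section vanish.
Variable R : realType.
Local Notation plane := (R * R)%type.
Local Notation mu := (@plane_measure R).
Local Notation mR := (measurableTypeR R).
Implicit Types f g h : plane -> R.

Lemma sqint_box_integrable h a b c d : sqint mu h -> mu.-integrable (box a b c d) (EFin \o h).
Proof.
by move=> Hh; have := @sqint_integrable _ _ R mu h _ (measurable_box a b c d) (box_finite a b c d) Hh.
Qed.

Lemma itvoo_setI (a b c d : R) :
  `]a, b[ `&` `]c, d[ = `](Num.max a c), (Num.min b d)[%classic.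
Proof.
apply/seteqP; split=> x /=; rewrite !in_itv /= gt_max lt_min.
  by move=> [/andP[-> ->] /andP[-> ->]].
by move=> /andP[/andP[-> ->] /andP[-> ->]].
Qed.

(** The Dynkin argument is used three times: for the first coordinate with an interval in the
    second, for the second coordinate with a measurable set in the first, and for the identity map,
    from rectangles to the product sigma-algebra. *)
Lemma vanish_on_boxes h : sqint mu h ->
  (forall a b c d, \int[mu]_(x in box a b c d) (h x)%:E = 0)%E -> ae_eq mu setT h (fun=> 0).
Proof.
move=> Hh h0.
have GI : setI_closed (@RGenOpens.G R).
  move=> _ _ [a [b ->]] [c [d ->]]; rewrite itvoo_setI.
  by exists (Num.max a c), (Num.min b d).
(* Square integrability gives integrability only on sets of finite measure, so the plane is
   exhausted by squares. *)
have step (n : nat) : ae_eq mu (box (- n%:R) n%:R (- n%:R) n%:R) h (fun=> 0).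
  set D := box _ _ _ _; set r : R := n%:R in D *.
  have mD : measurable D by exact: measurable_box.
  have ihD : mu.-integrable D (EFin \o h) by exact: sqint_box_integrable.
  have mfst (A : set mR) : measurable A -> measurable ((@fst R R) @^-1` A).
    by move=> mA; rewrite -[X in measurable X]setTI; exact: measurable_fst.
  have msnd (A : set mR) : measurable A -> measurable ((@snd R R) @^-1` A).
    by move=> mA; rewrite -[X in measurable X]setTI; exact: measurable_snd.
  have DE a b : D `&` (@snd R R) @^-1` `]a, b[ = box (- r) r (Num.max (- r) a) (Num.min r b).
    by rewrite /D /box -itvoo_setI; apply/seteqP; split=> [[x y]|[x y]] /=; tauto.
  have s1 a b (A : set mR) : measurable A ->
      (\int[mu]_(x in (D `&` (@snd R R) @^-1` `]a, b[) `&` (@fst R R) @^-1` A) (h x)%:E = 0)%E.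
    have mD' : measurable (D `&` (@snd R R) @^-1` `]a, b[).
      by apply: measurableI => //; apply: msnd; exact: measurable_itv.
    have iD' : mu.-integrable (D `&` (@snd R R) @^-1` `]a, b[) (EFin \o h).
      by have := @integrableS _ _ R mu _ _ (EFin \o h) mD mD'; apply.
    have := @integral0_dynkin _ _ R mu _ mR (@RGenOpens.G R) (@fst R R) _ _ mD' iD'
      (@measurable_fst _ _ mR mR) (@RGenOpens.measurableE R) GI.
    move=> h1; apply: h1; first by rewrite DE; exact: h0.
    move=> _ [c [d ->]]; rewrite DE (_ : _ `&` _ = box (Num.max (- r) c) (Num.min r d)
      (Num.max (- r) a) (Num.min r b)); first exact: h0.
    by rewrite /box -(itvoo_setI (- r) r c d); apply/seteqP; split=> [[x y]|[x y]] /=; tauto.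
  have s2 (A B : set mR) : measurable A -> measurable B ->
      (\int[mu]_(x in (D `&` (@fst R R) @^-1` A) `&` (@snd R R) @^-1` B) (h x)%:E = 0)%E.
    move=> mA.
    have mD' : measurable (D `&` (@fst R R) @^-1` A).
      by apply: measurableI => //; exact: mfst.
    have iD' : mu.-integrable (D `&` (@fst R R) @^-1` A) (EFin \o h).
      by have := @integrableS _ _ R mu _ _ (EFin \o h) mD mD'; apply.
    have := @integral0_dynkin _ _ R mu _ mR (@RGenOpens.G R) (@snd R R) _ _ mD' iD'
      (@measurable_snd _ _ mR mR) (@RGenOpens.measurableE R) GI.
    move=> h1; apply: h1.
      have := s1 (- r) r A mA; rewrite (_ : D `&` _ = D)//.
      by apply/seteqP; split=> [x []//|x Dx]; split => //; case: Dx.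
    by move=> _ [c [d ->]]; rewrite setIAC; exact: s1.
  have s3 (A : set (mR * mR)) : measurable A -> (\int[mu]_(x in D `&` id @^-1` A) (h x)%:E = 0)%E.
    have := @integral0_dynkin _ _ R mu _ (mR * mR)%type
      [set A `*` B | A in @measurable _ mR & B in @measurable _ mR] id _ _ mD ihD
      (@measurable_id _ _ setT) (measurable_prod_measurableType mR mR).
    move=> h1; apply: h1.
    - move=> _ _ [A1 mA1 [B1 mB1 <-]] [A2 mA2 [B2 mB2 <-]].
      exists (A1 `&` A2); first exact: measurableI.
      exists (B1 `&` B2); first exact: measurableI.
      by apply/seteqP; split=> [[x y]|[x y]] /=; tauto.
    - exact: h0.
    - move=> _ [A1 mA1 [B1 mB1 <-]]; have := s2 A1 B1 mA1 mB1.
      by rewrite (_ : _ `&` _ `&` _ = D `&` id @^-1` (A1 `*` B1))//;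
         apply/seteqP; split=> [[x y]|[x y]] /=; tauto.
  have : ae_eq mu D (EFin \o h) (EFin \o (fun=> 0)).
    have := @integral_ae_eq _ _ R mu D mD (EFin \o (fun=> 0)) _ ihD; apply; first exact: measurable_cst.
    move=> E ED mE; rewrite [RHS]integral0_eq// -(s3 E mE).
    by congr integral; apply/seteqP; split=> [x Ex|x []//]; split=> //; exact: ED.
  by apply: filterS => x /= h1 /h1 [].
have := (@ae_foralln _ _ R mu (fun n x => box (- n%:R) n%:R (- n%:R) n%:R x -> h x = 0)) step.
apply: filterS => x hx _; apply: (hx (Num.bound (`|x.1| + `|x.2|))).
have := @archi_boundP R (`|x.1| + `|x.2|) (addr_ge0 (normr_ge0 _) (normr_ge0 _)) => hb.
by split; rewrite /= in_itv /= -ltr_norml; apply: le_lt_trans hb; rewrite ?lerDl ?lerDr.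
Qed.

End vanish.

(** * Integration by parts on boxes *)

Section ibp.
Variable R : realType.
Local Notation plane := (R * R)%type.
Local Notation mu := (@plane_measure R).
Local Notation leb := (@lebesgue_measure R).
Local Notation mR := (measurableTypeR R).
Implicit Types f g h : plane -> R.

(** The integrand is the derivative of p phi, which vanishes at both ends. Polynomials vanishing at
    the ends serve as cutoffs: their derivatives are explicit and bounded on the interval. *)
Lemma ibp_line (phi psi : R -> R) (p : {poly R}) (a b : R) : a < b ->
  (forall x, is_derive x (1 : R) phi (psi x)) -> continuous psi ->
  p.[a] = 0 -> p.[b] = 0 ->
  (\int[leb]_(x in `]a, b[) (p.[x] * psi x + p^`().[x] * phi x)%:E = 0)%E.
Proof.
move=> ab dphi cpsi pa pb.
have cphi : continuous phi.
  by move=> x; apply: differentiable_continuous; apply/derivable1_diffP; case: (dphi x).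
pose k x := p.[x] * psi x + p^`().[x] * phi x.
have ck : continuous k.
  by move=> x; apply: cvgD; apply: cvgM; [exact: continuous_horner|exact: cpsi|
    exact: continuous_horner|exact: cphi].
have mk : measurable_fun `]a, b[ (EFin \o k).
  by apply/measurable_EFinP; apply: measurable_funTS; exact: continuous_measurable_fun.
rewrite -(integral_itv_bndoo true false mk).
have dF x : is_derive x (1 : R) (fun x => p.[x] * phi x) (k x).
  have := is_deriveM (is_derive_poly p x) (dphi x).
  by move=> h; apply: (is_derive_eq h); congr (_ + _); exact: mulrC.
have cF : continuous (fun x => p.[x] * phi x).
  by move=> x; apply: cvgM; [exact: continuous_horner|exact: cphi].
rewrite (@continuous_FTC2 _ _ (fun x => p.[x] * phi x) _ _ ab).
- by rewrite pa pb !mul0r subee.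
- exact: continuous_subspaceT.
- split=> [x _||]; first by case: (dF x).
  + by apply: cvg_at_right_filter; exact: cF.
  + by apply: cvg_at_left_filter; exact: cF.
- by move=> x _; rewrite derive1E; have [_ ->] := dF x.
Qed.

Lemma is_derive_line1 f (x y d : R) :
  is_derive (x, y) (@e1 R) f d <-> is_derive x (1 : R) (fun t => f (t, y)) d.
Proof.
have E : (fun h : R => h^-1 *: (((fun t => f (t, y)) \o shift x) (h *: 1) - f (x, y))) =
         (fun h : R => h^-1 *: ((f \o shift (x, y)) (h *: (@e1 R)) - f (x, y))).
  apply/funext => h /=; congr (_ *: (f _ - _)).
  by rewrite /e1 /shift /= /GRing.add /= /add_pair /= scaler0 add0r.
split=> -[df dE]; split.
- by rewrite /derivable E.
- by rewrite /derive E.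
- by rewrite /derivable -E.
- by rewrite /derive -E.
Qed.

Lemma is_derive_line2 f (x y d : R) :
  is_derive (x, y) (@e2 R) f d <-> is_derive y (1 : R) (fun t => f (x, t)) d.
Proof.
have E : (fun h : R => h^-1 *: (((fun t => f (x, t)) \o shift y) (h *: 1) - f (x, y))) =
         (fun h : R => h^-1 *: ((f \o shift (x, y)) (h *: (@e2 R)) - f (x, y))).
  apply/funext => h /=; congr (_ *: (f _ - _)).
  by rewrite /e2 /shift /= /GRing.add /= /add_pair /= scaler0 add0r.
split=> -[df dE]; split.
- by rewrite /derivable E.
- by rewrite /derive E.
- by rewrite /derivable -E.
- by rewrite /derive -E.
Qed.

Lemma continuous_box_sqint f a b c d : continuous f ->
  sqint mu (fun x => f x * \1_(box a b c d) x).
Proof.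
move=> cf.
have [M [_ MP]] : bounded_set (f @` (`[a, b] `*` `[c, d])).
  apply: compact_bounded; apply: continuous_compact; first exact: continuous_subspaceT.
  by apply: compact_setX; exact: segment_compact.
have := @sqint_bounded _ _ _ mu (fun x => f x * \1_(box a b c d) x) (M + 1) _
  (measurable_box a b c d) (box_finite _ _ _ _); apply.
- apply: measurable_funM; first exact: continuous_plane_measurable.
  by apply: measurable_indic; exact: measurable_box.
- move=> x bx; rewrite indicE mem_set// mulr1; apply: (MP (M + 1)).
    by rewrite ltrDl.
  exists x => //; case: bx => /= h1 h2; split => /=; exact: subset_itv_oo_cc.
- by move=> x nb; rewrite indicE memNset// mulr0.
Qed.

Lemma continuous_box_integrable f a b c d : continuous f ->
  mu.-integrable (box a b c d) (EFin \o f).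
Proof.
move=> cf; have := @sqint_integrable _ _ R mu _ _ (measurable_box a b c d) (box_finite a b c d)
  (continuous_box_sqint a b c d cf).
apply: eq_integrable; first exact: measurable_box.
by move=> x xb; rewrite /= indicE xb mulr1.
Qed.

Lemma box_integral21 f a b c d : continuous f ->
  (\int[mu]_(z in box a b c d) (f z)%:E =
   \int[leb]_(y in `]c, d[) \int[leb]_(x in `]a, b[) (f (x, y))%:E)%E.
Proof.
move=> cf; have i : mu.-integrable setT ((EFin \o f) \_ (box a b c d)).
  have := (@integrable_mkcond _ _ R mu _ (EFin \o f) (measurable_box a b c d)).1; apply.
  exact: continuous_box_integrable.
rewrite integral_mkcond -(@integral21_prod_meas1 _ _ mR mR R leb leb _ i) [RHS]integral_mkcond.
apply: eq_integral => y _; rewrite /fubini_G patchE.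
case: ifPn => [/set_mem yc|yc].
  rewrite [RHS]integral_mkcond; apply: eq_integral => x _; rewrite !patchE.
  have -> : ((x, y) \in box a b c d) = (x \in `]a, b[%classic) :> bool.
    by apply/idP/idP => /set_mem h; apply/mem_set; [case: h|split].
  by [].
apply: integral0_eq => x _; rewrite patchE ifF//; apply/negbTE; apply: contra yc.
by move=> /set_mem[_ h]; exact/mem_set.
Qed.

Lemma box_integral12 f a b c d : continuous f ->
  (\int[mu]_(z in box a b c d) (f z)%:E =
   \int[leb]_(x in `]a, b[) \int[leb]_(y in `]c, d[) (f (x, y))%:E)%E.
Proof.
move=> cf; have i : mu.-integrable setT ((EFin \o f) \_ (box a b c d)).
  have := (@integrable_mkcond _ _ R mu _ (EFin \o f) (measurable_box a b c d)).1; apply.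
  exact: continuous_box_integrable.
rewrite integral_mkcond -(@integral12_prod_meas1 _ _ mR mR R leb leb _ i) [RHS]integral_mkcond.
apply: eq_integral => x _; rewrite /fubini_F patchE.
case: ifPn => [/set_mem yc|yc].
  rewrite [RHS]integral_mkcond; apply: eq_integral => y _; rewrite !patchE.
  have -> : ((x, y) \in box a b c d) = (y \in `]c, d[%classic) :> bool.
    by apply/idP/idP => /set_mem h; apply/mem_set; [case: h|split].
  by [].
apply: integral0_eq => y _; rewrite patchE ifF//; apply/negbTE; apply: contra yc.
by move=> /set_mem[h _]; exact/mem_set.
Qed.

Lemma continuous_horner1 (p : {poly R}) : continuous (fun z : plane => p.[z.1]).
Proof. by move=> z; apply: continuous_comp; [exact: cvg_fst|exact: continuous_horner]. Qed.
Lemma continuous_horner2 (p : {poly R}) : continuous (fun z : plane => p.[z.2]).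
Proof. by move=> z; apply: continuous_comp; [exact: cvg_snd|exact: continuous_horner]. Qed.
Lemma continuous_mul f g : continuous f -> continuous g -> continuous (fun z => f z * g z).
Proof. by move=> cf cg z; apply: cvgM; [exact: cf|exact: cg]. Qed.
Lemma continuous_add f g : continuous f -> continuous g -> continuous (fun z => f z + g z).
Proof. by move=> cf cg z; apply: cvgD; [exact: cf|exact: cg]. Qed.

Lemma ibp_box1 f (p : {poly R}) (a b c d : R) : a < b -> p.[a] = 0 -> p.[b] = 0 ->
  continuous f -> (forall x, derivable f x (@e1 R)) -> continuous ('D_(@e1 R) f) ->
  (\int[mu]_(z in box a b c d) (p.[z.1] * 'D_(@e1 R) f z + p^`().[z.1] * f z)%:E = 0)%E.
Proof.
move=> ab pa pb cf df cdf; rewrite box_integral21; last first.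
  by apply: continuous_add; apply: continuous_mul => //; exact: continuous_horner1.
apply: integral0_eq => y _ /=.
apply: (@ibp_line (fun x => f (x, y)) (fun x => 'D_(@e1 R) f (x, y))) => //.
  by move=> x; apply/is_derive_line1; split; [exact: df|].
move=> x; apply: (@continuous_comp _ _ _ (fun x => (x, y)) ('D_(@e1 R) f)); last exact: cdf.
exact: (cvg_pair cvg_id (cvg_cst y)).
Qed.

Lemma ibp_box2 f (p : {poly R}) (a b c d : R) : c < d -> p.[c] = 0 -> p.[d] = 0 ->
  continuous f -> (forall x, derivable f x (@e2 R)) -> continuous ('D_(@e2 R) f) ->
  (\int[mu]_(z in box a b c d) (p.[z.2] * 'D_(@e2 R) f z + p^`().[z.2] * f z)%:E = 0)%E.
Proof.
move=> ab pa pb cf df cdf; rewrite box_integral12; last first.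
  by apply: continuous_add; apply: continuous_mul => //; exact: continuous_horner2.
apply: integral0_eq => x _ /=.
apply: (@ibp_line (fun y => f (x, y)) (fun y => 'D_(@e2 R) f (x, y))) => //.
  by move=> y; apply/is_derive_line2; split; [exact: df|].
move=> y; apply: (@continuous_comp _ _ _ (fun y => (x, y)) ('D_(@e2 R) f)); last exact: cdf.
exact: (cvg_pair (cvg_cst x) cvg_id).
Qed.

End ibp.

(** * The space of complex square integrable functions *)

Section L2.
Variable R : realType.
Local Notation C := (Cplx R).
Local Notation plane := (R * R)%type.
Local Notation mu := (@plane_measure R).
Implicit Types u v : plane -> C.

Lemma reCD (x y : C) : reC (x + y) = reC x + reC y.
Proof. by case: x => ? ?; case: y. Qed.
Lemma imCD (x y : C) : imC (x + y) = imC x + imC y.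
Proof. by case: x => ? ?; case: y. Qed.
Lemma reCN (x : C) : reC (- x) = - reC x.
Proof. by case: x. Qed.
Lemma imCN (x : C) : imC (- x) = - imC x.
Proof. by case: x. Qed.
Lemma reCM (x y : C) : reC (x * y) = reC x * reC y - imC x * imC y.
Proof. by case: x => ? ?; case: y. Qed.
Lemma imCM (x y : C) : imC (x * y) = reC x * imC y + imC x * reC y.
Proof. by case: x => ? ?; case: y => ? ?; rewrite /imC /=. Qed.

Lemma in_L2P u : in_L2 u <-> sqint mu (@reC R \o u) /\ sqint mu (@imC R \o u).
Proof.
have E : measurable_fun setT (@reC R \o u) -> measurable_fun setT (@imC R \o u) ->
    (\int[mu]_x (abs2 (u x))%:E =
     \int[mu]_x (((@reC R \o u) x) ^+ 2)%:E + \int[mu]_x (((@imC R \o u) x) ^+ 2)%:E)%E.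
  move=> mr mi; rewrite -ge0_integralD//; try by move=> x _; rewrite lee_fin sqr_ge0.
  - by apply/measurable_EFinP; exact: measurable_funX.
  - by apply/measurable_EFinP; exact: measurable_funX.
split=> [[mr mi]|[[mr Ir] [mi Ii]]].
  rewrite E// => h; split; split=> //; apply: le_lt_trans h; rewrite ?leeDl ?leeDr//.
  - by apply: integral_ge0 => x _; rewrite lee_fin sqr_ge0.
  - by apply: integral_ge0 => x _; rewrite lee_fin sqr_ge0.
by split=> //; rewrite E// lte_add_pinfty.
Qed.

Lemma in_L2D u v : in_L2 u -> in_L2 v -> in_L2 (fun x => u x + v x).
Proof.
move=> /in_L2P[ru iu] /in_L2P[rv iv]; apply/in_L2P; split.
  rewrite (_ : _ \o _ = fun x => reC (u x) + reC (v x)); first exact: sqintD.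
  by apply/funext => x; rewrite /= reCD.
rewrite (_ : _ \o _ = fun x => imC (u x) + imC (v x)); first exact: sqintD.
by apply/funext => x; rewrite /= imCD.
Qed.

Lemma in_L2Z (z : C) u : in_L2 u -> in_L2 (fun x => z * u x).
Proof.
move=> /in_L2P[ru iu]; apply/in_L2P; split.
  rewrite (_ : _ \o _ = fun x => reC z * reC (u x) + - imC z * imC (u x)).
    by apply: sqintD; exact: sqintZ.
  by apply/funext => x; rewrite /= reCM mulNr.
rewrite (_ : _ \o _ = fun x => reC z * imC (u x) + imC z * reC (u x)).
  by apply: sqintD; exact: sqintZ.
by apply/funext => x; rewrite /= imCM.
Qed.

Lemma in_L20 : in_L2 (fun=> 0 : C).
Proof. by apply/in_L2P; split; exact: sqint0. Qed.

(** With values in [C^o] the functions form a module over [C], whose structure the subtype [L2]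
    inherits. *)
Definition L2pred : {pred plane -> C^o} := fun u => `[< in_L2 u >].

Lemma L2pred_submod : submod_closed L2pred.
Proof.
split; first by apply/asboolP; exact: in_L20.
move=> z u v /asboolP Hu /asboolP Hv; apply/asboolP.
by apply: (@in_L2D (fun x => z * u x)) => //; exact: in_L2Z.
Qed.
HB.instance Definition _ := GRing.isSubmodClosed.Build C (plane -> C^o) L2pred L2pred_submod.

Record L2 := MkL2 { L2fun :> plane -> C^o; L2mem : L2fun \in L2pred }.
HB.instance Definition _ := [isSub for L2fun].
HB.instance Definition _ := [Choice of L2 by <:].
HB.instance Definition _ := [SubChoice_isSubLmodule of L2 by <:].

Lemma L2P (u : L2) : in_L2 u.
Proof. by have /asboolP := L2mem u. Qed.

Definition toL2 u (Hu : in_L2 u) : L2 := @MkL2 u (introT (asboolP _) Hu).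

Lemma L2DE (u v : L2) x : (u + v) x = u x + v x. Proof. by []. Qed.
Lemma L2ZE (z : C) (u : L2) x : (z *: u) x = z * u x. Proof. by []. Qed.
Lemma L2BE (u v : L2) x : (u - v) x = u x - v x. Proof. by []. Qed.
Lemma toL2E u (Hu : in_L2 u) : L2fun (toL2 Hu) = u. Proof. by []. Qed.

Definition reL2 (u : L2) : plane -> R := fun x => reC (u x).
Definition imL2 (u : L2) : plane -> R := fun x => imC (u x).
Lemma reL2P (u : L2) : sqint mu (reL2 u). Proof. by have /in_L2P[] := L2P u. Qed.
Lemma imL2P (u : L2) : sqint mu (imL2 u). Proof. by have /in_L2P[] := L2P u. Qed.

Local Notation rd := (rdot mu).

Definition L2rdot (u v : L2) : R := rd (reL2 u) (reL2 v) + rd (imL2 u) (imL2 v).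

Fact L2rdotC (u v : L2) : L2rdot u v = L2rdot v u.
Proof. by rewrite /L2rdot rdotC [in X in _ + X]rdotC. Qed.
Fact L2rdotDl (u v w : L2) : L2rdot (u + v) w = L2rdot u w + L2rdot v w.
Proof.
have H1 := @rdotDl _ _ _ mu _ _ _ (reL2P u) (reL2P v) (reL2P w).
have H2 := @rdotDl _ _ _ mu _ _ _ (imL2P u) (imL2P v) (imL2P w).
rewrite /L2rdot (_ : reL2 (u + v) = fun x => reL2 u x + reL2 v x); last first.
  by apply/funext => x; rewrite /reL2 L2DE reCD.
rewrite (_ : imL2 (u + v) = fun x => imL2 u x + imL2 v x); last first.
  by apply/funext => x; rewrite /imL2 L2DE imCD.
by rewrite H1 H2; ring.
Qed.
Fact L2rdotZl (a : R) (u v : L2) : L2rdot (toC a *: u) v = a * L2rdot u v.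
Proof.
have H1 := @rdotZl _ _ _ mu a _ _ (reL2P u) (reL2P v).
have H2 := @rdotZl _ _ _ mu a _ _ (imL2P u) (imL2P v).
rewrite /L2rdot (_ : reL2 (toC a *: u) = fun x => a * reL2 u x); last first.
  by apply/funext => x; rewrite /reL2 L2ZE reCM /= mul0r subr0.
rewrite (_ : imL2 (toC a *: u) = fun x => a * imL2 u x); last first.
  by apply/funext => x; rewrite /imL2 L2ZE imCM /= mul0r addr0.
by rewrite H1 H2; ring.
Qed.
Fact L2rdotiZ (u v : L2) : L2rdot (imag *: u) (imag *: v) = L2rdot u v.
Proof.
have E (w : L2) : reL2 (imag *: w) = fun x => - imL2 w x.
  by apply/funext => x; rewrite /reL2 L2ZE reCM /= mul0r mul1r sub0r.
have F (w : L2) : imL2 (imag *: w) = reL2 w.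
  by apply/funext => x; rewrite /imL2 L2ZE imCM /= mul0r mul1r add0r.
rewrite /L2rdot !E !F addrC; congr (_ + _).
have Hv := imL2P v; have Hu := imL2P u.
rewrite (@rdotNl _ _ _ mu)//; last exact: sqintN.
by rewrite (@rdotC _ _ _ mu) (@rdotNl _ _ _ mu)// opprK (@rdotC _ _ _ mu).
Qed.
Fact L2rdot_ge0 (u : L2) : 0 <= L2rdot u u.
Proof. by rewrite addr_ge0 ?rdot_ge0. Qed.
Fact L2rdot_complete (u : nat -> L2) :
    (forall e : R, 0 < e -> exists N, forall m n, (N <= m)%N -> (N <= n)%N ->
       L2rdot (u m - u n) (u m - u n) < e) ->
    exists l, forall e : R, 0 < e -> exists N, forall n, (N <= n)%N ->
       L2rdot (u n - l) (u n - l) < e.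
Proof.
move=> uC.
have rB (v w : L2) : reL2 (v - w) = fun x => reL2 v x - reL2 w x.
  by apply/funext => x; rewrite /reL2 L2BE reCD reCN.
have iB (v w : L2) : imL2 (v - w) = fun x => imL2 v x - imL2 w x.
  by apply/funext => x; rewrite /imL2 L2BE imCD imCN.
have [|f Hf fP] := @sqint_complete _ _ R mu (fun n => reL2 (u n)) (fun n => reL2P (u n)).
  move=> e e0; have [N NP] := uC e e0; exists N => m n Nm Nn.
  by apply: le_lt_trans (NP m n Nm Nn); rewrite /L2rdot rB lerDl rdot_ge0.
have [|g Hg gP] := @sqint_complete _ _ R mu (fun n => imL2 (u n)) (fun n => imL2P (u n)).
  move=> e e0; have [N NP] := uC e e0; exists N => m n Nm Nn.
  by apply: le_lt_trans (NP m n Nm Nn); rewrite /L2rdot iB lerDr rdot_ge0.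
have Hl : in_L2 (fun x => Complex (f x) (g x) : C) by apply/in_L2P.
exists (toL2 Hl) => e e0; have e20 : 0 < e / 2 by rewrite divr_gt0.
have [N1 N1P] := fP _ e20; have [N2 N2P] := gP _ e20.
exists (maxn N1 N2) => n; rewrite geq_max => /andP[n1 n2].
by rewrite (splitr e) /L2rdot rB iB ltrD; [|exact: N1P|exact: N2P].
Qed.
HB.instance Definition _ := isSemiHilbert.Build R L2
  L2rdotC L2rdotDl L2rdotZl L2rdotiZ L2rdot_ge0 L2rdot_complete.

Lemma L2dotE (u v : L2) : dot u v = rd (reL2 u) (reL2 v) + rd (imL2 u) (imL2 v).
Proof. by []. Qed.

End L2.

(** * Bounded multiplications and magnetic translations in L^2 *)

Section L2facts.
Variable R : realType.
Local Notation C := (Cplx R).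
Local Notation plane := (R * R)%type.
Local Notation mu := (@plane_measure R).
Local Notation L2 := (L2 R).
Local Notation nn u := (dot u u).
Implicit Types u v w : plane -> C.

Lemma conjCE (z : C) : z^* = Complex (reC z) (- imC z).
Proof. by case: z. Qed.

Lemma abs2M (x y : C) : abs2 (x * y) = abs2 x * abs2 y.
Proof. by case: x => ? ?; case: y => ? ?; rewrite /abs2 /=; ring. Qed.

Lemma measurable_abs2 u : measurable_fun setT (@reC R \o u) -> measurable_fun setT (@imC R \o u) ->
  measurable_fun setT (fun x => (abs2 (u x))%:E).
Proof.
by move=> mr mi; apply/measurable_EFinP; apply: measurable_funD; exact: measurable_funX.
Qed.

Lemma dot_integral (u : L2) : (nn u)%:E = (\int[mu]_x (abs2 (u x))%:E)%E.
Proof.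
have Hr := reL2P u; have Hi := imL2P u.
have := @ge0_integralD _ _ R mu _ measurableT (fun x => (reL2 u x ^+ 2)%:E)
  (fun x => (imL2 u x ^+ 2)%:E).
rewrite L2dotE EFinD (rdotE Hr) (rdotE Hi) => <- //.
- by move=> x _; rewrite lee_fin sqr_ge0.
- by apply/measurable_EFinP; apply: measurable_funX; case: Hr.
- by move=> x _; rewrite lee_fin sqr_ge0.
- by apply/measurable_EFinP; apply: measurable_funX; case: Hi.
Qed.

Lemma L2norm2E (u : L2) : L2norm2 u = nn u.
Proof. by rewrite /L2norm2 /Rintegral -dot_integral. Qed.

Lemma L2dotC (u v : L2) : L2dot u v = Complex (dot u v) (dot u (imag *: v)).
Proof.
have Hru := reL2P u; have Hiu := imL2P u; have Hrv := reL2P v; have Hiv := imL2P v.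
rewrite /L2dot /cintegral; congr Complex.
  rewrite L2dotE /rdot -(@RintegralD _ _ R mu)//; try exact: sqint_mul.
  by apply: eq_Rintegral => x _; rewrite /= conjCE reCM /= mulrN opprK.
have E : reL2 (imag *: v) = fun x => - imL2 v x.
  by apply/funext => x; rewrite /reL2 L2ZE reCM /= mul0r mul1r sub0r.
have F : imL2 (imag *: v) = reL2 v.
  by apply/funext => x; rewrite /imL2 L2ZE imCM /= mul0r mul1r add0r.
rewrite L2dotE E F /rdot -(@RintegralD _ _ R mu)//; try exact: sqint_mul.
  by apply: eq_Rintegral => x _; rewrite /= conjCE imCM /= mulrN.
by apply: sqint_mul => //; exact: sqintN.
Qed.

Lemma nn_ae (u : L2) : nn u = 0 <-> ae_eq mu setT (u : plane -> C) (fun=> 0).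
Proof.
have Hr := reL2P u; have Hi := imL2P u.
have nnE : nn u = 0 <-> rdot mu (reL2 u) (reL2 u) = 0 /\ rdot mu (imL2 u) (imL2 u) = 0.
  rewrite L2dotE; split=> [/eqP|[-> ->]]; last by rewrite addr0.
  by rewrite paddr_eq0 ?rdot_ge0// => /andP[/eqP -> /eqP ->].
rewrite nnE (rdot_eq0 Hr) (rdot_eq0 Hi); split=> [[]|h].
  apply: filterS2 => x hr hi _; have := hr I; have := hi I; rewrite /reL2 /imL2.
  by case: (L2fun u x) => a b /= -> ->.
by split; apply: filterS h => x /(_ I) h _; rewrite /reL2 /imL2 h.
Qed.

Lemma eqv_ae (u v : L2) : eqv u v <-> ae_eq mu setT (u : plane -> C) v.
Proof.
rewrite -eqvP nn_ae; split; apply: filterS => x h _.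
  by apply/eqP; rewrite -subr_eq0 -L2BE h.
by rewrite L2BE h// subrr.
Qed.

(** [M] bounds the squared modulus, so it is directly the constant for squared norms in
    [mulL2_le]. *)
Record bounded_mult (m : plane -> C) (M : R) : Prop := {
  bounded_mult_re : measurable_fun setT (@reC R \o m);
  bounded_mult_im : measurable_fun setT (@imC R \o m);
  bounded_mult_le : forall x, abs2 (m x) <= M }.

Lemma bounded_mult_measurable m M u : bounded_mult m M -> in_L2 u ->
  measurable_fun setT (@reC R \o (fun x => m x * u x)) /\
  measurable_fun setT (@imC R \o (fun x => m x * u x)).
Proof.
move=> [mr mi _] [ur ui _]; split.
  rewrite (_ : _ \o _ = fun x => reC (m x) * reC (u x) - imC (m x) * imC (u x)).
    by apply: measurable_funB; exact: measurable_funM.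
  by apply/funext => x; rewrite /= reCM.
rewrite (_ : _ \o _ = fun x => reC (m x) * imC (u x) + imC (m x) * reC (u x)).
  by apply: measurable_funD; exact: measurable_funM.
by apply/funext => x; rewrite /= imCM.
Qed.

Lemma bounded_mult_ge0 m M : bounded_mult m M -> 0 <= M.
Proof. by move=> [_ _ /(_ 0)]; exact: le_trans (abs2_ge0 _). Qed.

Lemma bounded_mult_integral m M u : bounded_mult m M -> in_L2 u ->
  (\int[mu]_x (abs2 (m x * u x))%:E <= M%:E * \int[mu]_x (abs2 (u x))%:E)%E.
Proof.
move=> bm Hu; have [mr mi] := bounded_mult_measurable bm Hu; have [ur ui _] := Hu.
have := @ge0_integralZl_EFin _ _ R mu _ measurableT (fun x => (abs2 (u x))%:E) _ _ M
  (bounded_mult_ge0 bm).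
move=> <-; last 2 first.
- by move=> x _; rewrite lee_fin abs2_ge0.
- exact: measurable_abs2.
have := @ge0_le_integral _ _ R mu _ measurableT; apply.
- by move=> x _; rewrite lee_fin abs2_ge0.
- exact: measurable_abs2.
- by apply: measurable_funeM; exact: measurable_abs2.
- move=> x _; rewrite -EFinM lee_fin abs2M ler_wpM2r ?abs2_ge0//.
  exact: bounded_mult_le bm x.
Qed.

Lemma in_L2_mult m M u : bounded_mult m M -> in_L2 u -> in_L2 (fun x => m x * u x).
Proof.
move=> bm Hu; have [mr mi] := bounded_mult_measurable bm Hu; split=> //.
apply: le_lt_trans (bounded_mult_integral bm Hu) _.
have [ur ui ioo] := Hu.
rewrite lte_mul_pinfty ?lee_fin ?(bounded_mult_ge0 bm)//.
Qed.

Definition mulL2 m M (bm : bounded_mult m M) (u : L2) : L2 := toL2 (in_L2_mult bm (L2P u)).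

Lemma mulL2_le m M (bm : bounded_mult m M) (u : L2) : nn (mulL2 bm u) <= M * nn u.
Proof.
rewrite -lee_fin EFinM !dot_integral; exact: bounded_mult_integral bm (L2P u).
Qed.

Lemma L2_eq (u v : L2) : (forall x, u x = v x) -> u = v.
Proof. by move=> h; apply/val_inj/funext. Qed.

Lemma mulL2D m M (bm : bounded_mult m M) (u v : L2) : mulL2 bm (u + v) = mulL2 bm u + mulL2 bm v.
Proof. by apply: L2_eq => x; rewrite /= mulrDr. Qed.
Lemma mulL2Z m M (bm : bounded_mult m M) (z : C) (u : L2) : mulL2 bm (z *: u) = z *: mulL2 bm u.
Proof. by apply: L2_eq => x; rewrite /= mulrCA. Qed.
Lemma mulL2_adj m M (bm : bounded_mult m M) m' M' (bm' : bounded_mult m' M') (u v : L2) :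
  (forall x, m' x = (m x)^*) -> dot (mulL2 bm u) v = dot u (mulL2 bm' v).
Proof.
move=> mm.
have H1 := sqint_mul (reL2P (mulL2 bm u)) (reL2P v).
have H2 := sqint_mul (imL2P (mulL2 bm u)) (imL2P v).
have H3 := sqint_mul (reL2P u) (reL2P (mulL2 bm' v)).
have H4 := sqint_mul (imL2P u) (imL2P (mulL2 bm' v)).
rewrite !L2dotE /rdot -!(@RintegralD _ _ R mu)//.
apply: eq_Rintegral => x _; rewrite /reL2 /imL2 /= mm conjCE !reCM !imCM /=; ring.
Qed.

Lemma dot_by_nn (V : semiHilbertType R) (u v : V) : 4 * dot u v = nn (u + v) - nn (u - v).
Proof. rewrite !dotE (dotC v u); ring. Qed.

Lemma in_L2_shift (a : plane) u : in_L2 u -> in_L2 (fun x => u (x + a)).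
Proof.
by move=> /in_L2P[hr hi]; apply/in_L2P; split;
  [exact: (sqint_shift a hr)|exact: (sqint_shift a hi)].
Qed.

Lemma measurable_continuousC m : continuous (@reC R \o m) -> continuous (@imC R \o m) ->
  (forall M, (forall x, abs2 (m x) <= M) -> bounded_mult m M).
Proof. by move=> cr ci M mM; split=> //; exact: continuous_plane_measurable. Qed.

Lemma abs2_expi (l x : plane) : abs2 (expi l x) = 1.
Proof. by rewrite /abs2 /expi /= cos2Dsin2. Qed.

Lemma continuous_phase (l : plane) : continuous (fun x : plane => l.1 * x.1 + l.2 * x.2).
Proof.
by move=> x; apply: cvgD; apply: cvgM; [exact: cvg_cst|exact: cvg_fst|exact: cvg_cst|exact: cvg_snd].
Qed.

Lemma bounded_expi (l : plane) : bounded_mult (expi l) 1.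
Proof.
apply: measurable_continuousC => [x|x|x]; last by rewrite abs2_expi.
- by apply: (@continuous_comp _ _ _ (fun x : plane => l.1 * x.1 + l.2 * x.2) (@cos R));
    [exact: continuous_phase|exact: continuous_cos].
- by apply: (@continuous_comp _ _ _ (fun x : plane => l.1 * x.1 + l.2 * x.2) (@sin R));
    [exact: continuous_phase|exact: continuous_sin].
Qed.

(** A magnetic translation: the phase with frequency [l] is there to absorb the constant by which
    the shift by [a] changes the vector potential. *)
Definition mtrans (l a : plane) (u : L2) : L2 :=
  mulL2 (bounded_expi l) (toL2 (in_L2_shift a (L2P u))).

Lemma mtransE l a (u : L2) x : mtrans l a u x = expi l x * u (x + a).
Proof. by []. Qed.
Lemma mtransD l a (u v : L2) : mtrans l a (u + v) = mtrans l a u + mtrans l a v.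
Proof. by apply: L2_eq => x; rewrite /= mulrDr. Qed.
Lemma mtransZ l a z (u : L2) : mtrans l a (z *: u) = z *: mtrans l a u.
Proof. by apply: L2_eq => x; rewrite /= mulrCA. Qed.
Lemma mtrans_nn l a (u : L2) : nn (mtrans l a u) = nn u.
Proof.
apply/eqP; rewrite -eqe !dot_integral; apply/eqP.
have [ur ui _] := L2P u.
have := @integral_shift2 R a _ (measurable_abs2 ur ui) (fun x => abs2_ge0 _).
move=> <-; apply: eq_integral => x _; rewrite mtransE abs2M abs2_expi mul1r //.
Qed.
Lemma mtrans_dot l a (u v : L2) : dot (mtrans l a u) (mtrans l a v) = dot u v.
Proof.
have h4 : 4 != 0 :> R by rewrite pnatr_eq0.
apply: (mulfI h4); rewrite !dot_by_nn -mtransD mtrans_nn; congr (_ - _).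
rewrite (_ : _ - _ = mtrans l a (u - v)) ?mtrans_nn//.
by rewrite mtransD -[- v]scaleN1r mtransZ scaleN1r.
Qed.
End L2facts.

(** * Test functions and magnetic gradients *)

Section smooth.
Variable R : realType.
Local Notation plane := (R * R)%type.
Local Notation e1 := (@e1 R).
Local Notation e2 := (@e2 R).
Implicit Types f g : plane -> R.

Lemma class_C_cont n f : class_C n f -> continuous f.
Proof. by case: n => [|n] []. Qed.

Lemma class_CS n f : class_C n.+1 f -> class_C n f.
Proof.
elim: n f => [|n IH] f; first by move=> [cf _]; split.
move=> [cf [d1 d2 c1 c2]]; split; first exact: cf.
by split; [exact: d1|exact: d2|exact: IH c1|exact: IH c2].
Qed.

Lemma class_C_intro n f (f1 f2 : plane -> R) : continuous f ->
  (forall x, is_derive x e1 f (f1 x)) -> (forall x, is_derive x e2 f (f2 x)) ->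
  class_C n f1 -> class_C n f2 -> class_C n.+1 f.
Proof.
move=> cf d1 d2 c1 c2; split; [exact: cf|split].
- by move=> x; case: (d1 x).
- by move=> x; case: (d2 x).
- suff -> : 'D_e1 f = f1 by exact: c1.
  by apply/funext => x; case: (d1 x).
- suff -> : 'D_e2 f = f2 by exact: c2.
  by apply/funext => x; case: (d2 x).
Qed.

Lemma class_C_elim n f : class_C n.+1 f -> [/\ continuous f,
  forall x, is_derive x e1 f ('D_e1 f x), forall x, is_derive x e2 f ('D_e2 f x),
  class_C n ('D_e1 f) & class_C n ('D_e2 f)].
Proof.
move=> [cf [d1 d2 c1 c2]].
by split; [exact: cf|move=> x; split|move=> x; split|exact: c1|exact: c2].
Qed.

Lemma class_CD n f g : class_C n f -> class_C n g -> class_C n (fun x => f x + g x).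
Proof.
elim: n f g => [|n IH] f g; first by move=> [cf _] [cg _]; split; [exact: continuous_add|].
move=> /class_C_elim[cf f1 f2 cf1 cf2] /class_C_elim[cg g1 g2 cg1 cg2].
apply: (@class_C_intro _ _ (fun x => 'D_e1 f x + 'D_e1 g x) (fun x => 'D_e2 f x + 'D_e2 g x)).
- exact: continuous_add.
- exact: (IH _ _ cf1 cg1).
- exact: (IH _ _ cf2 cg2).
Qed.

Lemma class_CM n f g : class_C n f -> class_C n g -> class_C n (fun x => f x * g x).
Proof.
elim: n f g => [|n IH] f g; first by move=> [cf _] [cg _]; split; [exact: continuous_mul|].
move=> Hf Hg; have Hf' := class_CS Hf; have Hg' := class_CS Hg.
move: Hf Hg => /class_C_elim[cf f1 f2 cf1 cf2] /class_C_elim[cg g1 g2 cg1 cg2].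
apply: (@class_C_intro _ _ (fun x => f x * 'D_e1 g x + g x * 'D_e1 f x)
  (fun x => f x * 'D_e2 g x + g x * 'D_e2 f x)).
- exact: continuous_mul.
- exact: (class_CD (IH _ _ Hf' cg1) (IH _ _ Hg' cf1)).
- exact: (class_CD (IH _ _ Hf' cg2) (IH _ _ Hg' cf2)).
Qed.

Lemma class_C_cst n (a : R) : class_C n (fun=> a).
Proof.
elim: n a => [|n IH] a; first by split; [move=> x; exact: cvg_cst|].
apply: (@class_C_intro _ _ (fun=> 0) (fun=> 0)); [by move=> x; exact: cvg_cst|exact: (IH 0)|exact: (IH 0)].
Qed.

Lemma is_derive_translate (a v x : plane) f (d : R) :
  is_derive (x + a) v f d -> is_derive x v (fun x => f (x + a)) d.
Proof.
have E : (fun t : R => t^-1 *: (((fun x => f (x + a)) \o shift x) (t *: v) - f (x + a))) =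
         (fun t : R => t^-1 *: ((f \o shift (x + a)) (t *: v) - f (x + a))).
  by apply/funext => t /=; rewrite addrA.
move=> [df dE]; split; first by rewrite /derivable E.
by rewrite /derive E.
Qed.

Lemma class_C_shift n (a : plane) f : class_C n f -> class_C n (fun x => f (x + a)).
Proof.
have cs : continuous (fun x : plane => x + a).
  by move=> x; apply: cvgD; [exact: cvg_id|exact: cvg_cst].
elim: n f => [|n IH] f.
  move=> [cf _]; split; last by [].
  move=> x; apply: (@continuous_comp _ _ _ (fun x : plane => x + a) f).
    exact: cs.
  exact: cf.
move=> /class_C_elim[cf f1 f2 cf1 cf2].
have ca : continuous (fun x : plane => f (x + a)).
  move=> x; apply: (@continuous_comp _ _ _ (fun x : plane => x + a) f); first exact: cs.
  exact: cf.
exact: (class_C_intro ca (fun x : plane => is_derive_translate (f1 (x + a)))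
  (fun x : plane => is_derive_translate (f2 (x + a))) (IH _ cf1) (IH _ cf2)).
Qed.

Lemma derive_expi (l x : plane) :
  [/\ is_derive x e1 (@reC R \o expi l) (- l.1 * imC (expi l x)),
      is_derive x e2 (@reC R \o expi l) (- l.2 * imC (expi l x)),
      is_derive x e1 (@imC R \o expi l) (l.1 * reC (expi l x)) &
      is_derive x e2 (@imC R \o expi l) (l.2 * reC (expi l x))].
Proof.
case: x => x y.
have lin (a b t : R) : is_derive t (1 : R) (fun t => a * t + b) a.
  have h := is_deriveD (is_deriveZ a (is_derive_id t (1 : R))) (is_derive_cst b t (1 : R)).
  by apply: (is_derive_eq h); rewrite addr0 /GRing.scale /= mulr1.
have lin2 (a b t : R) : is_derive t (1 : R) (fun t => b + a * t) a.
  have h := is_deriveD (is_derive_cst b t (1 : R)) (is_deriveZ a (is_derive_id t (1 : R))).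
  by apply: (is_derive_eq h); rewrite add0r /GRing.scale /= mulr1.
split.
- apply/is_derive_line1.
  have h := @is_derive1_comp _ (@cos R) (fun t => l.1 * t + l.2 * y) x _ _
    (is_derive_cos (l.1 * x + l.2 * y)) (lin l.1 (l.2 * y) x).
  by apply: (is_derive_eq h); rewrite /imC /expi /= /GRing.scale /=; ring.
- apply/is_derive_line2.
  have h := @is_derive1_comp _ (@cos R) (fun t => l.1 * x + l.2 * t) y _ _
    (is_derive_cos (l.1 * x + l.2 * y)) (lin2 l.2 (l.1 * x) y).
  by apply: (is_derive_eq h); rewrite /imC /expi /= /GRing.scale /=; ring.
- apply/is_derive_line1.
  have h := @is_derive1_comp _ (@sin R) (fun t => l.1 * t + l.2 * y) x _ _
    (is_derive_sin (l.1 * x + l.2 * y)) (lin l.1 (l.2 * y) x).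
  by apply: (is_derive_eq h); rewrite /reC /expi /= /GRing.scale /=; ring.
- apply/is_derive_line2.
  have h := @is_derive1_comp _ (@sin R) (fun t => l.1 * x + l.2 * t) y _ _
    (is_derive_sin (l.1 * x + l.2 * y)) (lin2 l.2 (l.1 * x) y).
  by apply: (is_derive_eq h); rewrite /reC /expi /= /GRing.scale /=; ring.
Qed.

Lemma class_C_expi n l : class_C n (@reC R \o expi l) /\ class_C n (@imC R \o expi l).
Proof.
have cr : continuous (@reC R \o expi l).
  by move=> x; apply: (@continuous_comp _ _ _ (fun x : plane => l.1 * x.1 + l.2 * x.2) (@cos R));
    [exact: continuous_phase|exact: continuous_cos].
have ci : continuous (@imC R \o expi l).
  by move=> x; apply: (@continuous_comp _ _ _ (fun x : plane => l.1 * x.1 + l.2 * x.2) (@sin R));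
    [exact: continuous_phase|exact: continuous_sin].
elim: n => [|n [IHr IHi]]; first by split; split.
have d x := derive_expi l x.
split.
  have d1 x : is_derive x e1 (@reC R \o expi l) (- l.1 * imC (expi l x)) by case: (d x).
  have d2 x : is_derive x e2 (@reC R \o expi l) (- l.2 * imC (expi l x)) by case: (d x).
  exact: (class_C_intro cr d1 d2 (class_CM (class_C_cst _ _) IHi) (class_CM (class_C_cst _ _) IHi)).
have d1 x : is_derive x e1 (@imC R \o expi l) (l.1 * reC (expi l x)) by case: (d x).
have d2 x : is_derive x e2 (@imC R \o expi l) (l.2 * reC (expi l x)) by case: (d x).
exact: (class_C_intro ci d1 d2 (class_CM (class_C_cst _ _) IHr) (class_CM (class_C_cst _ _) IHr)).
Qed.
End smooth.

Section test.
Variable R : realType.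
Local Notation C := (Cplx R).
Local Notation plane := (R * R)%type.
Local Notation e1 := (@e1 R).
Local Notation e2 := (@e2 R).
Implicit Types (u v w : plane -> C) (z : C) (A : plane -> plane).

Lemma complex_eq (x y : C) : reC x = reC y -> imC x = imC y -> x = y.
Proof. by case: x => a b; case: y => c d /= -> ->. Qed.

Definition cderive (e : plane) u x d :=
  is_derive x e (@reC R \o u) (reC d) /\ is_derive x e (@imC R \o u) (imC d).

Lemma cderive_partial e u x d : cderive e u x d -> partialC e u x = d.
Proof. by move=> [[_ h1] [_ h2]]; apply: complex_eq. Qed.

Lemma cderive_eq e u x d d' : cderive e u x d -> d = d' -> cderive e u x d'.
Proof. by move=> h <-. Qed.

Lemma cderiveD e u v x d d' : cderive e u x d -> cderive e v x d' ->
  cderive e (fun x => u x + v x) x (d + d').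
Proof.
move=> [u1 u2] [v1 v2]; split.
  rewrite (_ : _ \o _ = (@reC R \o u) + (@reC R \o v)).
    by apply: (is_derive_eq (is_deriveD u1 v1)); rewrite reCD.
  by apply/funext => y; rewrite /= reCD.
rewrite (_ : _ \o _ = (@imC R \o u) + (@imC R \o v)).
  by apply: (is_derive_eq (is_deriveD u2 v2)); rewrite imCD.
by apply/funext => y; rewrite /= imCD.
Qed.

Lemma cderiveM e u v x d d' : cderive e u x d -> cderive e v x d' ->
  cderive e (fun x => u x * v x) x (u x * d' + v x * d).
Proof.
move=> [u1 u2] [v1 v2]; split.
  rewrite (_ : _ \o _ = (@reC R \o u) * (@reC R \o v) - (@imC R \o u) * (@imC R \o v)).
    apply: (is_derive_eq (is_deriveB (is_deriveM u1 v1) (is_deriveM u2 v2))).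
    by rewrite reCD !reCM /GRing.scale /=; ring.
  by apply/funext => y; rewrite /= reCM.
rewrite (_ : _ \o _ = (@reC R \o u) * (@imC R \o v) + (@imC R \o u) * (@reC R \o v)).
  apply: (is_derive_eq (is_deriveD (is_deriveM u1 v2) (is_deriveM u2 v1))).
  by rewrite imCD !imCM /GRing.scale /=; ring.
by apply/funext => y; rewrite /= imCM.
Qed.

Lemma cderive_cst e z x : cderive e (fun=> z) x 0.
Proof. by split; exact: is_derive_cst. Qed.

Lemma cderive_shift e u (a x : plane) d : cderive e u (x + a) d ->
  cderive e (fun x => u (x + a)) x d.
Proof.
by move=> [d1 d2]; split; exact: is_derive_translate.
Qed.

Lemma cderive_expi1 l x : cderive e1 (expi l) x (imag * toC l.1 * expi l x).
Proof.
have [d1 _ d2 _] := derive_expi l x; split.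
  by apply: (is_derive_eq d1); rewrite !reCM !imCM /=; ring.
by apply: (is_derive_eq d2); rewrite !imCM !reCM /=; ring.
Qed.

Lemma cderive_expi2 l x : cderive e2 (expi l) x (imag * toC l.2 * expi l x).
Proof.
have [_ d1 _ d2] := derive_expi l x; split.
  by apply: (is_derive_eq d1); rewrite !reCM !imCM /=; ring.
by apply: (is_derive_eq d2); rewrite !imCM !reCM /=; ring.
Qed.

Lemma test_cderive1 u x : test_function u -> cderive e1 u x (partialC e1 u x).
Proof.
by move=> [/(_ 1)/class_C_elim[_ d1 _ _ _] /(_ 1)/class_C_elim[_ d2 _ _ _] _].
Qed.

Lemma test_cderive2 u x : test_function u -> cderive e2 u x (partialC e2 u x).
Proof.
by move=> [/(_ 1)/class_C_elim[_ _ d1 _ _] /(_ 1)/class_C_elim[_ _ d2 _ _] _].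
Qed.

Lemma test_intro u (K : set plane) : (forall n, class_C n (@reC R \o u)) ->
  (forall n, class_C n (@imC R \o u)) -> compact K -> (forall x, ~ K x -> u x = 0) ->
  test_function u.
Proof.
move=> cr ci cK uK; split; [exact: cr|exact: ci|].
apply: (subclosed_compact _ cK); first exact: closed_closure.
have Kc : closed K := compact_closed (@norm_hausdorff R plane) cK.
rewrite [X in _ `<=` X]((closure_id K).1 Kc); apply: closureS => x /= ux.
by apply: contrapT => /uK u0; move: ux; rewrite u0 eqxx.
Qed.

Lemma partialC_local0 e u x : (\forall y \near x, u y = 0) -> partialC e u x = 0.
Proof.
move=> u0; apply: cderive_partial; split.
  apply: (@near_eq_is_derive _ _ _ (cst (0 : R))).
  by near=> y; rewrite /= (near u0 y).
apply: (@near_eq_is_derive _ _ _ (cst (0 : R))).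
by near=> y; rewrite /= (near u0 y).
Unshelve. all: by end_near. Qed.

Lemma test_supp u : test_function u -> exists2 K : set plane, compact K &
  forall x, ~ K x -> [/\ u x = 0, partialC e1 u x = 0 & partialC e2 u x = 0].
Proof.
move=> [_ _ cK]; exists (closure [set x | u x != 0]) => // x nK.
have u0 : \forall y \near x, u y = 0.
  have : open (~` closure [set x | u x != 0]) by rewrite openC; exact: closed_closure.
  rewrite openE => /(_ x nK); apply: filterS => y ny.
  by apply: contrapT => /eqP uy; apply: ny; exact: subset_closure.
by split; [exact: nbhs_singleton u0|exact: partialC_local0|exact: partialC_local0].
Qed.

Lemma test_cont u : test_function u ->
  [/\ continuous (@reC R \o u), continuous (@imC R \o u),
   continuous (@reC R \o partialC e1 u), continuous (@imC R \o partialC e1 u) &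
   continuous (@reC R \o partialC e2 u) /\ continuous (@imC R \o partialC e2 u)].
Proof.
move=> [/(_ 1)/class_C_elim[c1 _ _ r1 r2] /(_ 1)/class_C_elim[c2 _ _ i1 i2] _].
by split; [exact: c1|exact: c2|exact: class_C_cont r1|exact: class_C_cont i1|
  split; [exact: class_C_cont r2|exact: class_C_cont i2]].
Qed.

Lemma test0 : test_function (fun=> 0 : C).
Proof.
apply: (@test_intro _ set0); [|by move=> n; exact: class_C_cst|exact: compact0|by []].
by move=> n; exact: class_C_cst.
Qed.

Lemma testZD z u v : test_function u -> test_function v ->
  test_function (fun x => z * u x + v x).
Proof.
move=> Hu Hv; have [K cK KP] := test_supp Hu; have [L cL LP] := test_supp Hv.
move: Hu Hv => [ru iu _] [rv iv _]; apply: (@test_intro _ (K `|` L)).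
- move=> n; rewrite (_ : _ \o _ = fun x => (reC z * (@reC R \o u) x + - imC z * (@imC R \o u) x) + (@reC R \o v) x).
    exact: (class_CD (class_CD (class_CM (class_C_cst _ _) (ru n)) (class_CM (class_C_cst _ _) (iu n))) (rv n)).
  by apply/funext => x; rewrite /= reCD reCM mulNr.
- move=> n; rewrite (_ : _ \o _ = fun x => (reC z * (@imC R \o u) x + imC z * (@reC R \o u) x) + (@imC R \o v) x).
    exact: (class_CD (class_CD (class_CM (class_C_cst _ _) (iu n)) (class_CM (class_C_cst _ _) (ru n))) (iv n)).
  by apply/funext => x; rewrite /= imCD imCM.
- exact: compactU.
- move=> x nKL; have [|-> _ _] := KP x; first by move=> Kx; apply: nKL; left.
  have [|-> _ _] := LP x; first by move=> Lx; apply: nKL; right.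
  by rewrite mulr0 addr0.
Qed.

Lemma test_mtrans l a u : test_function u -> test_function (fun x => expi l x * u (x + a)).
Proof.
move=> Hu; have [K cK KP] := test_supp Hu; move: Hu => [ru iu _].
apply: (@test_intro _ [set y - a | y in K]).
- move=> n; have [er ei] := class_C_expi n l.
  rewrite (_ : _ \o _ = fun x => (@reC R \o expi l) x * (@reC R \o u) (x + a) + -1 * ((@imC R \o expi l) x * (@imC R \o u) (x + a))).
    exact: (class_CD (class_CM er (class_C_shift _ (ru n))) (class_CM (class_C_cst _ _) (class_CM ei (class_C_shift _ (iu n))))).
  by apply/funext => x; rewrite /= reCM mulN1r.
- move=> n; have [er ei] := class_C_expi n l.
  rewrite (_ : _ \o _ = fun x => (@reC R \o expi l) x * (@imC R \o u) (x + a) + (@imC R \o expi l) x * (@reC R \o u) (x + a)).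
    exact: (class_CD (class_CM er (class_C_shift _ (iu n))) (class_CM ei (class_C_shift _ (ru n)))).
  by apply/funext => x; rewrite /= imCM.
- apply: continuous_compact cK; apply: continuous_subspaceT => y.
  by apply: cvgB; [exact: cvg_id|exact: cvg_cst].
- move=> x nK; have [|-> _ _] := KP (x + a); last by rewrite mulr0.
  by move=> Kx; apply: nK; exists (x + a) => //; rewrite addrK.
Qed.

Lemma in_L2_continuous u (K : set plane) : continuous (@reC R \o u) -> continuous (@imC R \o u) ->
  compact K -> (forall x, ~ K x -> u x = 0) -> in_L2 u.
Proof.
move=> cr ci cK uK; apply/in_L2P; split;
  by apply: (continuous_compact_sqint _ cK) => // x /uK /= ->.
Qed.

Lemma test_L2 u : test_function u -> in_L2 u.
Proof.
move=> Hu; have [K cK KP] := test_supp Hu; have [cr ci _ _ _] := test_cont Hu.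
by apply: (in_L2_continuous cr ci cK) => x /KP[].
Qed.

Lemma magnetic_grad_cont A u : continuous (fst \o A) -> continuous (snd \o A) -> test_function u ->
  [/\ continuous (@reC R \o (magnetic_grad A u).1), continuous (@imC R \o (magnetic_grad A u).1),
      continuous (@reC R \o (magnetic_grad A u).2) & continuous (@imC R \o (magnetic_grad A u).2)].
Proof.
move=> cA1 cA2 Hu; have [cr ci d1r d1i [d2r d2i]] := test_cont Hu.
split.
- rewrite (_ : _ \o _ = fun x => -1 * (@imC R \o partialC e1 u) x + (fst \o A) x * (@reC R \o u) x).
    apply: continuous_add; apply: continuous_mul => //; by move=> ?; exact: cvg_cst.
  by apply/funext => x; rewrite /= reCD !reCM /=; ring.
- rewrite (_ : _ \o _ = fun x => (@reC R \o partialC e1 u) x + (fst \o A) x * (@imC R \o u) x).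
    by apply: continuous_add => //; apply: continuous_mul.
  by apply/funext => x; rewrite /= imCD !imCM /=; ring.
- rewrite (_ : _ \o _ = fun x => -1 * (@imC R \o partialC e2 u) x + (snd \o A) x * (@reC R \o u) x).
    apply: continuous_add; apply: continuous_mul => //; by move=> ?; exact: cvg_cst.
  by apply/funext => x; rewrite /= reCD !reCM /=; ring.
- rewrite (_ : _ \o _ = fun x => (@reC R \o partialC e2 u) x + (snd \o A) x * (@imC R \o u) x).
    by apply: continuous_add => //; apply: continuous_mul.
  by apply/funext => x; rewrite /= imCD !imCM /=; ring.
Qed.

Lemma magnetic_grad_L2 A u : continuous (fst \o A) -> continuous (snd \o A) -> test_function u ->
  in_L2 (magnetic_grad A u).1 /\ in_L2 (magnetic_grad A u).2.
Proof.
move=> cA1 cA2 Hu; have [K cK KP] := test_supp Hu.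
have [c1 c2 c3 c4] := magnetic_grad_cont cA1 cA2 Hu.
split; [apply: (in_L2_continuous c1 c2 cK)|apply: (in_L2_continuous c3 c4 cK)].
  by move=> x /KP[h1 h2 _]; rewrite /= h1 h2 !mulr0 addr0.
by move=> x /KP[h1 _ h2]; rewrite /= h1 h2 !mulr0 addr0.
Qed.

Lemma partialC_ZD1 z u v x : test_function u -> test_function v ->
  partialC e1 (fun x => z * u x + v x) x = z * partialC e1 u x + partialC e1 v x.
Proof.
move=> Hu Hv; apply: cderive_partial.
apply: (cderive_eq (cderiveD (cderiveM (cderive_cst e1 z x) (test_cderive1 x Hu)) (test_cderive1 x Hv))).
by rewrite mulr0 addr0.
Qed.

Lemma partialC_ZD2 z u v x : test_function u -> test_function v ->
  partialC e2 (fun x => z * u x + v x) x = z * partialC e2 u x + partialC e2 v x.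
Proof.
move=> Hu Hv; apply: cderive_partial.
apply: (cderive_eq (cderiveD (cderiveM (cderive_cst e2 z x) (test_cderive2 x Hu)) (test_cderive2 x Hv))).
by rewrite mulr0 addr0.
Qed.

Lemma magnetic_gradZD A z u v x : test_function u -> test_function v ->
  (magnetic_grad A (fun x => z * u x + v x)).1 x =
    z * (magnetic_grad A u).1 x + (magnetic_grad A v).1 x /\
  (magnetic_grad A (fun x => z * u x + v x)).2 x =
    z * (magnetic_grad A u).2 x + (magnetic_grad A v).2 x.
Proof. by move=> Hu Hv; rewrite /= partialC_ZD1// partialC_ZD2//; split; ring. Qed.

(** Differentiating the phase produces imag * imag * l = - l, which cancels the constant [l] in the
    new potential. *)
Lemma magnetic_grad_mtrans A A' l a u x : test_function u ->
  A' x = A (x + a) + l ->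
  (magnetic_grad A' (fun x => expi l x * u (x + a))).1 x = expi l x * (magnetic_grad A u).1 (x + a) /\
  (magnetic_grad A' (fun x => expi l x * u (x + a))).2 x = expi l x * (magnetic_grad A u).2 (x + a).
Proof.
move=> Hu AA; rewrite /= AA /=.
have ii := imag2 R; split.
  have -> : partialC e1 (fun x => expi l x * u (x + a)) x =
      expi l x * partialC e1 u (x + a) + u (x + a) * (imag * toC l.1 * expi l x).
    apply: cderive_partial.
    exact: (cderiveM (cderive_expi1 l x) (cderive_shift (test_cderive1 (x + a) Hu))).
  rewrite toCD mulrDr.
  have -> : imag * (u (x + a) * (imag * toC l.1 * expi l x)) =
    (imag * imag) * (toC l.1 * expi l x * u (x + a)) by ring.
  rewrite ii; ring.
have -> : partialC e2 (fun x => expi l x * u (x + a)) x =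
    expi l x * partialC e2 u (x + a) + u (x + a) * (imag * toC l.2 * expi l x).
  apply: cderive_partial.
  exact: (cderiveM (cderive_expi2 l x) (cderive_shift (test_cderive2 (x + a) Hu))).
rewrite toCD mulrDr.
have -> : imag * (u (x + a) * (imag * toC l.2 * expi l x)) =
  (imag * imag) * (toC l.2 * expi l x * u (x + a)) by ring.
rewrite ii; ring.
Qed.

End test.

(** * The closed magnetic form *)

Section closability.
Variable R : realType.
Local Notation C := (Cplx R).
Local Notation plane := (R * R)%type.
Local Notation mu := (@plane_measure R).
Local Notation e1 := (@e1 R).
Local Notation e2 := (@e2 R).
Local Notation L2 := (L2 R).
Local Notation nn u := (dot u u).

Lemma box_pair_L2 (f g : plane -> R) a b c d : continuous f -> continuous g ->
  in_L2 (fun x => Complex (f x * \1_(box a b c d) x) (g x * \1_(box a b c d) x) : C).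
Proof. by move=> cf cg; apply/in_L2P; split; exact: continuous_box_sqint. Qed.

(** The function (f + i g) restricted to a box. Taking [g = 0] or [f = 0] selects the real or the
    imaginary part of the function tested against it. *)
Definition box_pair (f g : plane -> R) a b c d (cf : continuous f) (cg : continuous g) : L2 :=
  toL2 (box_pair_L2 a b c d cf cg).

Lemma dot_box_pair f g a b c d (cf : continuous f) (cg : continuous g) (u : L2) :
  dot (box_pair a b c d cf cg) u =
  Rintegral mu (box a b c d) (fun x => f x * reC (u x) + g x * imC (u x)).
Proof.
have H1 := continuous_box_sqint a b c d cf; have H2 := continuous_box_sqint a b c d cg.
rewrite L2dotE /rdot -(@RintegralD _ _ R mu)//; last 2 first.
- exact: (sqint_mul H1 (reL2P u)).
- exact: (sqint_mul H2 (imL2P u)).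
rewrite [RHS]Rintegral_mkcond; apply: eq_Rintegral => x _.
rewrite patchE /reL2 /imL2 /reC /imC /= indicE.
by case: ifP => _; rewrite ?mulr1 ?mulr0 ?mul0r ?addr0.
Qed.

(** [t] is a parabola vanishing at both ends, normalized by (b - a)^2 to take values in ]0, 1] in
    between; then 1 - (1 - t)^(k+1) increases to 1 inside and stays 0 at the ends. *)
Lemma poly_cutoff (a b : R) : a < b -> exists p : nat -> {poly R},
  [/\ forall k, (p k).[a] = 0, forall k, (p k).[b] = 0,
      forall k x, a < x < b -> `|(p k).[x]| <= 1 &
      forall x, a < x < b -> (fun k => (p k).[x]) @ \oo --> (1 : R)].
Proof.
move=> ab; have ba0 : 0 < b - a by rewrite subr_gt0.
pose c := (b - a) ^- 2.
have [t tE] : exists t : {poly R}, forall x, t.[x] = c * ((x - a) * (b - x)).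
  by exists (c *: (('X - a%:P) * (b%:P - 'X))) => x; rewrite !hornerE.
have c0 : 0 < c by rewrite invr_gt0 exprn_gt0.
have t01 x : a < x < b -> 0 < t.[x] <= 1.
  move=> /andP[ax xb]; rewrite tE !mulr_gt0 ?subr_gt0//=.
  rewrite mulrC ler_pdivrMr ?exprn_gt0// mul1r expr2.
  by apply: ler_pM; rewrite ?subr_ge0 ?ltW//; lra.
exists (fun k => 1 - (1 - t) ^+ k.+1); split.
- by move=> k; rewrite !hornerE tE subrr mul0r mulr0 subr0 expr1n subrr.
- by move=> k; rewrite !hornerE tE subrr !mulr0 subr0 expr1n subrr.
- move=> k x /t01/andP[t0 t1]; rewrite !hornerE.
  have : 0 <= (1 - t.[x]) ^+ k.+1 <= 1.
    by rewrite exprn_ge0 ?subr_ge0//= exprn_ile1 ?subr_ge0// gerBl ltW.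
  by move=> /andP[h1 h2]; rewrite ger0_norm ?subr_ge0// gerBl.
- move=> x /t01/andP[t0 t1].
  rewrite (_ : (fun _ => _) = (fun k => 1 - (1 - t.[x]) ^+ k.+1)); last first.
    by apply/funext => k; rewrite !hornerE.
  rewrite -[X in _ --> X]subr0; apply: cvgB; first exact: cvg_cst.
  have := @cvg_geometric R (1 - t.[x]) (1 - t.[x]).
  rewrite ger0_norm ?subr_ge0// gtrBl t0 => /(_ isT).
  by under eq_cvg do rewrite /= -exprS.
Qed.

(** Dominated convergence on the box, where |h| is integrable and dominates every [q k * h]. *)
Lemma vanish_by_cutoff (h : plane -> R) a b c d (q : nat -> plane -> R) : sqint mu h ->
  (forall k, continuous (q k)) ->
  (forall k x, box a b c d x -> `|q k x| <= 1) ->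
  (forall x, box a b c d x -> (fun k => q k x) @ \oo --> (1 : R)) ->
  (forall k, Rintegral mu (box a b c d) (fun x => q k x * h x) = 0) ->
  (\int[mu]_(x in box a b c d) (h x)%:E = 0)%E.
Proof.
move=> Hh cq q1 qc q0.
have mb := measurable_box a b c d; have ih := sqint_box_integrable a b c d Hh.
have mh : measurable_fun (box a b c d) h by apply: measurable_funTS; case: Hh.
have mq k : measurable_fun (box a b c d) (fun x => q k x * h x).
  apply: measurable_funM => //; apply: measurable_funTS; exact: continuous_plane_measurable.
have iq k : mu.-integrable (box a b c d) (EFin \o (fun x => q k x * h x)).
  have := @le_integrable _ _ R mu _ mb (EFin \o (fun x => q k x * h x)) _ _ _ ih.
  apply; first by apply/measurable_EFinP; exact: (mq k).
  move=> x bx /=; rewrite lee_fin normrM -[leRHS]mul1r ler_wpM2r//; exact: q1.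
have [|||||_ _ cv] := @dominated_convergence _ _ R mu _ mb
  (fun k => EFin \o (fun x => q k x * h x)) (EFin \o h) (EFin \o (fun x => `|h x|)) _ _ _ _ _.
- by move=> k; apply/measurable_EFinP; exact: (mq k).
- by apply/measurable_EFinP; exact: mh.
- apply: aeW => x bx; apply/fine_cvgP; split; first exact: nearW.
  rewrite -[X in _ --> X]mul1r; apply: cvgM; [exact: qc|exact: cvg_cst].
- by have := integrable_abse ih.
- apply: aeW => x k bx /=; rewrite lee_fin normrM -[leRHS]mul1r ler_wpM2r//; exact: q1.
apply: (cvg_unique _ cv) => //.
rewrite (_ : [sequence _]_n = (fun=> 0%E)); first exact: cvg_cst.
apply/funext => k; have fk := @integrable_fin_num _ _ R mu _ mb _ (iq k).
by rewrite /= -(fineK fk); congr EFin; exact: q0.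
Qed.

(* By parts: the components of a test function's magnetic gradient, tested against a
   cutoff [q] supported in a box, only involve the function itself. *)
Lemma partial_adjoint (e : plane) (h q dq : plane -> R) a b c d
    (cq : continuous q) (c0 : continuous (fun _ : plane => 0 : R)) :
  continuous h -> continuous dq ->
  (forall f, class_C 1 f -> continuous ('D_e f)) ->
  (forall f, class_C 1 f ->
     \int[mu]_(z in box a b c d) (q z * 'D_e f z + dq z * f z)%:E = 0)%E ->
  exists X Y : L2, forall u v : L2, test_function u ->
    (v : plane -> C) = (fun x => imag * partialC e u x + toC (h x) * u x) ->
    dot (box_pair a b c d cq c0) v = dot X u /\ dot (box_pair a b c d c0 cq) v = dot Y u.
Proof.
move=> ch cdq cD ibp; have mb := measurable_box a b c d.
have cN : continuous (fun z => - dq z) by move=> z; apply: cvgN; exact: cdq.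
have cqh : continuous (fun z => q z * h z) by exact: continuous_mul.
exists (box_pair a b c d cqh cdq), (box_pair a b c d cN cqh) => u v [Cr Ci _] vE.
have cr : continuous (@reC R \o u) := class_C_cont (Cr 0%N).
have cI : continuous (@imC R \o u) := class_C_cont (Ci 0%N).
have Dr := cD _ (Cr 1%N); have Di := cD _ (Ci 1%N).
have cv1 : continuous (fun x => reC (v x)).
  rewrite (_ : (fun x => _) = (fun x => -1 * 'D_e (@imC R \o u) x + h x * (@reC R \o u) x)).
    exact: (continuous_add (continuous_mul (fun=> cvg_cst _) Di) (continuous_mul ch cr)).
  by apply/funext => x; rewrite vE reCD !reCM /=; ring.
have cv2 : continuous (fun x => imC (v x)).
  rewrite (_ : (fun x => _) = (fun x => 'D_e (@reC R \o u) x + h x * (@imC R \o u) x)).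
    exact: (continuous_add Dr (continuous_mul ch cI)).
  by apply/funext => x; rewrite vE imCD !imCM /=; ring.
have cint f : continuous f -> mu.-integrable (box a b c d) (EFin \o f).
  exact: continuous_box_integrable.
have i1 : continuous (fun x => q x * reC (v x) + 0 * imC (v x)).
  exact: (continuous_add (continuous_mul cq cv1) (continuous_mul c0 cv2)).
have i2 : continuous (fun x => 0 * reC (v x) + q x * imC (v x)).
  exact: (continuous_add (continuous_mul c0 cv1) (continuous_mul cq cv2)).
have j1 : continuous (fun x => q x * h x * reC (u x) + dq x * imC (u x)).
  exact: (continuous_add (continuous_mul cqh cr) (continuous_mul cdq cI)).
have j2 : continuous (fun x => - dq x * reC (u x) + q x * h x * imC (u x)).
  exact: (continuous_add (continuous_mul cN cr) (continuous_mul cqh cI)).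
have k f : class_C 1 f -> continuous (fun z => q z * 'D_e f z + dq z * f z).
  move=> Cf; exact: (continuous_add (continuous_mul cq (cD f Cf))
    (continuous_mul cdq (class_C_cont Cf))).
rewrite !dot_box_pair; split; apply/eqP; rewrite -subr_eq0.
- rewrite -(@RintegralB _ _ R mu _ _ _ mb (cint _ i1) (cint _ j1)).
  rewrite (_ : (fun x => _) = (fun x => -1 * (q x * 'D_e (@imC R \o u) x + dq x * (@imC R \o u) x))).
    have ik := cint _ (k _ (Ci 1%N)); have im0 := ibp _ (Ci 1%N).
    by rewrite RintegralZl; [rewrite /Rintegral im0 mulr0|exact: mb|exact: ik].
  by apply/funext => x; rewrite vE reCD !reCM /=; ring.
- rewrite -(@RintegralB _ _ R mu _ _ _ mb (cint _ i2) (cint _ j2)).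
  rewrite (_ : (fun x => _) = (fun x => q x * 'D_e (@reC R \o u) x + dq x * (@reC R \o u) x)).
    by rewrite /Rintegral (ibp _ (Cr 1%N)).
  by apply/funext => x; rewrite vE imCD !imCM /=; ring.
Qed.

Definition continuous_potential (A : plane -> plane) :=
  continuous (fst \o A) /\ continuous (snd \o A).

Definition magnetic_graph (A : plane -> plane) (y : L2 * (L2 * L2)) : Prop :=
  [/\ test_function y.1, (y.2.1 : plane -> C) = (magnetic_grad A y.1).1 &
      (y.2.2 : plane -> C) = (magnetic_grad A y.1).2].

(** The domain of the closed form, each element being kept together with its magnetic gradient; the
    form norm is then the norm of pairs. *)
Definition form_closure (A : plane -> plane) (x : L2 * (L2 * L2)) : Prop :=
  forall e : R, 0 < e -> exists2 y, magnetic_graph A y & nn (x - y) < e.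

Section one_potential.
Variables (A : plane -> plane) (cA : continuous_potential A).

Lemma test_in_graph w (Hw : test_function w) :
  exists2 y, magnetic_graph A y & (y.1 : plane -> C) = w.
Proof.
have [H1 H2] := magnetic_grad_L2 cA.1 cA.2 Hw.
by exists (toL2 (test_L2 Hw), (toL2 H1, toL2 H2)).
Qed.

Lemma magnetic_graph_comb (z : C) x y : magnetic_graph A x -> magnetic_graph A y ->
  magnetic_graph A (z *: x + y).
Proof.
move=> [tx x1 x2] [ty y1 y2]; split.
- exact: (testZD z tx ty).
- apply/funext => t; have [-> _] := magnetic_gradZD A z t tx ty.
  by rewrite -x1 -y1.
- apply/funext => t; have [_ ->] := magnetic_gradZD A z t tx ty.
  by rewrite -x2 -y2.
Qed.

Lemma magnetic_graph0 : magnetic_graph A 0.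
Proof.
have [y Gy _] := test_in_graph (test0 R).
by have := magnetic_graph_comb (-1) Gy Gy; rewrite scaleN1r addNr.
Qed.

Lemma form_closure_domain : form_domain (form_closure A).
Proof.
have dP := semidot_dot (L2 * (L2 * L2))%type.
split.
- by move=> e e0; exists 0; [exact: magnetic_graph0|rewrite subrr (semidot0l dP)].
- move=> x y Qx Qy e e0; have e4 : 0 < e / 4 by rewrite divr_gt0.
  have [x' Gx xx] := Qx _ e4; have [y' Gy yy] := Qy _ e4.
  exists (x' + y'); first by have := magnetic_graph_comb 1 Gx Gy; rewrite scale1r.
  by rewrite opprD addrACA; have := semidotD_le dP (x - x') (y - y'); lra.
- move=> z x Qx e e0; have a0 : 0 < abs2 z + 1 by rewrite ltr_wpDl// abs2_ge0.
  have [x' Gx xx] := Qx _ (divr_gt0 e0 a0).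
  exists (z *: x').
    by have := magnetic_graph_comb z Gx magnetic_graph0; rewrite addr0.
  rewrite -scalerBr nnZ; move: xx; rewrite ltr_pdivlMr// mulrC; apply: le_lt_trans.
  by rewrite ler_wpM2r ?dot_ge0// lerDl.
- move=> x Qx e e0; have e4 : 0 < e / 4 by rewrite divr_gt0.
  have [y Qy xy] := Qx _ e4; have [y' Gy yy] := Qy _ e4; exists y' => //.
  have -> : x - y' = (x - y) + (y - y') by rewrite addrA subrK.
  by have := semidotD_le dP (x - y) (y - y'); lra.
Qed.

Lemma form_closure_dot x k : (forall y, magnetic_graph A y -> dot k y = 0) ->
  form_closure A x -> dot k x = 0.
Proof.
have dP := semidot_dot (L2 * (L2 * L2))%type.
move=> h Qx; apply/eqP; rewrite -sqrf_eq0 eq_le sqr_ge0 andbT; apply/ler_addgt0Pl => e e0.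
have k0 : 0 < nn k + 1 by rewrite ltr_wpDl// dot_ge0.
have [y Gy xy] := Qx _ (divr_gt0 e0 k0); rewrite addr0.
have -> : dot k x = dot k (x - y) by rewrite (semidotDr dP) (semidotNr dP) (h y Gy) subr0.
apply: le_trans (cauchy_schwarz dP _ _) _.
move: xy; rewrite ltr_pdivlMr// mulrC => /ltW; apply: le_trans.
by rewrite ler_wpM2r ?dot_ge0// lerDl.
Qed.

(** Integration by parts moves the derivative onto a cutoff, an identity that extends to the closure
    by continuity. For a pair (0, g) it says that [g] is orthogonal to all cutoffs on boxes, hence
    has zero integral over every box. *)
Lemma form_closure_closable g : form_closure A (0, g) -> nn g = 0.
Proof.
move=> Qg; have dP := semidot_dot (L2 * (L2 * L2))%type.
have c0 : continuous (fun _ : plane => 0 : R) by move=> x; exact: cvg_cst.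
(* The adjoint relation says that (- X, (phi, 0)) is orthogonal to the graph, hence to its closure;
   at (0, g) the term with [X] disappears. *)
have adj (phi X : L2) : (forall y, magnetic_graph A y -> dot phi y.2.1 = dot X y.1) -> dot phi g.1 = 0.
  move=> h; have := @form_closure_dot (0, g) (- X, (phi, 0)).
  rewrite !dot_pair /= => h1.
  have := h1 _ Qg; rewrite (semidot0r (semidot_dot L2)) add0r.
  rewrite (semidot0l (semidot_dot L2)) addr0; apply=> y Gy.
  rewrite !dot_pair /=.
  by rewrite (semidotNl (semidot_dot L2)) (semidot0l (semidot_dot L2)) addr0 h// addNr.
have adj' (phi X : L2) : (forall y, magnetic_graph A y -> dot phi y.2.2 = dot X y.1) -> dot phi g.2 = 0.
  move=> h; have := @form_closure_dot (0, g) (- X, (0, phi)).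
  rewrite !dot_pair /= => h1.
  have := h1 _ Qg; rewrite (semidot0r (semidot_dot L2)) add0r.
  rewrite (semidot0l (semidot_dot L2)) add0r; apply=> y Gy.
  rewrite !dot_pair /=.
  by rewrite (semidotNl (semidot_dot L2)) (semidot0l (semidot_dot L2)) add0r h// addNr.
(* Boxes with bounds in the wrong order are empty; the cutoffs require a nondegenerate interval. *)
have box0 (h : plane -> R) a b c d : (b <= a) || (d <= c) ->
    (\int[mu]_(x in box a b c d) (h x)%:E = 0)%E.
  move=> abcd; rewrite (_ : box a b c d = set0) ?integral_set0//.
  apply/seteqP; split=> // -[x y] [/=]; rewrite !in_itv /= => /andP[h1 h2] /andP[h3 h4].
  by case/orP: abcd => h5; [have := lt_trans h1 h2|have := lt_trans h3 h4]; rewrite ltNge h5.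
have cut1 (h : plane -> R) a b c d : sqint mu h -> (forall p : {poly R}, a < b -> p.[a] = 0 -> p.[b] = 0 ->
    Rintegral mu (box a b c d) (fun z => p.[z.1] * h z) = 0) ->
    (\int[mu]_(x in box a b c d) (h x)%:E = 0)%E.
  move=> Hh h0; have [ab|ba] := ltP a b; last by apply: box0; rewrite ba.
  have [p [pa pb p1 pc]] := poly_cutoff ab.
  apply: (vanish_by_cutoff (q := fun k z => (p k).[z.1]) Hh).
  - by move=> k; exact: continuous_horner1.
  - by move=> k x [/= hx _]; apply: p1; move: hx; rewrite in_itv.
  - by move=> x [/= hx _]; apply: pc; move: hx; rewrite in_itv.
  - by move=> k; exact: h0.
have cut2 (h : plane -> R) a b c d : sqint mu h -> (forall p : {poly R}, c < d -> p.[c] = 0 -> p.[d] = 0 ->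
    Rintegral mu (box a b c d) (fun z => p.[z.2] * h z) = 0) ->
    (\int[mu]_(x in box a b c d) (h x)%:E = 0)%E.
  move=> Hh h0; have [ab|ba] := ltP c d; last by apply: box0; rewrite ba orbT.
  have [p [pa pb p1 pc]] := poly_cutoff ab.
  apply: (vanish_by_cutoff (q := fun k z => (p k).[z.2]) Hh).
  - by move=> k; exact: continuous_horner2.
  - by move=> k x [_ /= hx]; apply: p1; move: hx; rewrite in_itv.
  - by move=> x [_ /= hx]; apply: pc; move: hx; rewrite in_itv.
  - by move=> k; exact: h0.
have zero (u : L2) : (forall a b c d, (\int[mu]_(x in box a b c d) (reL2 u x)%:E = 0)%E) ->
    (forall a b c d, (\int[mu]_(x in box a b c d) (imL2 u x)%:E = 0)%E) -> nn u = 0.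
  move=> hr hi; rewrite L2dotE.
  have := (rdot_eq0 (reL2P u)).2 (vanish_on_boxes (reL2P u) hr).
  have := (rdot_eq0 (imL2P u)).2 (vanish_on_boxes (imL2P u) hi).
  by move=> -> ->; rewrite addr0.
have g10 : nn g.1 = 0.
  have orth (p : {poly R}) a b c d : a < b -> p.[a] = 0 -> p.[b] = 0 ->
      let cq := @continuous_horner1 R p in
      dot (box_pair a b c d cq c0) g.1 = 0 /\ dot (box_pair a b c d c0 cq) g.1 = 0.
    move=> ab pa pb cq.
    have [||X [Y XY]] := @partial_adjoint e1 _ _ _ a b c d cq c0 cA.1 (@continuous_horner1 _ p^`()).
    - by move=> f /class_C_elim[_ _ _ /class_C_cont].
    - move=> f /class_C_elim[cf df _ /class_C_cont cdf _].
      by apply: (ibp_box1 c d ab pa pb cf _ cdf) => x; case: (df x).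
    split; [apply: (@adj _ X)|apply: (@adj _ Y)] => y [Ty y1 _];
      by have [h1 h2] := XY y.1 y.2.1 Ty y1.
  apply: zero => a b c d; [apply: cut1 (reL2P _) _|apply: cut1 (imL2P _) _] => p ab pa pb.
    have [h _] := orth p a b c d ab pa pb; rewrite dot_box_pair in h; rewrite -[RHS]h.
    by apply: eq_Rintegral => x _; rewrite mul0r addr0.
  have [_ h] := orth p a b c d ab pa pb; rewrite dot_box_pair in h; rewrite -[RHS]h.
  by apply: eq_Rintegral => x _; rewrite mul0r add0r.
have g20 : nn g.2 = 0.
  have orth (p : {poly R}) a b c d : c < d -> p.[c] = 0 -> p.[d] = 0 ->
      let cq := @continuous_horner2 R p in
      dot (box_pair a b c d cq c0) g.2 = 0 /\ dot (box_pair a b c d c0 cq) g.2 = 0.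
    move=> ab pa pb cq.
    have [||X [Y XY]] := @partial_adjoint e2 _ _ _ a b c d cq c0 cA.2 (@continuous_horner2 _ p^`()).
    - by move=> f /class_C_elim[_ _ _ _ /class_C_cont].
    - move=> f /class_C_elim[cf _ df _ /class_C_cont cdf].
      by apply: (ibp_box2 a b ab pa pb cf _ cdf) => x; case: (df x).
    split; [apply: (@adj' _ X)|apply: (@adj' _ Y)] => y [Ty _ y2];
      by have [h1 h2] := XY y.1 y.2.2 Ty y2.
  apply: zero => a b c d; [apply: cut2 (reL2P _) _|apply: cut2 (imL2P _) _] => p ab pa pb.
    have [h _] := orth p a b c d ab pa pb; rewrite dot_box_pair in h; rewrite -[RHS]h.
    by apply: eq_Rintegral => x _; rewrite mul0r addr0.
  have [_ h] := orth p a b c d ab pa pb; rewrite dot_box_pair in h; rewrite -[RHS]h.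
  by apply: eq_Rintegral => x _; rewrite mul0r add0r.
by rewrite dot_pair g10 g20 addr0.
Qed.

End one_potential.
End closability.

(** * Convergence of complex numbers and of inner products *)

Section convergence.
Variable R : realType.
Local Notation C := (Cplx R).

Lemma norm_lt_toC (z : C) (r : R) : 0 < r -> (`|z| < toC r) = (abs2 z < r ^+ 2).
Proof.
move=> r0; rewrite (normc_def z) /toC (_ : Complex r 0 = r%:C%C)// ltcR.
rewrite -(@ltr_pXn2r _ 2)// ?nnegrE ?sqrtr_ge0 ?(ltW r0)// sqr_sqrtr//.
by rewrite addr_ge0 ?sqr_ge0.
Qed.

Lemma pos_toC (e : C) : 0 < e -> exists2 r : R, 0 < r & e = toC r.
Proof.
case: e => a b; rewrite ltcE /= => /andP[/eqP b0 a0]; exists a => //.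
by rewrite /toC -b0.
Qed.

(** The norm of [C] takes values in [C] itself; this translates its topology into real estimates on
    the squared modulus. *)
Lemma cvg_complexP (T : Type) (F : set_system T) (FF : Filter F) (z : T -> C) (l : C) :
  z @ F --> l <-> forall e : R, 0 < e -> \forall t \near F, abs2 (z t - l) < e.
Proof.
have abs2B (x y : C) : abs2 (x - y) = abs2 (y - x).
  by case: x => a b; case: y => c d; rewrite /abs2 /=; ring.
split=> [/cvgrPdist_lt h e e0|h].
  have s0 : 0 < Num.sqrt e by rewrite sqrtr_gt0.
  have te : 0 < toC (Num.sqrt e) by rewrite ltcE /= eqxx.
  apply: filterS (h _ te) => t; rewrite norm_lt_toC// sqr_sqrtr ?ltW// abs2B //.
apply/cvgrPdist_lt => e /pos_toC[r r0 ->].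
by apply: filterS (h _ (exprn_gt0 2 r0)) => t; rewrite norm_lt_toC// abs2B.
Qed.

Lemma near_ooP (P : nat -> Prop) : (\forall n \near \oo, P n) <-> exists N, forall n, (N <= n)%N -> P n.
Proof. by split=> [[N _ NP]|[N NP]]; exists N. Qed.

Lemma near_oo2P (P : nat -> nat -> Prop) : (\forall p \near (\oo, \oo), P p.1 p.2) <->
  exists N, forall m n, (N <= m)%N -> (N <= n)%N -> P m n.
Proof.
split=> [[[A B] [/= [N _ NA] [M _ MB]] AB]|[N NP]].
  exists (maxn N M) => m n; rewrite !geq_max => /andP[m1 m2] /andP[n1 n2].
  by apply: (AB (m, n)); split; [exact: NA|exact: MB].
exists ([set n | (N <= n)%N], [set n | (N <= n)%N]) => /=; first by split; exists N.
by move=> [m n] /= [? ?]; exact: NP.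
Qed.

Lemma cvg_in_dot2 (V : semiHilbertType R) (u v : nat -> V) (a b : V) :
  cvg_in (@dot R V) u a -> cvg_in (@dot R V) v b ->
  forall e : R, 0 < e -> exists N, forall n, (N <= n)%N -> (dot (u n) (v n) - dot a b) ^+ 2 < e.
Proof.
have dP := semidot_dot V.
(* [K] bounds |a|^2 and, as soon as |v n - b|^2 < 1, also |v n|^2. *)
move=> ua vb e e0; pose K : R := 2 * dot b b + 2 + dot a a + 1.
have K0 : 0 < K by rewrite /K; have := dot_ge0 b; have := dot_ge0 a; lra.
have eK : 0 < e / (4 * K) by rewrite divr_gt0// mulr_gt0.
have [N1 N1P] := ua _ eK; have [N2 N2P] := vb _ eK; have [N3 N3P] := vb 1 ltr01.
exists (maxn N1 (maxn N2 N3)) => n; rewrite !geq_max => /and3P[n1 n2 n3].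
have h1 := N1P n n1; have h2 := N2P n n2; have h3 := N3P n n3.
have -> : dot (u n) (v n) - dot a b = dot (u n - a) (v n) + dot a (v n - b).
  by rewrite !dotE; ring.
have vn : dot (v n) (v n) <= K.
  have := semidotD_le dP (v n - b) b; rewrite subrK /K; have := dot_ge0 a; lra.
have aK : dot a a <= K by rewrite /K; have := dot_ge0 b; lra.
have c1 := cauchy_schwarz dP (u n - a) (v n).
have c2 := cauchy_schwarz dP a (v n - b).
move: h1 h2; rewrite !ltr_pdivlMr ?mulr_gt0// => h1 h2.
have d1 : dot (u n - a) (u n - a) * dot (v n) (v n) <= dot (u n - a) (u n - a) * K.
  by rewrite ler_wpM2l ?dot_ge0.
have d2 : dot a a * dot (v n - b) (v n - b) <= K * dot (v n - b) (v n - b).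
  by rewrite ler_wpM2r ?dot_ge0.
move: (dot (u n - a) (v n)) (dot a (v n - b)) c1 c2 => x y c1 c2.
have : 0 <= (x - y) ^+ 2 by exact: sqr_ge0.
rewrite !expr2 in c1 c2 *; nra.
Qed.
End convergence.

(** * The magnetic Laplacian as a weak equation on the closed form *)

Section laplacian.
Variable R : realType.
Local Notation C := (Cplx R).
Local Notation plane := (R * R)%type.
Local Notation mu := (@plane_measure R).
Local Notation L2 := (L2 R).
Local Notation nn u := (dot u u).
Variables (A : plane -> plane) (cA : continuous_potential A).

Definition cdot (V : semiHilbertType R) (u v : V) : C := Complex (dot u v) (dot u (imag *: v)).

Lemma cdot_cvg (V : semiHilbertType R) (u v : nat -> V) (a b : V) :
  cvg_in (@dot R V) u a -> cvg_in (@dot R V) v b ->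
  (fun n => cdot (u n) (v n)) @ \oo --> cdot a b.
Proof.
move=> ua vb; apply/cvg_complexP => e e0; apply/near_ooP.
have ivb : cvg_in (@dot R V) (fun n => imag *: v n) (imag *: b).
  by move=> d d0; have [N NP] := vb d d0; exists N => n /NP; rewrite -scalerBr dotiZ.
have e2 : 0 < e / 2 by rewrite divr_gt0.
have [N1 N1P] := cvg_in_dot2 ua vb e2; have [N2 N2P] := cvg_in_dot2 ua ivb e2.
exists (maxn N1 N2) => n; rewrite geq_max => /andP[/N1P h1 /N2P h2].
by rewrite (splitr e); exact: ltrD h1 h2.
Qed.

Lemma magnetic_form_graph x y : magnetic_graph A x -> magnetic_graph A y ->
  magnetic_form A x.1 y.1 = cdot x.2 y.2.
Proof.
move=> [_ x1 x2] [_ y1 y2].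
have E (f g f' g' : L2) : cintegral (fun x => f x * (g x)^* + f' x * (g' x)^*) =
    L2dot f g + L2dot f' g'.
  have I1 (h k : L2) : mu.-integrable setT (EFin \o (fun x => reC (h x * (k x)^*))).
    have a1 := sqint_mul (reL2P h) (reL2P k); have a2 := sqint_mul (imL2P h) (imL2P k).
    have := @integrableD _ _ R mu _ measurableT _ _ a1 a2.
    apply: eq_integrable => // t _; rewrite /= conjCE reCM /= mulrN opprK EFinD //.
  have I2 (h k : L2) : mu.-integrable setT (EFin \o (fun x => imC (h x * (k x)^*))).
    have a1 := sqint_mul (imL2P h) (reL2P k); have a2 := sqint_mul (reL2P h) (imL2P k).
    have := @integrableB _ _ R mu _ measurableT _ _ a1 a2.
    by apply: eq_integrable => // t _; rewrite /= conjCE imCM /= mulrN EFinD EFinN addeC.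
  rewrite /cintegral /L2dot /cintegral.
  have -> (a b c d : R) : Complex a b + Complex c d = Complex (a + c) (b + d) :> C by [].
  congr Complex.
    rewrite -(@RintegralD _ _ R mu _ _ _ measurableT (I1 f g) (I1 f' g')).
    by apply: eq_Rintegral => t _; rewrite /= reCD.
  rewrite -(@RintegralD _ _ R mu _ _ _ measurableT (I2 f g) (I2 f' g')).
  by apply: eq_Rintegral => t _; rewrite /= imCD.
rewrite /magnetic_form -x1 -x2 -y1 -y2 E !L2dotC /cdot !dot_pair.
by [].
Qed.

Lemma magnetic_graphB x y : magnetic_graph A x -> magnetic_graph A y -> magnetic_graph A (x - y).
Proof.
move=> Gx Gy; have := magnetic_graph_comb (-1) Gy Gx.
by rewrite scaleN1r addrC.
Qed.

Local Notation approx := (form_approx (magnetic_form A) (@test_function R)).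
Local Notation L3 := (L2 * (L2 * L2))%type.

(** The form at a difference is the squared norm of the difference of the gradients. A sequence that
    is Cauchy for the form thus has convergent gradients, and their limit is the second
    component. *)
Lemma approx_closure (U : L2) (w : nat -> plane -> C) : approx U w ->
  exists (g : L2 * L2) (y : nat -> L3), [/\ form_closure A (U, g),
    forall n, magnetic_graph A (y n), forall n, (y n).1 = w n :> (plane -> C) &
    cvg_in (@dot R _) y (U, g)].
Proof.
move=> [_ tw wU qw].
have [y yP] : exists y : nat -> L3, forall n, magnetic_graph A (y n) /\ (y n).1 = w n :> (plane -> C).
  have h n : exists y : L3, magnetic_graph A y /\ y.1 = w n :> (plane -> C).
    by have [y Gy yw] := test_in_graph cA (tw n); exists y.
  by have [y yP] := choice h; exists y.
have Gy n := (yP n).1; have yw n := (yP n).2.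
have u0 : forall e : R, 0 < e -> exists N, forall n, (N <= n)%N -> nn ((y n).1 - U) < e.
  move=> e e0; apply/near_ooP; move/cvgrPdist_lt : wU => /(_ e e0); apply: filterS => n.
  rewrite sub0r normrN -yw => h.
  by have := le_lt_trans (ler_norm _) h; rewrite (_ : L2norm2 _ = L2norm2 ((y n).1 - U)) ?L2norm2E.
have gC : forall e : R, 0 < e -> exists N, forall m n, (N <= m)%N -> (N <= n)%N ->
    nn ((y m).2 - (y n).2) < e.
  move=> e e0; have e2 : 0 < e ^+ 2 by rewrite exprn_gt0.
  have FF : Filter (filter_prod \oo \oo : set_system (nat * nat)%type) by exact: filter_prod_filter.
  have h := (@cvg_complexP R (nat * nat)%type (filter_prod \oo \oo) FF _ _).1 qw _ (exprn_gt0 2 e0).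
  have [N NP] := (near_oo2P (fun m n => abs2 (magnetic_form A (w m \- w n) (w m \- w n) - 0) < e ^+ 2)).1 h.
  exists N => m n Nm Nn; have := NP m n Nm Nn; rewrite subr0.
  have -> : w m \- w n = (y m - y n).1 by rewrite -!yw.
  rewrite (magnetic_form_graph (magnetic_graphB (Gy m) (Gy n)) (magnetic_graphB (Gy m) (Gy n))).
  rewrite /cdot /= (dotC _ (imag *: _)) dotii /abs2 /= expr0n addr0.
  by rewrite ltr_pXn2r// ?nnegrE ?dot_ge0 ?ltW.
have [g gP] := dot_complete (fun n => (y n).2) gC.
have yc : cvg_in (@dot R _) y (U, g).
  move=> e e0; have e2 : 0 < e / 2 by rewrite divr_gt0.
  have [N1 N1P] := u0 _ e2; have [N2 N2P] := gP _ e2.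
  exists (maxn N1 N2) => n; rewrite geq_max => /andP[/N1P h1 /N2P h2].
  by rewrite (splitr e) dot_pair; exact: ltrD h1 h2.
exists g, y; split=> //.
move=> e e0; have [N NP] := yc e e0; exists (y N) => //.
by rewrite (semidot_sym (semidot_dot _)); exact: NP.
Qed.

Lemma closure_approx x : form_closure A x -> exists y : nat -> L3,
  [/\ forall n, magnetic_graph A (y n), cvg_in (@dot R _) y x & approx x.1 (fun n => (y n).1)].
Proof.
move=> Qx.
have [y yP] : exists y : nat -> L3, forall n, magnetic_graph A (y n) /\ nn (x - y n) < n.+1%:R^-1.
  have h n : exists y : L3, magnetic_graph A y /\ nn (x - y) < n.+1%:R^-1.
    have n0 : 0 < n.+1%:R^-1 :> R by rewrite invr_gt0.
    by have [y Gy xy] := Qx _ n0; exists y.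
  by have [y yP] := choice h; exists y.
have Gy n := (yP n).1; have yx n := (yP n).2.
have yc : cvg_in (@dot R _) y x.
  move=> e e0; exists (Num.bound e^-1) => n Nn.
  rewrite (semidot_sym (semidot_dot _)); apply: lt_trans (yx n) _.
  rewrite invf_plt ?posrE//; apply: (lt_le_trans (archi_boundP _)); first by rewrite invr_ge0 ltW.
  by rewrite ler_nat ltnW.
exists y; split=> //; split.
- exact: L2P.
- by move=> n; case: (Gy n).
- apply/cvgrPdist_lt => e e0; apply/near_ooP; have [N NP] := yc e e0; exists N => n /NP.
  rewrite dot_pair sub0r normrN (_ : L2norm2 _ = nn ((y n).1 - x.1)); last by rewrite -L2norm2E.
  rewrite ger0_norm ?dot_ge0//; apply: le_lt_trans; by rewrite lerDl dot_ge0.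
- apply/cvg_complexP => e e0.
  have s0 : 0 < Num.sqrt e by rewrite sqrtr_gt0.
  apply/(near_oo2P (fun m n => abs2 (magnetic_form A ((y m).1 \- (y n).1) ((y m).1 \- (y n).1) - 0) < e)).
  have [N NP] := cvg_in_cauchy (semidot_dot _) yc s0.
  exists N => m n Nm Nn; have := NP m n Nm Nn; rewrite subr0.
  have -> : (y m).1 \- (y n).1 = (y m - y n).1 by [].
  rewrite (magnetic_form_graph (magnetic_graphB (Gy m) (Gy n)) (magnetic_graphB (Gy m) (Gy n))).
  rewrite /cdot /= (dotC _ (imag *: _)) dotii /abs2 /= expr0n addr0 dot_pair => h.
  rewrite -[ltRHS](@sqr_sqrtr _ e) ?ltW// ltr_pXn2r// ?nnegrE ?dot_ge0 ?sqrtr_ge0//.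
  by apply: le_lt_trans h; rewrite lerDr dot_ge0.
Qed.

(** Form values along approximating sequences converge to inner products of limit gradients. By
    closability every sequence approximating [U] leads to the same gradient [g]. The real part of
    the equation suffices, the imaginary part being the real one tested with [imag *: y]. *)
Lemma magnetic_laplacianP (U F : L2) : magnetic_laplacian A U F <->
  exists2 g, form_closure A (U, g) & forall y, form_closure A y -> dot g y.2 = dot F y.1.
Proof.
split=> [[_ [w wU] H]|[g Qg gP]].
  have [g [x [Qg Gx xw xc]]] := approx_closure wU; exists g => // y Qy.
  have [z [Gz zc za]] := closure_approx Qy.
  have := H _ _ _ wU za.
  rewrite (_ : (fun n => _) = (fun n => cdot (x n).2 (z n).2)); last first.
    by apply/funext => n; rewrite -xw magnetic_form_graph.
  have xc2 : cvg_in (@dot R _) (fun n => (x n).2) g.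
    move=> e e0; have [N NP] := xc e e0; exists N => n /NP.
    by rewrite dot_pair; apply: le_lt_trans; rewrite lerDr dot_ge0.
  have zc2 : cvg_in (@dot R _) (fun n => (z n).2) y.2.
    move=> e e0; have [N NP] := zc e e0; exists N => n /NP.
    by rewrite dot_pair; apply: le_lt_trans; rewrite lerDr dot_ge0.
  have c1 := cdot_cvg xc2 zc2 => c2.
  have E : cdot g y.2 = L2dot F y.1 by exact: (cvg_unique (@norm_hausdorff _ C) c1 c2).
  by move: E; rewrite L2dotC => -[].
split; first exact: L2P.
  by have [y [Gy _ ya]] := closure_approx Qg; exists (fun n => (y n).1).
move=> v u_ v_ au av.
have Hv : in_L2 v by case: av.
have av' : approx (toL2 Hv) v_ by [].
have [g' [x [Qg' Gx xw xc]]] := approx_closure au.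
have [h [z [Qh Gz zw zc]]] := approx_closure av'.
have gg : eqv g' g.
  apply/eqvP; apply: (form_closure_closable cA).
  by have := form_domainB (form_closure_domain cA) Qg' Qg; rewrite (_ : _ - _ = (0, g' - g))//;
    congr pair; rewrite /= subrr.
rewrite (_ : (fun n => _) = (fun n => cdot (x n).2 (z n).2)); last first.
  by apply/funext => n; rewrite -xw -zw magnetic_form_graph.
have xc2 : cvg_in (@dot R _) (fun n => (x n).2) g'.
  move=> e e0; have [N NP] := xc e e0; exists N => n /NP.
  by rewrite dot_pair; apply: le_lt_trans; rewrite lerDr dot_ge0.
have zc2 : cvg_in (@dot R _) (fun n => (z n).2) h.
  move=> e e0; have [N NP] := zc e e0; exists N => n /NP.
  by rewrite dot_pair; apply: le_lt_trans; rewrite lerDr dot_ge0.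
have -> : L2dot F v = cdot g' h; last exact: cdot_cvg.
have -> : L2dot F v = cdot F (toL2 Hv) by rewrite -[in LHS](toL2E Hv) L2dotC.
rewrite /cdot !gg; congr Complex; first by rewrite (gP _ Qh).
by have := gP _ (form_domainZ (form_closure_domain cA) imag Qh).
Qed.

End laplacian.

(** * Perturbation and translation of the closed form *)

Section closure_maps.
Variable R : realType.
Local Notation C := (Cplx R).
Local Notation plane := (R * R)%type.
Local Notation L2 := (L2 R).
Local Notation nn u := (dot u u).

(** The shear (u, g) |-> (u, g - d u) maps the graph for [A] into the graph for [A'], and it is
    continuous because [d] is bounded, so it also maps the closures. *)
Lemma form_closure_perturb (A A' d : plane -> plane) (e : R)
    (b1 : bounded_mult (fun x => toC (d x).1) e) (b2 : bounded_mult (fun x => toC (d x).2) e) :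
  (forall x, A x = A' x + d x) ->
  forall (u : L2) g, form_closure A (u, g) -> form_closure A' (u, g - (mulL2 b1 u, mulL2 b2 u)).
Proof.
move=> AA u g Qu r r0; have dP := semidot_dot (L2 * L2)%type.
(* |a v|^2 <= 2 e |v|^2, so the shear multiplies squared norms by at most 3 + 4 e. *)
have e0 := bounded_mult_ge0 b1; pose k : R := 3 + 4 * e.
have k0 : 0 < k by rewrite /k; lra.
have [y [ty y1 y2] uy] := Qu _ (divr_gt0 r0 k0).
pose a (v : L2) : L2 * L2 := (mulL2 b1 v, mulL2 b2 v).
have aB v w : a (v - w) = a v - a w.
  by congr pair; apply: L2_eq => x /=; rewrite mulrBr.
have an v : nn (a v) <= 2 * e * nn v.
  by rewrite dot_pair; have := mulL2_le b1 v; have := mulL2_le b2 v; lra.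
exists (y.1, y.2 - a y.1).
  split; first exact: ty.
    apply/funext => x; change (y.2.1 x - toC (d x).1 * y.1 x = imag * partialC (e1 R) y.1 x + toC (A' x).1 * y.1 x).
    by rewrite y1 /= AA toCD; ring.
  apply/funext => x; change (y.2.2 x - toC (d x).2 * y.1 x = imag * partialC (e2 R) y.1 x + toC (A' x).2 * y.1 x).
  by rewrite y2 /= AA toCD; ring.
have h0 : nn (u - y.1) + nn (g - y.2) < r / k by move: uy; rewrite dot_pair.
move: h0; rewrite ltr_pdivlMr// => h0.
suff h : nn (u - y.1) + nn (g - y.2 - a (u - y.1)) < r.
  have E (V : zmodType) (p q s t : V) : p - q - (s - t) = p - s - (q - t).
    by rewrite !opprD !opprK addrACA.
  rewrite dot_pair.
  have -> : ((u, g - (mulL2 b1 u, mulL2 b2 u)) - (y.1, y.2 - a y.1)).2 = (g - y.2) - a (u - y.1).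
    by rewrite aB; exact: E.
  exact: h.
have h1 := semidotB_le dP (g - y.2) (a (u - y.1)); have h2 := an (u - y.1).
have h3 := dot_ge0 (u - y.1); have h4 := dot_ge0 (g - y.2).
have h5 : 0 <= e * nn (g - y.2) by rewrite mulr_ge0.
move: h0 h1 h2 h3 h4 h5; rewrite /k.
move: (nn (u - y.1)) (nn (g - y.2)) (nn (a (u - y.1))) (nn (g - y.2 - a (u - y.1))).
move=> p q s t; lra.
Qed.

Lemma form_closure_mtrans (A A' : plane -> plane) (l a : plane) :
  (forall x, A' x = A (x + a) + l) ->
  forall (u g1 g2 : L2), form_closure A (u, (g1, g2)) ->
    form_closure A' (mtrans l a u, (mtrans l a g1, mtrans l a g2)).
Proof.
move=> AA u g1 g2 Qu r r0; have [y [ty y1 y2] uy] := Qu _ r0.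
have mB v w : mtrans l a (v - w) = mtrans l a v - mtrans l a w.
  by apply: L2_eq => x /=; rewrite mulrBr.
exists (mtrans l a y.1, (mtrans l a y.2.1, mtrans l a y.2.2)).
  split=> /=; first exact: test_mtrans.
    apply/funext => x; have [h _] := magnetic_grad_mtrans ty (AA x).
    by apply: etrans (esym h); rewrite y1.
  apply/funext => x; have [_ h] := magnetic_grad_mtrans ty (AA x).
  by apply: etrans (esym h); rewrite y2.
have h : nn (u - y.1) + (nn (g1 - y.2.1) + nn (g2 - y.2.2)) < r.
  by move: uy; rewrite dot_pair dot_pair.
rewrite dot_pair dot_pair.
suff h' : nn (mtrans l a u - mtrans l a y.1) + (nn (mtrans l a g1 - mtrans l a y.2.1) +
    nn (mtrans l a g2 - mtrans l a y.2.2)) < r by exact: h'.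
by rewrite -!mB !mtrans_nn.
Qed.

(** The two phases multiply to exp(- i l.a), which is 1 when [l] and [a] are orthogonal. *)
Lemma mtransK l a (u : L2) : l.1 * a.1 + l.2 * a.2 = 0 ->
  mtrans l a (mtrans (- l) (- a) u) = u.
Proof.
move=> la; apply: L2_eq => x; rewrite !mtransE addrK mulrA.
have -> : expi l x * expi (- l) (x + a) = 1 :> C; last by rewrite mul1r.
apply/eqP; rewrite eq_complex /=.
set t := l.1 * x.1 + l.2 * x.2.
have -> : - l.1 * (x.1 + a.1) + - l.2 * (x.2 + a.2) = - t.
  by rewrite /t; move: la; set p := l.1 * a.1; set q := l.2 * a.2 => pq; rewrite !mulrDr !mulNr -/p -/q; lra.
rewrite cosN sinN !mulrN opprK -!expr2 cos2Dsin2 eqxx /=.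
by rewrite addrC mulrC subrr.
Qed.
End closure_maps.

(** * Pauli operators *)

Section spinors.
Variable R : realType.
Local Notation C := (Cplx R).
Local Notation plane := (R * R)%type.
Local Notation mu := (@plane_measure R).
Local Notation L2 := (L2 R).
Local Notation H := (L2 * L2)%type.
Local Notation G := ((L2 * L2) * (L2 * L2))%type.
Local Notation nn u := (dot u u).

(** [G] stores the two gradient components of the first spinor component, then those of the second;
    the principal part acts diagonally. *)
Definition spin_form (A : plane -> plane) (x : H * G) : Prop :=
  form_closure A (x.1.1, x.2.1) /\ form_closure A (x.1.2, x.2.2).

Lemma spin_form_domain A : continuous_potential A -> form_domain (spin_form A).
Proof.
move=> cA; have QP := form_closure_domain cA; split.
- by split; exact: form_domain0 QP.
- by move=> x y [x1 x2] [y1 y2]; split; [exact: (form_domainD QP x1 y1)|exact: (form_domainD QP x2 y2)].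
- by move=> z x [x1 x2]; split; [exact: (form_domainZ QP z x1)|exact: (form_domainZ QP z x2)].
- move=> x h.
  have key e : 0 < e -> exists2 y, spin_form A y &
      nn (x.1.1 - y.1.1) + nn (x.1.2 - y.1.2) + (nn (x.2.1 - y.2.1) + nn (x.2.2 - y.2.2)) < e.
    move=> e0; have [y Qy xy] := h _ e0; exists y => //.
  split; apply: (form_domain_closed QP) => e /key[y [Q1 Q2] xy].
    exists (y.1.1, y.2.1) => //; apply: le_lt_trans xy; rewrite dot_pair.
    change (nn (x.1.1 - y.1.1) + nn (x.2.1 - y.2.1) <=
      nn (x.1.1 - y.1.1) + nn (x.1.2 - y.1.2) + (nn (x.2.1 - y.2.1) + nn (x.2.2 - y.2.2)) : Prop).
    have := dot_ge0 (x.1.2 - y.1.2); have := dot_ge0 (x.2.2 - y.2.2).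
    by move: (nn _) (nn _) (nn _) (nn _) => p q s t; lra.
  exists (y.1.2, y.2.2) => //; apply: le_lt_trans xy; rewrite dot_pair.
  change (nn (x.1.2 - y.1.2) + nn (x.2.2 - y.2.2) <=
    nn (x.1.1 - y.1.1) + nn (x.1.2 - y.1.2) + (nn (x.2.1 - y.2.1) + nn (x.2.2 - y.2.2)) : Prop).
  have := dot_ge0 (x.1.1 - y.1.1); have := dot_ge0 (x.2.1 - y.2.1).
  by move: (nn _) (nn _) (nn _) (nn _) => p q s t; lra.
Qed.

Definition spin (u : H) : spinor R := fun x => \col_i (if i == 0 then u.1 x else u.2 x).

Lemma component_spin0 u : component (spin u) 0 = u.1.
Proof. by apply/funext => x; rewrite /component mxE. Qed.
Lemma component_spin1 u : component (spin u) 1 = u.2.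
Proof. by apply/funext => x; rewrite /component mxE. Qed.

Lemma ord2P (P : 'I_2 -> Prop) : P 0 -> P 1 -> forall i, P i.
Proof.
move=> P0 P1; case=> [[|[|//]] h].
  by rewrite (_ : Ordinal h = 0)//; apply: val_inj.
by rewrite (_ : Ordinal h = 1)//; apply: val_inj.
Qed.

Lemma spin_L2 u : in_L2s (spin u).
Proof. by apply: ord2P; rewrite ?component_spin0 ?component_spin1; exact: L2P. Qed.

Definition unspin u (Hu : in_L2s u) : H := (toL2 (Hu 0), toL2 (Hu 1)).

Lemma unspinK u (Hu : in_L2s u) : spin (unspin Hu) = u.
Proof.
apply/funext => x; apply/matrixP => i j; rewrite !mxE (ord1 j); move: i.
by apply: ord2P.
Qed.

Lemma spin_nn u : L2norm2s (spin u) = nn u.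
Proof.
rewrite /L2norm2s big_ord_recl big_ord1 component_spin0 (_ : lift _ _ = 1); last exact: val_inj.
by rewrite component_spin1 !L2norm2E dot_pair.
Qed.

Lemma spin_ae u v : ae_eq mu setT (spin u) (spin v) <-> eqv u v.
Proof.
split=> [h|/eqvP].
  apply/eqvP; rewrite dot_pair.
  have h1 : nn (u.1 - v.1) = 0.
    apply/eqvP/eqv_ae; apply: filterS h => x /(_ I) h _.
    by have := congr1 (fun m : 'cV_2 => m 0 0) h; rewrite !mxE.
  have h2 : nn (u.2 - v.2) = 0.
    apply/eqvP/eqv_ae; apply: filterS h => x /(_ I) h _.
    by have := congr1 (fun m : 'cV_2 => m 1 0) h; rewrite !mxE.
  by rewrite h1 h2 addr0.
rewrite dot_pair => /eqP; rewrite paddr_eq0 ?dot_ge0// => /andP[/eqP h1 /eqP h2].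
have /eqv_ae h1' : eqv u.1 v.1 by apply/eqvP.
have /eqv_ae h2' : eqv u.2 v.2 by apply/eqvP.
apply: filterS2 h1' h2' => x /(_ I) e1 /(_ I) e2 _.
by apply/matrixP => i j; rewrite !mxE e1 e2.
Qed.

Lemma spin_comb u z v : (fun x => spin u x + z *: spin v x) = spin (u + z *: v).
Proof.
by apply/funext => x; apply/matrixP => i j; rewrite !mxE; case: ifP.
Qed.

Record matrix_potential (W : plane -> 'M[C]_2) (K : R) := {
  matrix_potential_mult : forall i j, bounded_mult (fun x => W x i j) K;
  matrix_potential_herm : forall x i j, W x i j = (W x j i)^* }.

Section potential.
Variables (W : plane -> 'M[C]_2) (K : R) (WP : matrix_potential W K).
Local Notation bm := (matrix_potential_mult WP).

Definition matmul (u : H) : H :=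
  (mulL2 (bm 0 0) u.1 + mulL2 (bm 0 1) u.2, mulL2 (bm 1 0) u.1 + mulL2 (bm 1 1) u.2).

Lemma matmulD u v : matmul (u + v) = matmul u + matmul v.
Proof. by rewrite /matmul !mulL2D; congr pair; rewrite addrACA. Qed.

Lemma matmulZ z u : matmul (z *: u) = z *: matmul u.
Proof. by rewrite /matmul !mulL2Z; congr pair; rewrite -scalerDr. Qed.

Lemma matmul_sym u v : dot (matmul u) v = dot u (matmul v).
Proof.
rewrite !dot_pair /=.
rewrite !(semidotDl (semidot_dot L2)) !(semidotDr (semidot_dot L2)).
rewrite !(fun i j => mulL2_adj (bm i j) (bm j i) _ _ (fun x => matrix_potential_herm WP x j i)).
ring.
Qed.

Lemma matmul_nn u : nn (matmul u) <= 4 * K * nn u.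
Proof.
rewrite !dot_pair /=.
have h1 := semidotD_le (semidot_dot L2) (mulL2 (bm 0 0) u.1) (mulL2 (bm 0 1) u.2).
have h2 := semidotD_le (semidot_dot L2) (mulL2 (bm 1 0) u.1) (mulL2 (bm 1 1) u.2).
have h3 := mulL2_le (bm 0 0) u.1; have h4 := mulL2_le (bm 0 1) u.2.
have h5 := mulL2_le (bm 1 0) u.1; have h6 := mulL2_le (bm 1 1) u.2.
lra.
Qed.

(* The shift makes the energy form coercive with constants depending only on [K],
   hence uniformly over the family of operators. *)
Definition shifted (u : H) : H := matmul u + toC (4 * K + 2) *: u.

Lemma shifted_coercive : coercive_op shifted.
Proof.
have K0 := bounded_mult_ge0 (bm 0 0); have dP := semidot_dot H.
split.
- by move=> u v; rewrite /shifted matmulD scalerDr addrACA.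
- by move=> z u; rewrite /shifted matmulZ scalerDr !scalerA mulrC.
- by move=> u v; rewrite /shifted (semidotDl dP) (semidotDr dP) matmul_sym !dotE.
- exists (2 * (4 * K) + 2 * (4 * K + 2) ^+ 2).
    by rewrite ltr_wpDl ?mulr_ge0// mulr_gt0// exprn_gt0//; lra.
  move=> u; apply: le_trans (semidotD_le dP _ _) _; have := matmul_nn u.
  by rewrite !nnZ /abs2 /= expr0n addr0; lra.
(* By Young's inequality - dot (matmul u) u is at most (4 K + 1/4) |u|^2, so the shift 4 K + 2
   leaves more than |u|^2. *)
- move=> u; rewrite /shifted (semidotDl dP) (semidotC dP (toC _ *: u)) (semidotZr dP).
  have := dot_young (matmul u) u; have := matmul_nn u; have := dot_ge0 u.
  by move: (dot (matmul u) u) (nn (matmul u)) (nn u) => p q r; lra.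
Qed.

(** The magnetic terms - b and + b are merged with [V] into one Hermitian matrix, so that the Pauli
    operator is a diagonal magnetic Laplacian plus a bounded multiplication. *)
Definition pauli_potential (b : plane -> R) (V : plane -> 'M[C]_2) (x : plane) : 'M[C]_2 :=
  V x + diag_mx (\row_j (if j == 0 then toC (- b x) else toC (b x))).

(** The shift is added to both sides of the equation. The two scalar equations are equivalent to a
    single one on the product, since test pairs may live in one spinor component. *)
Lemma pauliP A b V (u f : H) : continuous_potential A -> W = pauli_potential b V ->
  pauli A b V (spin u) (spin f) <->
  weak_solution (spin_form A) shifted u (f + toC (4 * K + 2) *: u).
Proof.
move=> cA WE; have dP := semidot_dot H; have dP' := semidot_dot L2.
pose F := f - matmul u; have L : lift ord0 ord0 = 1 :> 'I_2 by exact: val_inj.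
have E0 : (fun x => component (fun x => spin f x - V x *m spin u x) 0 x - toC ((\- b) x) * component (spin u) 0 x) = F.1.
  apply/funext => x; change ((spin f x - V x *m spin u x) 0 0 - toC (- b x) * (spin u x) 0 0 =
    f.1 x - (W x 0 0 * u.1 x + W x 0 1 * u.2 x)).
  rewrite WE !mxE big_ord_recl big_ord1 L !mxE /= mulr1n mulr0n; ring.
have E1 : (fun x => component (fun x => spin f x - V x *m spin u x) 1 x - toC (b x) * component (spin u) 1 x) = F.2.
  apply/funext => x; change ((spin f x - V x *m spin u x) 1 0 - toC (b x) * (spin u x) 1 0 =
    f.2 x - (W x 1 0 * u.1 x + W x 1 1 * u.2 x)).
  rewrite WE !mxE big_ord_recl big_ord1 L !mxE /= mulr1n mulr0n; ring.
rewrite /pauli /add_potential E0 E1 component_spin0 component_spin1 !magnetic_laplacianP//.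
split.
  move=> [[g0 Q0 e0] [g1 Q1 e1]]; exists (g0, g1).
    exact: conj Q0 Q1.
  move=> y [Qy0 Qy1].
  rewrite /shifted (semidotDl dP _ (toC _ *: u)) (semidotDl dP f).
  have -> : dot (g0, g1) y.2 = dot F y.1.
    have h0 : dot g0 y.2.1 = dot F.1 y.1.1 := e0 _ Qy0.
    have h1 : dot g1 y.2.2 = dot F.2 y.1.2 := e1 _ Qy1.
    by rewrite 2!dot_pair [X in X + _]h0 [X in _ + X]h1.
  rewrite (semidotDl dP f) (semidotNl dP); ring.
move=> [[g0 g1] [Q0 Q1] e].
have e' y : spin_form A y -> dot (g0, g1) y.2 = dot F y.1.
  move=> /e; rewrite /shifted (semidotDl dP _ (toC _ *: u)) (semidotDl dP f).
  rewrite (semidotDl dP f) (semidotNl dP).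
  move: (dot (g0, g1) _) (dot (matmul u) _) (dot f _) (dot (toC _ *: u) _) => p q r s; lra.
(* Completing a test pair by zero in the other component isolates one scalar equation. *)
have Q00 : form_closure A (0, 0) by exact: form_domain0 (form_closure_domain cA).
split; [exists g0; first exact: Q0|exists g1; first exact: Q1]; move=> [y1 y2] Qy.
  have Qy' : spin_form A ((y1, 0), (y2, 0)) := conj Qy Q00.
  have h : dot g0 y2 + dot g1 0 = dot F.1 y1 + dot F.2 0 := e' _ Qy'.
  by move: h; rewrite (semidot0r (semidot_dot (L2 * L2)%type)) (semidot0r dP') !addr0.
have Qy' : spin_form A ((0, y1), (0, y2)) := conj Q00 Qy.
have h : dot g0 0 + dot g1 y2 = dot F.1 0 + dot F.2 y1 := e' _ Qy'.
by move: h; rewrite (semidot0r (semidot_dot (L2 * L2)%type)) (semidot0r dP') !add0r.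
Qed.
End potential.
End spinors.

(** * Resolvent set, spectrum and eigenspaces of a Pauli operator *)

Section pauli_resolvent.
Variable R : realType.
Local Notation C := (Cplx R).
Local Notation plane := (R * R)%type.
Local Notation L2 := (L2 R).
Local Notation H := (L2 * L2)%type.

Section one.
Variables (A : plane -> plane) (b : plane -> R) (V : plane -> 'M[C]_2) (K : R).
Hypotheses (cA : continuous_potential A) (WP : matrix_potential (pauli_potential b V) K).
Variables (T : H -> H) (TP : forall f, weak_solution (spin_form A) (shifted WP) (T f) f).
Let M : C := toC (4 * K + 2).

Lemma pauli_eqv u f : pauli A b V (spin u) (spin f) <-> eqv u (T (f + M *: u)).
Proof.
rewrite (pauliP WP u f cA erefl).
exact: (weak_solutionP (spin_form_domain cA) (shifted_coercive WP) TP).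
Qed.

(** The definitions of spectrum and eigenspace quantify over arbitrary spinors; membership in the
    operator domain is what allows one to pass to the space [H]. *)
Lemma pauli_in_L2 u f : pauli A b V u f -> in_L2s u.
Proof.
by move=> [[_ [w [u0 _ _ _]] _] [_ [w' [u1 _ _ _]] _]]; exact: ord2P.
Qed.

Lemma resolvent_set_pauli z : resolvent_set (pauli A b V) z <-> resolvent T (z + M).
Proof.
have comb f u : f + (z + M) *: u = (f + z *: u) + M *: u by rewrite scalerDl addrA.
split=> [[c h]|[c h]]; exists c => f.
  have [u [pu uq un]] := h _ (spin_L2 f).
  have Hu := pauli_in_L2 pu; move: pu uq un; rewrite -(unspinK Hu); move: (unspin Hu) => {Hu u}u.
  rewrite spin_comb !spin_nn => /pauli_eqv uT uq un; exists u; split; [by rewrite comb| |exact: un].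
  move=> v; rewrite comb => /pauli_eqv vT; apply/spin_ae; apply: uq.
  by rewrite spin_comb.
move=> Hf; rewrite -(unspinK Hf); move: (unspin Hf) => {Hf f}f.
have [u [uT uq un]] := h f; exists (spin u); rewrite spin_comb !spin_nn; split=> //.
  by apply/pauli_eqv; rewrite -comb.
move=> v pv; have Hv := pauli_in_L2 pv; move: pv; rewrite -(unspinK Hv); move: (unspin Hv) => {Hv v}v.
by rewrite spin_comb => /pauli_eqv vT; apply/spin_ae; apply: uq; rewrite comb.
Qed.

Lemma eigenspace_pauli z u : eigenspace (pauli A b V) z (spin u) <-> eqv u (T ((z + M) *: u)).
Proof.
rewrite scalerDl -pauli_eqv /eigenspace /=.
by rewrite (_ : (fun x => _) = spin (z *: u))//; apply/funext => x; apply/matrixP => i j;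
  rewrite !mxE; case: ifP.
Qed.

Lemma spectrum_pauli z : spectrum (pauli A b V) z <-> ~ exists c, bddbelow T (z + M) c.
Proof.
have TS := resolvent_symop (spin_form_domain cA) (shifted_coercive WP) TP.
by rewrite /spectrum /= resolvent_set_pauli (resolventP TS).
Qed.
End one.
End pauli_resolvent.

(** * Perturbation and covariance of Pauli resolvents *)

Section spinor_maps.
Variable R : realType.
Local Notation C := (Cplx R).
Local Notation plane := (R * R)%type.
Local Notation L2 := (L2 R).
Local Notation H := (L2 * L2)%type.
Local Notation G := ((L2 * L2) * (L2 * L2))%type.
Local Notation nn u := (dot u u).

Lemma bounded_multN (m : plane -> C) e : bounded_mult m e -> bounded_mult (fun x => - m x) e.
Proof.
move=> [mr mi me]; split.
- by rewrite (_ : _ \o _ = \- (@reC R \o m)); [exact: measurableT_comp|apply/funext => x /=; rewrite reCN].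
- by rewrite (_ : _ \o _ = \- (@imC R \o m)); [exact: measurableT_comp|apply/funext => x /=; rewrite imCN].
- by move=> x; rewrite /abs2 reCN imCN !sqrrN; exact: me.
Qed.

Lemma bounded_multB (m m' : plane -> C) K K' e : bounded_mult m K -> bounded_mult m' K' ->
  (forall x, abs2 (m x - m' x) <= e) -> bounded_mult (fun x => m x - m' x) e.
Proof.
move=> [mr mi _] [mr' mi' _] me; split=> //.
- rewrite (_ : _ \o _ = (@reC R \o m) \- (@reC R \o m')); first exact: measurable_funB.
  by apply/funext => x /=; rewrite reCD reCN.
- rewrite (_ : _ \o _ = (@imC R \o m) \- (@imC R \o m')); first exact: measurable_funB.
  by apply/funext => x /=; rewrite imCD imCN.
Qed.

Lemma pauli_resolvent_perturb (A A' d : plane -> plane) (W W' : plane -> 'M[C]_2) (K e : R)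
    (WP : matrix_potential W K) (WP' : matrix_potential W' K) (T T' : H -> H) :
  continuous_potential A -> continuous_potential A' ->
  (forall f, weak_solution (spin_form A) (shifted WP) (T f) f) ->
  (forall f, weak_solution (spin_form A') (shifted WP') (T' f) f) ->
  0 < e -> (forall x, A x = A' x + d x) ->
  bounded_mult (fun x => toC (d x).1) e -> bounded_mult (fun x => toC (d x).2) e ->
  (forall x i j, abs2 (W x i j - W' x i j) <= e) ->
  forall f, nn (T f - T' f) <= 16 * e * nn f.
Proof.
move=> cA cA' TP TP' e0 AA b1 b2 We f.
pose a (u : H) : G := ((mulL2 b1 u.1, mulL2 b2 u.1), (mulL2 b1 u.2, mulL2 b2 u.2)).
pose bD i j := bounded_multB (matrix_potential_mult WP i j) (matrix_potential_mult WP' i j)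
  (fun x => We x i j).
(* 4 e is a common constant: the change of gradient contributes at most 2 e |u|^2, the change of
   matrix at most 4 e |u|^2. The factor 4 of [resolvent_perturb] then gives 16 e. *)
have e4 : 0 < 4 * e by rewrite mulr_gt0.
have := @resolvent_perturb R H G (spin_form A) (spin_form A') (shifted WP) (shifted WP') T T' a (4 * e)
  (spin_form_domain cA) (spin_form_domain cA') (shifted_coercive WP) (shifted_coercive WP') TP TP' e4.
have -> : 16 * e = 4 * (4 * e) by rewrite mulrA -natrM.
apply.
- move=> u; have an v : nn (mulL2 b1 v) + nn (mulL2 b2 v) <= 2 * e * nn v.
    by have := mulL2_le b1 v; have := mulL2_le b2 v; lra.
  rewrite [leLHS](_ : _ = (nn (mulL2 b1 u.1) + nn (mulL2 b2 u.1)) + (nn (mulL2 b1 u.2) + nn (mulL2 b2 u.2)))//.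
  have := an u.1; have := an u.2; have := dot_ge0 u; rewrite [dot u u]dot_pair.
  move: (nn (mulL2 b1 u.1) + _) (nn (mulL2 b1 u.2) + _) (nn u.1) (nn u.2) => p q s t h1 h2 h3.
  have := mulr_ge0 (ltW e0) h1; lra.
- move=> u.
  have -> : shifted WP u - shifted WP' u =
      (mulL2 (bD 0 0) u.1 + mulL2 (bD 0 1) u.2, mulL2 (bD 1 0) u.1 + mulL2 (bD 1 1) u.2).
    have -> : shifted WP u - shifted WP' u = matmul WP u - matmul WP' u.
      by rewrite /shifted opprD addrACA subrr addr0.
    congr pair; apply: L2_eq => x.
      change (W x 0 0 * u.1 x + W x 0 1 * u.2 x - (W' x 0 0 * u.1 x + W' x 0 1 * u.2 x) =
        (W x 0 0 - W' x 0 0) * u.1 x + (W x 0 1 - W' x 0 1) * u.2 x); ring.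
    change (W x 1 0 * u.1 x + W x 1 1 * u.2 x - (W' x 1 0 * u.1 x + W' x 1 1 * u.2 x) =
      (W x 1 0 - W' x 1 0) * u.1 x + (W x 1 1 - W' x 1 1) * u.2 x); ring.
  have h1 := semidotD_le (semidot_dot L2) (mulL2 (bD 0 0) u.1) (mulL2 (bD 0 1) u.2).
  have h2 := semidotD_le (semidot_dot L2) (mulL2 (bD 1 0) u.1) (mulL2 (bD 1 1) u.2).
  have h3 := mulL2_le (bD 0 0) u.1; have h4 := mulL2_le (bD 0 1) u.2.
  have h5 := mulL2_le (bD 1 0) u.1; have h6 := mulL2_le (bD 1 1) u.2.
  rewrite dot_pair [dot u u]dot_pair; move: h1 h2 h3 h4 h5 h6.
  move: (nn (mulL2 (bD 0 0) u.1 + _)) (nn (mulL2 (bD 1 0) u.1 + _)) => p q.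
  move: (nn (mulL2 (bD 0 0) u.1)) (nn (mulL2 (bD 0 1) u.2)) (nn (mulL2 (bD 1 0) u.1)) (nn (mulL2 (bD 1 1) u.2)).
  move: (nn u.1) (nn u.2) => s t v1 v2 v3 v4 *; lra.
- move=> u g [Q1 Q2]; split.
    exact: (form_closure_perturb b1 b2 AA Q1).
  exact: (form_closure_perturb b1 b2 AA Q2).
- move=> u g [Q1 Q2].
  have AA' x : A' x = A x + - d x by rewrite AA addrK.
  have b1' : bounded_mult (fun x => toC (- d x).1) e.
    rewrite (_ : (fun x => _) = (fun x => - toC (d x).1)); first exact: bounded_multN.
    by apply/funext => x; rewrite -toCN.
  have b2' : bounded_mult (fun x => toC (- d x).2) e.
    rewrite (_ : (fun x => _) = (fun x => - toC (d x).2)); first exact: bounded_multN.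
    by apply/funext => x; rewrite -toCN.
  have EN (v : L2) : - (mulL2 b1' v, mulL2 b2' v) = (mulL2 b1 v, mulL2 b2 v).
    congr pair; apply: L2_eq => x.
      by change (- (toC (- (d x).1) * v x) = toC (d x).1 * v x); rewrite toCN mulNr opprK.
    by change (- (toC (- (d x).2) * v x) = toC (d x).2 * v x); rewrite toCN mulNr opprK.
  split.
    by have := form_closure_perturb b1' b2' AA' Q1; rewrite EN.
  by have := form_closure_perturb b1' b2' AA' Q2; rewrite EN.
Qed.

Definition strans (l a : plane) (u : H) : H := (mtrans l a u.1, mtrans l a u.2).

Lemma strans_dot l a u v : dot (strans l a u) (strans l a v) = dot u v.
Proof. by rewrite !dot_pair !mtrans_dot. Qed.
Lemma stransD l a u v : strans l a (u + v) = strans l a u + strans l a v.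
Proof. by rewrite /strans !mtransD. Qed.
Lemma stransZ l a z u : strans l a (z *: u) = z *: strans l a u.
Proof. by rewrite /strans !mtransZ. Qed.

Lemma pauli_resolvent_covariant (A A' : plane -> plane) (l a : plane) (W W' : plane -> 'M[C]_2) (K : R)
    (WP : matrix_potential W K) (WP' : matrix_potential W' K) (T T' : H -> H) :
  continuous_potential A' ->
  (forall f, weak_solution (spin_form A) (shifted WP) (T f) f) ->
  (forall f, weak_solution (spin_form A') (shifted WP') (T' f) f) ->
  l.1 * a.1 + l.2 * a.2 = 0 ->
  (forall x, A' x = A (x + a) + l) -> (forall x, W' x = W (x + a)) ->
  forall f, eqv (strans l a (T f)) (T' (strans l a f)).
Proof.
move=> cA' TP TP' la AA WW.
pose SG (g : G) : G := (strans l a g.1, strans l a g.2).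
have AA' x : A x = A' (x + - a) + - l by rewrite AA addrK subrK.
apply: (resolvent_covariant (spin_form_domain cA') (shifted_coercive WP') TP TP' (SG := SG)).
- exact: strans_dot.
- move=> u v; rewrite [LHS](_ : _ = dot (strans l a u.1) (strans l a v.1) + dot (strans l a u.2) (strans l a v.2))//.
  by rewrite !strans_dot [RHS]dot_pair.
- move=> u; rewrite /shifted stransD stransZ; congr (_ + _).
  congr pair; apply: L2_eq => x.
    change (W' x 0 0 * (expi l x * u.1 (x + a)) + W' x 0 1 * (expi l x * u.2 (x + a)) =
      expi l x * (W (x + a) 0 0 * u.1 (x + a) + W (x + a) 0 1 * u.2 (x + a))).
    rewrite WW; ring.
  change (W' x 1 0 * (expi l x * u.1 (x + a)) + W' x 1 1 * (expi l x * u.2 (x + a)) =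
    expi l x * (W (x + a) 1 0 * u.1 (x + a) + W (x + a) 1 1 * u.2 (x + a))).
  rewrite WW; ring.
- move=> u [[g1 g2] [g3 g4]] [Q1 Q2]; split; [exact: (form_closure_mtrans AA Q1)|exact: (form_closure_mtrans AA Q2)].
(* The preimage of a test pair is its inverse magnetic translate; orthogonality of [l] and [a]
   enters here, through [mtransK]. *)
- move=> [[u1 u2] [[g1 g2] [g3 g4]]] [Q1 Q2].
  exists (strans (- l) (- a) (u1, u2)), (strans (- l) (- a) (g1, g2), strans (- l) (- a) (g3, g4)).
  split; first by split; [exact: (form_closure_mtrans AA' Q1)|exact: (form_closure_mtrans AA' Q2)].
  have K1 v : mtrans l a (mtrans (- l) (- a) v) = v by exact: mtransK.
  by rewrite /SG /strans !K1.
Qed.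
End spinor_maps.

(** * Almost orthogonality of distant translates *)

Section decay.
Variable R : realType.
Local Notation C := (Cplx R).
Local Notation plane := (R * R)%type.
Local Notation mu := (@plane_measure R).
Local Notation L2 := (L2 R).
Local Notation H := (L2 * L2)%type.
Local Notation nn u := (dot u u).

(** Only the first coordinate is cut off, matching the direction in which the recurrent points are
    separated. *)
Definition strip (r : R) : set plane := [set x | `|x.1| < r].

Lemma bounded_strip r : bounded_mult (fun x => toC (\1_(strip r) x)) 1.
Proof.
have ms : measurable (strip r).
  apply: open_plane_measurable.
  rewrite (_ : strip r = (fun x : plane => `|x.1|) @^-1` [set y | y < r])//.
  apply: open_comp; last exact: open_lt.
  move=> x _; apply: (@continuous_comp plane R R (@fst R R) (fun y : R => `|y|)); first exact: cvg_fst.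
  exact: (@norm_continuous _ R).
split.
- by rewrite (_ : _ \o _ = \1_(strip r))//; exact: measurable_indic.
- by rewrite (_ : _ \o _ = cst 0)//; exact: measurable_cst.
- move=> x; rewrite /abs2 /= indicE expr0n addr0.
  by case: (_ \in _); rewrite ?expr1n ?expr0n.
Qed.

Lemma cut_tail (u : L2) (e : R) : 0 < e -> exists r (u1 : L2),
  (forall x, r <= `|x.1| -> u1 x = 0) /\ nn (u - u1) < e.
Proof.
move=> e0; pose U n := mulL2 (bounded_strip n%:R) u.
have [ur ui ufin] := L2P u.
have mU n : measurable_fun setT (fun x => (abs2 ((u - U n) x))%:E).
  by have [wr wi _] := L2P (u - U n); exact: measurable_abs2.
have [||||_ _ cv] := @dominated_convergence _ _ R mu _ measurableT
  (fun n x => (abs2 ((u - U n) x))%:E) (fun=> 0%E) (fun x => (abs2 (u x))%:E) mU.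
- exact: measurable_cst.
- apply: aeW => x _.
  apply/fine_cvgP; split; first exact: nearW.
  apply: cvg_near_cst.
  exists (Num.bound `|x.1|) => // n /= Nn.
  have xn : `|x.1| < n%:R.
    by apply: lt_le_trans (archi_boundP _) _ => //; rewrite ler_nat.
  have h : u x - toC (\1_(strip n%:R) x) * u x = 0.
    by rewrite indicE mem_set// -[toC _]/(1 : C) mul1r subrr.
  change (abs2 (u x - toC (\1_(strip n%:R) x) * u x) = 0).
  by rewrite h /abs2 /= expr0n addr0.
- apply/integrableP; split; first exact: measurable_abs2.
  apply: le_lt_trans ufin; rewrite le_eqVlt; apply/orP; left; apply/eqP.
  apply: eq_integral => x _.
  by rewrite gee0_abs// lee_fin abs2_ge0.
- apply: aeW => x n _; rewrite gee0_abs ?lee_fin ?abs2_ge0// L2BE.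
  change (abs2 (u x - toC (\1_(strip n%:R) x) * u x) <= abs2 (u x) : Prop).
  rewrite indicE; case: (_ \in _).
    by rewrite -[toC _]/(1 : C) mul1r subrr /abs2 /= expr0n addr0 abs2_ge0.
  by rewrite -[toC _]/(0 : C) mul0r subr0.
rewrite integral0 in cv.
move/fine_cvgP : cv => -[_] /cvgrPdist_lt/(_ e e0)[N _ NP].
have Ne : nn (u - U N) < e.
  have := NP N (leqnn _); rewrite sub0r normrN.
  rewrite -[X in `|X|](congr1 fine (dot_integral (u - U N))).
  by rewrite ger0_norm ?dot_ge0.
exists N%:R, (U N); split=> // x Nx.
change (toC (\1_(strip N%:R) x) * u x = 0).
by rewrite indicE memNset ?mul0r// /strip /= => /lt_le_trans/(_ Nx); rewrite ltxx.
Qed.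

(** Up to small errors [u] and [v] live in strips of half widths [r1] and [r2], whose translates are
    disjoint once the first coordinates of the shifts differ by r1 + r2. Phases preserve supports,
    so the distance is uniform in [l] and [l']. *)
Lemma mtrans_far (u v : L2) (e : R) : 0 < e -> exists r, forall l a l' a' : plane,
  r <= `|a.1 - a'.1| -> `|dot (mtrans l a u) (mtrans l' a' v)| <= e.
Proof.
move=> e0; have dP := semidot_dot L2.
have u0 := dot_ge0 u; have v0 := dot_ge0 v.
(* [k] bounds |v|^2 and the squared norm of the truncation of [u]; [d] makes the square of each of
   the two errors at most e^2/4. *)
pose k : R := nn v + 2 * nn u + 3; have k0 : 0 < k by rewrite /k; lra.
pose d := Num.min 1 (e ^+ 2 / (4 * k)).
have d0 : 0 < d by rewrite lt_min ltr01 divr_gt0 ?exprn_gt0 ?mulr_gt0.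
have d1 : d <= 1 by rewrite ge_min lexx.
have dk : d * k <= e ^+ 2 / 4.
  have : d <= e ^+ 2 / (4 * k) by rewrite ge_min lexx orbT.
  rewrite ler_pdivlMr ?mulr_gt0//; lra.
have [r1 [u1 [u1z u1d]]] := cut_tail u d0; have [r2 [v1 [v1z v1d]]] := cut_tail v d0.
exists (r1 + r2) => l a l' a' raa.
pose S := mtrans l a; pose S' := mtrans l' a'.
have SB w w' : S (w - w') = S w - S w' by apply: L2_eq => x /=; rewrite mulrBr.
have SB' w w' : S' (w - w') = S' w - S' w' by apply: L2_eq => x /=; rewrite mulrBr.
have zero : dot (S u1) (S' v1) = 0.
  have h x : S u1 x = 0 \/ S' v1 x = 0.
    have [h|h] := ltP `|(x + a).1| r1; last by left; rewrite mtransE u1z// mulr0.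
    have [h'|h'] := ltP `|(x + a').1| r2; last by right; rewrite mtransE v1z// mulr0.
    exfalso; have := ler_normB (x.1 + a.1) (x.1 + a'.1).
    rewrite opprD addrACA subrr add0r => /(le_trans raa).
    by rewrite leNgt ltrD.
  rewrite L2dotE /rdot.
  have E f : (forall x, f x = 0) -> Rintegral mu setT f = 0.
    by move=> fz; have -> : f = (fun=> 0) by [apply/funext]; rewrite /Rintegral integral0.
  rewrite !E ?addr0// => x; rewrite /reL2 /imL2; case: (h x) => ->; by rewrite ?mulr0 ?mul0r.
have -> : dot (S u) (S' v) = dot (S (u - u1)) (S' v) + dot (S u1) (S' (v - v1)).
  rewrite SB SB' (semidotDl dP) (semidotNl dP) (semidotDr dP) (semidotNr dP) zero; ring.
have c1 := cauchy_schwarz dP (S (u - u1)) (S' v).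
have c2 := cauchy_schwarz dP (S u1) (S' (v - v1)).
rewrite !mtrans_nn in c1 c2.
have n1 : nn u1 <= k.
  have -> : u1 = u - (u - u1) by rewrite opprB addrC subrK.
  by have := semidotB_le dP u (u - u1); rewrite /k; lra.
have n2 : nn v <= k by rewrite /k; lra.
have b1 : nn (u - u1) * nn v <= d * k by exact: (ler_pM (dot_ge0 _) (dot_ge0 _) (ltW u1d) n2).
have b2 : nn u1 * nn (v - v1) <= d * k by rewrite mulrC; exact: (ler_pM (dot_ge0 _) (dot_ge0 _) (ltW v1d) n1).
have c3 := le_trans c1 b1; have c4 := le_trans c2 b2.
rewrite -(@ler_pXn2r _ 2)// ?nnegrE ?(ltW e0)// real_normK ?num_real//.
move: (dot (S (u - u1)) _) (dot (S u1) _) c3 c4 => x y c3 c4.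
have := sqr_ge0 (x - y); move: c3 c4 dk. move: (d * k) => p *; lra.
Qed.

Lemma strans_far (u v : H) (e : R) : 0 < e -> exists r, forall l a l' a' : plane,
  r <= `|a.1 - a'.1| -> `|dot (strans l a u) (strans l' a' v)| <= e.
Proof.
move=> e0; have e2 : 0 < e / 2 by rewrite divr_gt0.
have [r1 h1] := mtrans_far u.1 v.1 e2; have [r2 h2] := mtrans_far u.2 v.2 e2.
exists (Num.max r1 r2) => l a l' a'; rewrite ge_max => /andP[/h1 h1' /h2 h2'].
by rewrite dot_pair (splitr e); apply: le_trans (ler_normD _ _) (lerD (h1' _ _) (h2' _ _)).
Qed.
End decay.

(** * Compact groups and covariant families *)

Section compact_group.
Variables (R : realType) (B : topologicalZmodType).
Hypothesis cB : compact [set: B].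
Local Notation plane := (R * R)%type.

Lemma compact_continuous_bounded (phi : B -> R) : continuous phi ->
  exists K : R, forall w, `|phi w| <= K.
Proof.
move=> cphi.
have cA : compact (phi @` [set: B]).
  by apply: continuous_compact => //; exact: continuous_subspaceT.
have [K [_ hK]] := compact_bounded cA.
by exists (K + 1) => w; apply: hK; [rewrite ltrDl|exists w].
Qed.

(** The difference is jointly continuous in (w, k) and vanishes at k = 0; compactness in [w] gives
    one neighbourhood of 0 valid for all [w]. *)
Lemma uniform_translate (phi : B -> R) : continuous phi -> forall e : R, 0 < e ->
  \forall k \near (0 : B), forall w, `|phi (w + k) - phi w| < e.
Proof.
move=> cphi e e0.
have := (compact_near_coveringP [set: B]).1 cB B (nbhs (0 : B))
  (fun k w => `|phi (w + k) - phi w| < e) _.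
move=> /(_ _) h.
have : \forall k \near (0 : B), [set: B] `<=` (fun w => `|phi (w + k) - phi w| < e).
  apply: h => w0 _.
  pose psi (p : B * B) : R := `|phi (p.1 + p.2) - phi p.1|.
  have cpsi : {for (w0, 0), continuous psi}.
    apply: (@continuous_comp _ _ _ (fun p : B * B => phi (p.1 + p.2) - phi p.1) (fun y : R => `|y|)).
      apply: cvgB.
        apply: (@continuous_comp _ _ _ (fun p : B * B => p.1 + p.2) phi); last exact: cphi.
        exact: tvs.add_continuous.
      by apply: (@continuous_comp _ _ _ fst phi); [exact: cvg_fst|exact: cphi].
    exact: (@norm_continuous _ R).
  have := cpsi [set y | y < e]; rewrite /nbhs /=.
  have : nbhs (psi (w0, 0)) [set y | y < e].
    by apply: open_nbhs_nbhs; split; [exact: open_lt|rewrite /psi /= addr0 subrr normr0].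
  by move=> h1 /(_ h1).
by apply: filterS => k hk w; exact: hk.
Qed.

(** The points [b] with w' + b - w in [U] form a neighbourhood of w - w', which the dense range of
    [iota] meets. *)
Lemma dense_translate (iota : plane -> B) (U : set B) (w w' : B) : dense (range iota) ->
  nbhs (0 : B) U -> exists a, U (w' + iota a - w).
Proof.
move=> dI U0.
have cont : {for (w - w' : B), continuous (fun b : B => w' + b - w)}.
  apply: (@continuous_comp _ _ _ (fun b => w' + b) (fun b => b - w)).
    apply: (@continuous_comp _ _ _ (fun b : B => (w', b)) (fun p : B * B => p.1 + p.2)).
      by apply: cvg_pair; [exact: cvg_cst|exact: cvg_id].
    exact: tvs.add_continuous.
  apply: (@continuous_comp _ _ _ (fun b : B => (b, w)) (fun p : B * B => p.1 - p.2)).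
    by apply: cvg_pair; [exact: cvg_id|exact: cvg_cst].
  exact: sub_continuous.
have : nbhs (w - w') ((fun b : B => w' + b - w) @^-1` U).
  by apply: cont; rewrite (addrC w') subrK subrr.
rewrite nbhsE; case=> O [oO Ow] OU.
have [b [Ob [a _ ab]]] := dI O (ex_intro _ _ Ow) oO.
by exists a; rewrite ab; exact: OU.
Qed.

(* Differences of terms of [iota (k r, 0)] close to a cluster point are close to 0. *)
Lemma recurrent_points (iota : plane -> B) (U : set B) (r : R) (n : nat) :
  {morph iota : x y / x + y} -> nbhs (0 : B) U -> 0 <= r ->
  exists x : 'I_n -> plane, (forall i, U (iota (x i))) /\
    forall i j, i != j -> r <= `|(x i).1 - (x j).1|.
Proof.
move=> im U0 r0; pose p (k : nat) := iota (k%:R * r, 0).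
have [q [_ cq]] := cB (@fmap_proper_filter _ _ p \oo _) filterT.
have [N Nq NU] : exists2 N, nbhs q N & forall a b, N a -> N b -> U (a - b).
  have := @sub_continuous B (q, q); rewrite /continuous_at /= subrr => /(_ U U0).
  move=> [[P Q] /= [Pq Qq] PQ]; exists (P `&` Q); first exact: filterI.
  by move=> a b [Pa _] [_ Qb]; exact: (PQ (a, b)).
have inf m : exists k, (m <= k)%N /\ N (p k).
  have [|b [[k mk <-] Nb]] := cq (p @` [set k | (m <= k)%N]) N _ Nq.
    by exists m => // k /= mk; exists k.
  by exists k.
have [next nextP] := choice inf.
pose s := fix s i := if i is i'.+1 then next (s i').+1 else next 0%N.
have sN i : N (p (s i)) by case: i => [|i]; exact: (nextP _).2.
have sS i : (s i < s i.+1)%N by exact: (nextP _).1.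
have smono i j : (i < j)%N -> (s i < s j)%N by exact: (homo_ltn ltn_trans sS).
(* All points share the base term [s 0]: each image is a difference of two terms near [q], and
   between two points the base cancels, leaving a nonzero integer multiple of [r]. *)
exists (fun i : 'I_n => ((s i.+1)%:R * r - (s 0%N)%:R * r, 0)); split=> [i|i j ij].
  rewrite (_ : iota _ = p (s i.+1) - p (s 0%N)); first exact: NU.
  apply: (addIr (p (s 0%N))); rewrite subrK /p -im; congr iota.
  by congr pair => /=; rewrite ?subrK ?addr0.
rewrite /= opprB addrA subrK -mulrBl normrM (ger0_norm r0).
suff : 1 <= `|(s i.+1)%:R - (s j.+1)%:R| :> R by move=> h; rewrite ler_peMl.
wlog ltij : i j ij / (i < j)%N.
  move=> h; have [lt|lt|/val_inj e] := ltngtP i j; first exact: h.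
    by rewrite distrC; apply: h; rewrite // eq_sym.
  by rewrite e eqxx in ij.
have lt := smono i.+1 j.+1 ltij.
rewrite distrC ger0_norm; first by rewrite -natrB ?ler1n ?subn_gt0// ltnW.
by rewrite subr_ge0 ler_nat ltnW.
Qed.
End compact_group.

(** * Spectra of covariant, norm continuous families *)

Section covariant_family.
Variables (R : realType) (H : semiHilbertType R) (B : topologicalZmodType).
Local Notation plane := (R * R)%type.
Local Notation nn u := (dot u u).
Variables (iota : plane -> B) (T : B -> H -> H) (S : plane -> H -> H).
Hypotheses (TS : forall w, symop (T w))
  (Tcont : forall e : R, 0 < e -> \forall k \near (0 : B), forall w f,
     nn (T (w + k) f - T w f) <= e * nn f)
  (SP : forall a u v, dot (S a u) (S a v) = dot u v)
  (SD : forall a u v, S a (u + v) = S a u + S a v)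
  (SZ : forall a z u, S a (z *: u) = z *: S a u)
  (ST : forall w a f, eqv (S a (T w f)) (T (w + iota a) (S a f))).

(** Norm continuity moves the bound from [w] to a nearby point w' + iota a, and conjugation by the
    isometry [S a] moves it on to [w']. *)
Lemma family_bddbelow w w' z c : dense (range iota) ->
  bddbelow (T w) z c -> exists c', bddbelow (T w') z c'.
Proof.
move=> dI h; have [e e0 eP] := bddbelow_perturb h.
have [a ka] := dense_translate w w' dI (Tcont e0).
have [c' h'] : exists c', bddbelow (T (w' + iota a)) z c'.
  apply: eP => u; rewrite (semidot_sym (semidot_dot H)).
  by have := ka w u; rewrite (addrC w) subrK.
exists c' => u; rewrite -(SP a u u); apply: le_trans (h' _) _.
rewrite (@eqv_nn _ _ _ (S a (u - z *: T w' u))) ?SP//.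
rewrite SD -[- (z *: T w' u)]scaleNr SZ scaleNr.
by apply: eqvB => //; apply: eqvZ; exact: eqv_sym.
Qed.

Lemma S_eqv a u v : eqv u v -> eqv (S a u) (S a v).
Proof.
move=> /eqvP uv; apply/eqvP.
have -> : S a u - S a v = S a (u - v) by rewrite SD -[- v]scaleN1r SZ scaleN1r.
by rewrite SP.
Qed.

(** With b = 1/t, the operator A - b - s is a nonzero multiple of 1 - A/(b + s). The first bound in
    [r] gives |b + s| > |b|/2, and the second then keeps 1/(b + s) at distance less than [d] from
    [t]. *)
Lemma isolated_gap (A : H -> H) (t d : R) : t != 0 -> 0 < d ->
  (forall s, s != t -> `|s - t| < d -> exists c, bddbelow A (toC s) c) ->
  exists2 r : R, 0 < r & forall s, s != 0 -> `|s| < r ->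
    exists c, forall u, nn u <= c * nn (A u - toC t^-1 *: u - toC s *: u).
Proof.
move=> t0 d0 iso; pose b := t^-1.
have b0 : b != 0 by rewrite invr_eq0.
have nb : 0 < `|b| by rewrite normr_gt0.
pose r := Num.min (`|b| / 2) (d * (`|b| ^+ 2 / 2)).
have r0 : 0 < r by rewrite lt_min !mulr_gt0 ?exprn_gt0 ?invr_gt0.
exists r => // s s0; rewrite lt_min => /andP[s1 s2].
have bs : `|b| / 2 < `|b + s|.
  have := ler_normB (b + s) s; rewrite addrK; lra.
have bs0 : 0 < `|b + s| by apply: lt_trans bs; rewrite divr_gt0.
have nz : b + s != 0 by rewrite -normr_gt0.
have [c cP] : exists c, bddbelow A (toC (b + s)^-1) c.
  apply: iso.
    by apply: contra s0 => /eqP /(congr1 GRing.inv); rewrite invrK -/b => /eqP; rewrite -subr_eq0 addrC addKr.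
  have -> : (b + s)^-1 - t = - s / (b * (b + s)).
    by rewrite -[t]invrK -/b; field; rewrite b0 nz.
  rewrite normrM normrN normfV normrM ltr_pdivrMr ?mulr_gt0//.
  apply: lt_le_trans s2 _; rewrite ler_wpM2l ?(ltW d0)// expr2 -mulrA ler_wpM2l//.
  exact: ltW.
pose k := toC (b + s)^-1.
exists (c * abs2 k) => u; apply: le_trans (cP u) _.
have -> : u - k *: A u = - k *: (A u - toC b *: u - toC s *: u).
  rewrite -addrA -opprD -scalerDl -toCD scalerBr !scaleNr opprK addrC scalerA.
  by rewrite -toCM mulVf// scale1r.
by rewrite nnZ mulrA /abs2 /= sqrrN oppr0.
Qed.

Lemma family_no_isolated_eigenvalue w (t d : R) (u0 : H) n (e : 'I_n -> H) :
  compact [set: B] -> {morph iota : x y / x + y} ->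
  (forall u v (h : R), 0 < h -> exists r, forall a a' : plane, r <= `|a.1 - a'.1| ->
     `|dot (S a u) (S a' v)| <= h) ->
  t != 0 -> 0 < d ->
  (forall s, s != t -> `|s - t| < d -> exists c, bddbelow (T w) (toC s) c) ->
  eqv u0 (T w (toC t *: u0)) -> nn u0 != 0 ->
  (forall u, eqv u (T w (toC t *: u)) -> exists a, eqv u (\sum_(j < n) a j *: e j)) ->
  False.
Proof.
move=> cB im far t0 d0 iso u0P n0 span; have dP := semidot_dot H.
have N0 : 0 < nn u0 by rewrite lt_def n0 dot_ge0.
pose K u := T w u - toC t^-1 *: u.
have KS : symop K by exact: symop_shift.
have [r r0 rP] := isolated_gap t0 d0 iso.
have c0 : 0 < 3 / 4 * r ^+ 2 by rewrite mulr_gt0 ?exprn_gt0 ?divr_gt0.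
(* The kernel of [K] is the eigenspace, so its finite dimension is the spanning hypothesis. *)
have kerE u : nn (K u) = 0 -> eqv u (T w (toC t *: u)).
  move=> /eqvP h; apply: eqv_trans (eqv_sym (symopZr (TS w) t u)).
  by apply: eqv_sym; apply: eqv_trans (eqvZ (toC t) h) _; rewrite scalerA -toCM divff// scale1r.
have [h h0 hP] := finite_kernel KS c0 N0 (gap_range KS r0 rP) (fun k kk => span k (kerE k kk)).
(* Real and imaginary parts of the complex inner products must both be small, hence a second
   distance for [imag *: u0]. *)
have [r1 r1P] := far u0 u0 h h0; have [r2 r2P] := far (imag *: u0) u0 h h0.
have hN : 0 < h / nn u0 by rewrite divr_gt0.
have rm : 0 <= Num.max 0 (Num.max r1 r2) by rewrite le_max lexx.
have [x [xU xr]] := recurrent_points cB n.+1 im (Tcont hN) rm.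
apply: (hP (fun i => S (x i) u0)) => [i|i|i j /xr].
- exact: SP.
- have Tu : eqv (toC t^-1 *: u0) (T w u0).
    have := eqvZ (toC t^-1) (eqv_trans u0P (symopZr (TS w) t u0)).
    by rewrite scalerA -toCM mulVf// scale1r.
  (* By covariance the translate is an exact eigenvector of [T] at w + iota (x i). Applying [K] to
     it therefore gives the difference of the two operators, which norm continuity bounds. *)
  have E : eqv (toC t^-1 *: S (x i) u0) (T (w + iota (x i)) (S (x i) u0)).
    by rewrite -SZ; apply: eqv_trans (ST w (x i) u0); exact: S_eqv.
  rewrite /K (eqv_nn (eqvB (eqv_refl _) E)) (semidot_sym dP).
  apply: le_trans (xU i w _) _.
  by rewrite SP divfK.
- rewrite !ge_max => /and3P[_ h1 h2]; split; first exact: r1P.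
  by rewrite -SZ; exact: r2P.
Qed.
End covariant_family.

(** * The family over the Bohr compactification *)

Section hulls.
Variables (R : realType) (B : topologicalZmodType).
Local Notation C := (Cplx R).
Local Notation plane := (R * R)%type.

Lemma continuous_reC : continuous (@reC R).
Proof.
move=> z; have FF : Filter (nbhs z) by exact: (@nbhs_filter (Cplx R) z).
apply/cvgrPdist_lt => e e0.
have := (@cvg_complexP R C (nbhs z) FF id z).1 (fun P h => h) _ (exprn_gt0 2 e0).
apply: filterS => t h; rewrite -(@ltr_pXn2r _ 2)// ?nnegrE ?(ltW e0)// real_normK ?num_real//.
apply: le_lt_trans h; rewrite /abs2 reCD reCN -sqrrN opprB.
by rewrite lerDl sqr_ge0.
Qed.

Lemma continuous_imC : continuous (@imC R).
Proof.
move=> z; have FF : Filter (nbhs z) by exact: (@nbhs_filter (Cplx R) z).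
apply/cvgrPdist_lt => e e0.
have := (@cvg_complexP R C (nbhs z) FF id z).1 (fun P h => h) _ (exprn_gt0 2 e0).
apply: filterS => t h; rewrite -(@ltr_pXn2r _ 2)// ?nnegrE ?(ltW e0)// real_normK ?num_real//.
apply: le_lt_trans h; rewrite /abs2 imCD imCN -[X in X <= _]sqrrN opprB.
by rewrite lerDr sqr_ge0.
Qed.

Lemma herm_entry (M : 'M[C]_2) i j : M \is hermsymmx -> M i j = (M j i)^*.
Proof.
by move=> /is_hermitianmxP h; rewrite [in LHS]h expr0 scale1r !mxE.
Qed.

Section potential.
Variables (beta : B -> R) (Upsilon : B -> 'M[C]_2).
Hypotheses (cbeta : continuous beta) (cUpsilon : continuous Upsilon)
  (hermU : forall w, Upsilon w \is hermsymmx).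

(** The Pauli potential lifted to the group: its value at w + iota x is the potential of the
    operator with parameter [w] at the point [x]. *)
Definition hull_matrix (w : B) : 'M[C]_2 :=
  Upsilon w + diag_mx (\row_j (if j == 0 then toC (- beta w) else toC (beta w))).

Lemma hull_matrix_re i j : continuous (fun w => reC (hull_matrix w i j)).
Proof.
have cU : continuous (fun w => reC (Upsilon w i j)).
  move=> w; apply: (@continuous_comp _ _ _ (fun w => Upsilon w i j) (@reC R)); last exact: continuous_reC.
  by apply: (@continuous_comp _ _ _ Upsilon (fun M : 'M[C]_2 => M i j)); [exact: cUpsilon|exact: coord_continuous].
rewrite (_ : (fun w => _) = (fun w => reC (Upsilon w i j) + (if i == j then (if i == 0 then - 1 else 1) else 0) * beta w)).
  by move=> w; apply: cvgD; [exact: cU|apply: cvgM; [exact: cvg_cst|exact: cbeta]].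
apply/funext => w; rewrite !mxE reCD; congr (_ + _).
by case: eqP => _; case: eqP => _; rewrite ?mulr0n ?mulr1n ?mul0r ?mulN1r ?mul1r.
Qed.

Lemma hull_matrix_im i j : continuous (fun w => imC (hull_matrix w i j)).
Proof.
have cU : continuous (fun w => imC (Upsilon w i j)).
  move=> w; apply: (@continuous_comp _ _ _ (fun w => Upsilon w i j) (@imC R)); last exact: continuous_imC.
  by apply: (@continuous_comp _ _ _ Upsilon (fun M : 'M[C]_2 => M i j)); [exact: cUpsilon|exact: coord_continuous].
rewrite (_ : (fun w => _) = (fun w => imC (Upsilon w i j)))//.
apply/funext => w; rewrite !mxE imCD -[RHS]addr0; congr (_ + _).
by case: eqP => _; rewrite ?mulr0n ?mulr1n//; case: eqP.
Qed.

Lemma hull_matrix_herm w i j : hull_matrix w i j = (hull_matrix w j i)^*.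
Proof.
rewrite !mxE rmorphD (herm_entry i j (hermU w)); congr (_ + _).
rewrite (eq_sym j i); case: (i =P j) => [->|_]; rewrite ?mulr0n ?mulr1n ?rmorph0//.
have cr (r : R) : toC r = (toC r)^* :> C by rewrite conjCE /= oppr0.
by case: ifP => _; exact: cr.
Qed.

Hypothesis cB : compact [set: B].

Lemma hull_matrix_bounded : exists K : R, forall w i j, abs2 (hull_matrix w i j) <= K.
Proof.
have h i j : exists K : R, forall w, abs2 (hull_matrix w i j) <= K.
  have [K1 h1] := compact_continuous_bounded cB (@hull_matrix_re i j).
  have [K2 h2] := compact_continuous_bounded cB (@hull_matrix_im i j).
  exists (K1 ^+ 2 + K2 ^+ 2) => w; rewrite /abs2 lerD//.
    by rewrite -real_normK ?num_real// lerXn2r// nnegrE (le_trans _ (h1 w)).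
  by rewrite -real_normK ?num_real// lerXn2r// nnegrE (le_trans _ (h2 w)).
have [K KP] := choice (fun ij : 'I_2 * 'I_2 => h ij.1 ij.2).
exists (\sum_ij `|K ij|) => w i j; apply: le_trans (KP (i, j) w) _.
by rewrite (bigD1 (i, j))//=; apply: le_trans (ler_norm _) _; rewrite lerDl sumr_ge0.
Qed.

Lemma hull_matrix_translate (e : R) : 0 < e ->
  \forall k \near (0 : B), forall w i j, abs2 (hull_matrix (w + k) i j - hull_matrix w i j) <= e.
Proof.
(* For |x| < d <= 1 one has x^2 <= d <= e/2; real and imaginary parts take half of [e] each. *)
move=> e0; pose d := Num.min 1 (e / 2).
have d0 : 0 < d by rewrite lt_min ltr01 divr_gt0.
have d1 : d <= 1 by rewrite ge_min lexx.
have de : d <= e / 2 by rewrite ge_min lexx orbT.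
have sq x : `|x| < d -> x ^+ 2 <= e / 2.
  move=> xd; apply: le_trans de; rewrite -real_normK ?num_real// expr2.
  by rewrite -[leRHS]mulr1 ler_pM// ?(ltW xd)// (le_trans (ltW xd)).
have h : \forall k \near (0 : B), forall ij : 'I_2 * 'I_2, forall w,
    abs2 (hull_matrix (w + k) ij.1 ij.2 - hull_matrix w ij.1 ij.2) <= e.
  apply: filter_forall => -[i j] /=.
  have h1 := uniform_translate cB (@hull_matrix_re i j) d0.
  have h2 := uniform_translate cB (@hull_matrix_im i j) d0.
  apply: filterS2 h1 h2 => k h1 h2 w.
  by rewrite /abs2 reCD imCD reCN imCN (splitr e) lerD// sq.
by apply: filterS h => k h w i j; exact: (h (i, j)).
Qed.

Variables (iota : plane -> B) (ci : continuous iota).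

Lemma continuous_hull (phi : B -> R) w : continuous phi -> continuous (hull iota phi w).
Proof.
move=> cphi x; apply: (@continuous_comp _ _ _ (fun x => w + iota x) phi); last exact: cphi.
apply: (@continuous_comp _ _ _ (fun x : plane => (w, iota x)) (fun p : B * B => p.1 + p.2)).
  by apply: cvg_pair; [exact: cvg_cst|exact: ci].
exact: tvs.add_continuous.
Qed.

Lemma hull_matrix_potential K : (forall w i j, abs2 (hull_matrix w i j) <= K) ->
  forall w, matrix_potential (pauli_potential (hull iota beta w) (hull iota Upsilon w)) K.
Proof.
move=> hK w; split=> [i j|x i j]; last exact: hull_matrix_herm.
apply: measurable_continuousC => [||x]; last exact: hK.
- by have h := @continuous_hull _ w (@hull_matrix_re i j); exact: h.
- by have h := @continuous_hull _ w (@hull_matrix_im i j); exact: h.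
Qed.
End potential.
End hulls.

(** * Covariance, continuity and spectra of the Pauli family *)

Section family.
Variables (R : realType) (B : topologicalZmodType).
Local Notation C := (Cplx R).
Local Notation plane := (R * R)%type.
Local Notation H := (L2 R * L2 R)%type.
Local Notation nn u := (dot u u).
Variables (b0 : R) (iota : plane -> B) (alpha : B -> plane) (beta : B -> R) (Upsilon : B -> 'M[C]_2).
Hypotheses (cB : compact [set: B]) (im : {morph iota : x y / x + y}) (ci : continuous iota)
  (dI : dense (range iota)) (calpha : continuous alpha) (cbeta : continuous beta)
  (cUpsilon : continuous Upsilon) (hermU : forall w, Upsilon w \is hermsymmx).
Local Notation A w := (fun x => A0 b0 x + hull iota alpha w x).
Local Notation family := (pauli_family iota b0 alpha beta Upsilon).

Lemma continuous_fst_alpha : continuous (fst \o alpha).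
Proof. by move=> w; apply: continuous_comp; [exact: calpha|exact: cvg_fst]. Qed.
Lemma continuous_snd_alpha : continuous (snd \o alpha).
Proof. by move=> w; apply: continuous_comp; [exact: calpha|exact: cvg_snd]. Qed.

Lemma continuous_hull_potential w : continuous_potential (A w).
Proof.
split.
  have h := continuous_hull ci (w := w) continuous_fst_alpha.
  rewrite (_ : _ \o _ = (fun x : plane => - b0 / 2 * x.2 + hull iota (fst \o alpha) w x)).
    by move=> x; apply: cvgD; [apply: cvgM; [exact: cvg_cst|exact: cvg_snd]|exact: h].
  by apply/funext => x; rewrite /= /hull /=; lra.
have h := continuous_hull ci (w := w) continuous_snd_alpha.
rewrite (_ : _ \o _ = (fun x : plane => b0 / 2 * x.1 + hull iota (snd \o alpha) w x)).
  by move=> x; apply: cvgD; [apply: cvgM; [exact: cvg_cst|exact: cvg_fst]|exact: h].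
by apply/funext => x; rewrite /= /hull /=; lra.
Qed.

Variables (K : R) (hK : forall w i j, abs2 (hull_matrix beta Upsilon w i j) <= K).
Let WP := hull_matrix_potential cbeta cUpsilon hermU ci hK.
Variables (T : B -> H -> H)
  (TP : forall w f, weak_solution (spin_form (A w)) (shifted (WP w)) (T w f) f).
Let M : C := toC (4 * K + 2).

(* [A0 (x + a) = A0 x + A0 a]: the constant [A0 a] is removed by a phase. *)
Let gauge a : plane := - A0 b0 a.
Let S a : H -> H := strans (gauge a) a.

Lemma family_symop w : symop (T w).
Proof.
exact: (resolvent_symop (spin_form_domain (continuous_hull_potential w)) (shifted_coercive (WP w)) (TP w)).
Qed.

Lemma family_covariant w a f : eqv (S a (T w f)) (T (w + iota a) (S a f)).
Proof.
apply: (pauli_resolvent_covariant (continuous_hull_potential (w + iota a)) (TP w) (TP (w + iota a))).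
(* [A0 b0 a] is [a] rotated by a right angle and scaled, hence orthogonal to [a]. *)
- by rewrite /gauge /A0 /=; field.
- move=> x; rewrite /hull im (addrC (iota x)) addrA; apply/eqP; rewrite /gauge -subr_eq0; apply/eqP.
  rewrite /A0; set y := alpha _; case: y => y1 y2; congr pair => /=; lra.
- by move=> x; rewrite /pauli_potential /hull im (addrC (iota x)) addrA.
Qed.

(** [A0] cancels between the two potentials; what remains are translates of continuous functions on
    the compact group, uniformly close for small [k]. *)
Lemma family_continuous (e : R) : 0 < e ->
  \forall k \near (0 : B), forall w f, nn (T (w + k) f - T w f) <= e * nn f.
Proof.
move=> e0; pose d := e / 16; have d0 : 0 < d by rewrite divr_gt0.
pose r := Num.min 1 d.
have r0 : 0 < r by rewrite lt_min ltr01 d0.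
have r1 : r <= 1 by rewrite ge_min lexx.
have rd : r <= d by rewrite ge_min lexx orbT.
have sq x : `|x| < r -> x ^+ 2 <= d.
  move=> xr; apply: le_trans rd; rewrite -real_normK ?num_real// expr2.
  by rewrite -[leRHS]mulr1 ler_pM// ?(ltW xr)// (le_trans (ltW xr)).
have h1 := uniform_translate cB continuous_fst_alpha r0.
have h2 := uniform_translate cB continuous_snd_alpha r0.
have h3 := hull_matrix_translate cbeta cUpsilon cB d0.
apply: filterS3 h1 h2 h3 => k k1 k2 k3 w f.
have -> : e = 16 * d by rewrite /d; field.
have wk x : w + k + iota x = (w + iota x) + k by rewrite addrAC.
pose dA x := hull iota alpha (w + k) x - hull iota alpha w x.
have bd (phi : B -> R) : continuous phi -> (forall w, `|phi (w + k) - phi w| < r) ->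
    bounded_mult (fun x => toC (hull iota phi (w + k) x - hull iota phi w x)) d.
  move=> cphi kphi.
  have h := continuous_hull ci (w := w + k) cphi; have h' := continuous_hull ci (w := w) cphi.
  apply: measurable_continuousC.
  - rewrite (_ : _ \o _ = (fun x => hull iota phi (w + k) x - hull iota phi w x))//.
    by move=> x; apply: cvgB; [exact: h|exact: h'].
  - by rewrite (_ : _ \o _ = (fun x => 0))// => x; exact: cvg_cst.
  - by move=> x; rewrite /abs2 /= expr0n addr0 /hull wk sq.
apply: (pauli_resolvent_perturb (continuous_hull_potential (w + k)) (continuous_hull_potential w)
  (TP (w + k)) (TP w) d0 (d := dA)).
- by move=> x; rewrite /dA -[RHS]addrA [X in _ = _ + X]addrC subrK.
- exact: (bd (fst \o alpha) continuous_fst_alpha k1).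
- exact: (bd (snd \o alpha) continuous_snd_alpha k2).
- by move=> x i j; have := k3 (w + iota x) i j; rewrite -wk.
Qed.

Lemma family_spectrumP w z : spectrum (family w) z <-> ~ exists c, bddbelow (T w) (z + M) c.
Proof. exact: (spectrum_pauli (continuous_hull_potential w) (TP w)). Qed.

Lemma family_spectrum w w' : spectrum (family w) = spectrum (family w').
Proof.
have half v v' z : spectrum (family v) z -> spectrum (family v') z.
  move=> /family_spectrumP h; apply/family_spectrumP => -[c cP]; apply: h.
  exact: (family_bddbelow family_continuous (S := S) (fun a => strans_dot _ a)
    (fun a => stransD _ a) (fun a => stransZ _ a) family_covariant v dI cP).
by apply/seteqP; split=> z; exact: half.
Qed.

Lemma family_spectrum_real w z : spectrum (family w) z -> z = toC (reC z).
Proof.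
move=> /family_spectrumP h; apply: complex_eq => //=; apply/eqP.
apply: contra_notT h => z0.
by have := bddbelow_nonreal (family_symop w) (z := z + M); rewrite imCD addr0; exact.
Qed.

Definition real_spectrum w : set R := [set s | spectrum (family w) (toC s)].

Lemma family_real_spectrum w : spectrum (family w) = [set toC s | s in real_spectrum w].
Proof.
apply/seteqP; split=> [z zs|z [s ss <-]//].
by have zr := family_spectrum_real zs; exists (reC z); rewrite /real_spectrum /= -?zr.
Qed.

Lemma closed_real_spectrum w : closed (real_spectrum w).
Proof.
have arith (s t e : R) : 0 < e -> `|s - t| < Num.sqrt e -> (t - s) ^+ 2 < e.
  move=> e0 st; rewrite -[ltRHS](@sqr_sqrtr _ e) ?(ltW e0)// -real_normK ?num_real// distrC.
  by rewrite ltr_pXn2r// nnegrE sqrtr_ge0.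
rewrite -openC openE => s; rewrite /setC /interior /= /real_spectrum /=.
move=> hs; have [c cP] : exists c, bddbelow (T w) (toC s + M) c.
  by apply: contrapT => h; apply: hs; apply/family_spectrumP.
have [e e0 eP] := bddbelow_open (family_symop w) cP.
have s0 : 0 < Num.sqrt e by rewrite sqrtr_gt0.
apply/nbhs_ballP; exists (Num.sqrt e); first exact: s0.
move=> t st ht; apply: ((family_spectrumP w (toC t)).1 ht); move: st; rewrite /ball /= => st.
apply: eP; rewrite opprD addrACA subrr addr0 /abs2 /= oppr0 addr0 expr0n addr0.
exact: (arith s t e e0 st).
Qed.

Lemma family_discrete_spectrum w : discrete_spectrum (family w) = set0.
Proof.
apply/seteqP; split=> // z [[zs [U Uz UA]] [u0 eu0 nu0] [n [e [ee espan]]]].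
have zs' : spectrum (family w) z by move: zs; rewrite inE.
have zr := family_spectrum_real zs'.
(* [t] is the eigenvalue of the shifted operator, real because the spectrum is; 1/t is the
   corresponding eigenvalue of [T w]. *)
pose t := reC z + (4 * K + 2); have zM : z + M = toC t by rewrite zr /M /t toCD.
have cA := continuous_hull_potential w.
have eP u : eigenspace (family w) z (spin u) <-> eqv u (T w (toC t *: u)).
  by rewrite -zM; exact: (eigenspace_pauli cA (TP w)).
have Hu0 : in_L2s u0 by exact: pauli_in_L2 eu0.
have He k : in_L2s (e k) by exact: pauli_in_L2 (ee k).
(* A real s near t without a lower bound would put s - (4 K + 2) in the spectrum inside the
   isolating neighbourhood of [z], so s would be [t]. *)
have [d d0 iso] : exists2 d : R, 0 < d & forall s, s != t -> `|s - t| < d ->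
    exists c, bddbelow (T w) (toC s) c.
  move: Uz => /nbhs_ballP[r /pos_toC[d d0 ->]] ball_U; exists d => // s st sd.
  apply: contrapT => h.
  have zsE : toC s = toC (s - (4 * K + 2)) + M by rewrite /M -toCD subrK.
  have : (U `&` spectrum (family w)) (toC (s - (4 * K + 2))).
    split; last by apply/family_spectrumP; rewrite -zsE.
    apply: ball_U; rewrite /ball /= norm_lt_toC// zr /abs2 /= oppr0 addr0 expr0n addr0.
    rewrite -real_normK ?num_real// ltr_pXn2r// ?nnegrE ?(ltW d0)//.
    by rewrite distrC (_ : s - (4 * K + 2) - reC z = s - t)//; rewrite /t; ring.
  rewrite UA /= => E; move: st => /eqP; apply.
  by rewrite /t -E /= subrK.
have e0P := (eP (unspin Hu0)).1; rewrite unspinK in e0P.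
have n0 : nn (unspin Hu0) != 0.
  apply/eqP => h; apply: nu0; rewrite -(unspinK Hu0).
  rewrite (_ : (fun=> 0) = spin 0); last first.
    by apply/funext => x; apply/matrixP => i j; rewrite !mxE; case: ifP.
  by apply/spin_ae/eqvP; rewrite subr0.
(* For t = 0 the eigenvector would be equivalent to [T w] applied to a null vector, hence null. *)
have t0 : t != 0.
  apply: contra n0 => /eqP t0; have := e0P eu0; rewrite t0 => h; apply/eqP.
  have [c _ cP] := symop_bdd (family_symop w); rewrite (eqv_nn h).
  apply: le_anti; rewrite dot_ge0 andbT; apply: le_trans (cP _) _.
  by rewrite nnZ /abs2 /= expr0n addr0 mul0r mulr0.
apply: (family_no_isolated_eigenvalue family_symop family_continuous (S := S) (fun a => strans_dot _ a)
  (fun a => stransD _ a) (fun a => stransZ _ a) family_covariant (w := w) (t := t) (d := d)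
  (u0 := unspin Hu0) (n := n) (e := fun k => unspin (He k)) cB im _ t0 d0 iso (e0P eu0) n0).
  by move=> u v h h0; have [r rP] := strans_far u v h0; exists r => a a'; exact: rP.
move=> u /eP eu; have [c cP] := espan _ eu; exists c; apply/spin_ae.
rewrite (_ : spin (\sum_(j < n) _) = (fun x => \sum_(k < n) c k *: e k x))//.
apply/funext => x; elim/big_rec2: _ => [|k y1 y2 _ <-].
  by apply/matrixP => i j; rewrite !mxE; case: ifP.
rewrite -[in RHS](unspinK (He k)).
by apply/matrixP => i j; rewrite !mxE; case: ifP.
Qed.
End family.

Theorem corollary3p3 (R : realType)
    (b : R * R -> R) (b0 : R) (V : R * R -> 'M[Cplx R]_2)
    (Atilde : R * R -> R * R)
    (b_cap : CAP_real b) (b_mean : has_mean_value b b0)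
    (V_cap : CAP_herm V)
    (Atilde_cap : CAP_vec Atilde)
    (Atilde_C1 : class_C 1 (fst \o Atilde) /\ class_C 1 (snd \o Atilde))
    (curlA : forall x, curl (fun y => A0 b0 y + Atilde y) x = b x)
    (B : topologicalZmodType) (iota : R * R -> B) (Bohr : is_Bohr iota)
    (P : probability (borel_type B) R) (Haar : is_Haar P)
    (alpha : B -> R * R) (beta : B -> R) (Upsilon : B -> 'M[Cplx R]_2)
    (alpha_ext : canonic_extension iota Atilde alpha)
    (beta_ext : canonic_extension iota b beta)
    (Upsilon_ext : canonic_extension iota V Upsilon)
    (Upsilon_herm : forall w, Upsilon w \is hermsymmx) :
  let Hfam := pauli_family iota b0 alpha beta Upsilon in
  let H := pauli (fun x => A0 b0 x + Atilde x) b V in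
  (exists Sigma : set R, almost_sure_spectrum P Hfam Sigma) /\
  (forall Sigma : set R, almost_sure_spectrum P Hfam Sigma ->
     forall w : B, spectrum (Hfam w) = [set toC s | s in Sigma] /\
                   discrete_spectrum (Hfam w) = set0) /\
  (Hfam 0 = H /\ discrete_spectrum H = set0).
Proof.
move=> Hfam H.
have [calpha alphaE] := alpha_ext; have [cbeta betaE] := beta_ext.
have [cU UE] := Upsilon_ext; have [cB _ im ci dI _] := Bohr.
have [K hK] := hull_matrix_bounded cbeta cU cB.
pose WP := hull_matrix_potential cbeta cU Upsilon_herm ci hK.
have cA := continuous_hull_potential b0 ci calpha.
have [T TP] := choice (fun w => resolvent_exists (spin_form_domain (cA w)) (shifted_coercive (WP w))).
have H0 : Hfam 0 = H.
  have hull0 (X : Type) (phi : B -> X) : hull iota phi 0 = phi \o iota.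
    by apply/funext => x; rewrite /hull add0r.
  by rewrite /Hfam /pauli_family !hull0 -alphaE -betaE -UE.
have spec w w' : spectrum (Hfam w) = spectrum (Hfam w') := family_spectrum cB im dI calpha TP w w'.
have disc w : discrete_spectrum (Hfam w) = set0 := family_discrete_spectrum cB im calpha TP w.
split; last split.
- exists (real_spectrum b0 iota alpha beta Upsilon 0); split.
    exact: (closed_real_spectrum calpha TP).
  apply: aeW => w; rewrite (spec w 0).
  exact: (family_real_spectrum calpha TP 0).
- move=> Sigma [_ ae] w; split; last exact: disc.
  (* A single parameter with spectrum [Sigma] suffices, and one exists: otherwise the exceptional
     null set would be the whole space, of probability one. *)
  have [w' w'P] : exists w', spectrum (Hfam w') = [set toC s | s in Sigma].
    apply: contrapT => h; move: ae => [N [mN N0 subN]].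
    have NT : N = setT.
      apply/seteqP; split=> w' _; first exact: I.
      by apply: subN => h'; apply: h; exists w'.
    by move: N0; rewrite NT probability_setT => /eqP; rewrite onee_eq0.
  by rewrite (spec w w').
- by split; [exact: H0|rewrite -H0; exact: disc].
Qed.
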